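(* Let $U:\mathbb{T}^3\to\mathbb{R}^3$ be alpha-unstable. Then there exist $\boldsymbol{j}_\star\in\mathbb{R}^3$ with $|\boldsymbol{j}_\star|\le 1$, $p_\star\in\mathbb{C}$ with $\mathrm{Re}(p_\star)>0$, and a non-zero $H\in L^2(\mathbb{T}^3;\mathbb{C}^3)$ such that $$(\nabla+i\boldsymbol{j}_\star)\times(U\times H)+(\nabla+i\boldsymbol{j}_\star)^2H=p_\star H,\qquad (\nabla+i\boldsymbol{j}_\star)\cdot H=0\qquad\text{on }\mathbb{T}^3.$$
   Context: $\mathbb{T}^3=(\mathbb{R}/2\pi\mathbb{Z})^3$, and $\fint_{\mathbb{T}^3}$ denotes the average over $\mathbb{T}^3$. For $\boldsymbol{j}\in\mathbb{R}^3$, $(\nabla+i\boldsymbol{j})^2H=\Delta H+2i\,\boldsymbol{j}\cdot\nabla H-|\boldsymbol{j}|^2H$. Definition (alpha-unstable). Let $U\in C^\infty(\mathbb{T}^3;\mathbb{R}^3)$ be mean-free and divergence-free with $\|\nabla U\|_{L^\infty}<1$. For $v\in\mathbb{C}^3$ let $\mathcal{S}(v)=S\in L^2(\mathbb{T}^3;\mathbb{C}^3)$ be the unique solution of $$\nabla\times(U\times S)+\Delta S=\nabla\times(v\times U),\qquad \int_{\mathbb{T}^3}S\,dx=0,$$ and for $\boldsymbol{j}\in\mathbb{R}^3\setminus\{0\}$ define the matrix $A=A(U,\boldsymbol{j})\in\mathbb{C}^{3\times3}$ by $Av=i\frac{\boldsymbol{j}}{|\boldsymbol{j}|}\times\fint_{\mathbb{T}^3}U\times\mathcal{S}(v)$,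 $v\in\mathbb{C}^3$. Then $U$ is alpha-unstable if there exist a non-zero $\boldsymbol{j}\in\mathbb{R}^3$ and a simple eigenvalue $\mu\in\mathbb{C}$ of $A(U,\boldsymbol{j})$ with $\mathrm{Re}(\mu)>0$. *)

(* Defs.v *)
From HB Require Import structures.
From mathcomp Require Import all_boot all_order all_algebra.
From mathcomp Require Import complex.
From mathcomp Require Import all_classical all_reals all_analysis.

Set Implicit Arguments.
Unset Strict Implicit.
Unset Printing Implicit Defensive.

Import Order.TTheory GRing.Theory Num.Theory.
Import numFieldNormedType.Exports.

Local Open Scope classical_set_scope.
Local Open Scope ring_scope.

(** Functions on the torus T^3 = (R / 2 pi Z)^3 are the functions on
    R^3 = R * R * R that are 2 pi-periodic in each coordinate; integrals over
    T^3 are Lebesgue integrals over the cube [0, 2 pi]^3.  Vectors of R^3 and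
    C^3 that are not points of the torus are column vectors. *)

Section Torus.
Context {R : realType}.
Local Notation C := (R[i])%C.
Local Notation R3 := (R * R * R)%type.

Definition basis_vec (k : 'I_3) : R3 :=
  ((val k == 0%N)%:R, (val k == 1%N)%:R, (val k == 2%N)%:R).

Definition periodic (T : Type) (f : R3 -> T) :=
  forall (k : 'I_3) (x : R3), f (x + (2 * pi) *: basis_vec k) = f x.

Definition leb3 := ((@lebesgue_measure R \x @lebesgue_measure R)
                      \x @lebesgue_measure R)%E.

Definition cube : set R3 := `[0, 2 * pi] `*` `[0, 2 * pi] `*` `[0, 2 * pi].

Definition cintegral (f : R3 -> C) : C :=
  Complex (Rintegral leb3 cube (fun x => complex.Re (f x)))
          (Rintegral leb3 cube (fun x => complex.Im (f x))).

Definition vintegral (F : R3 -> 'cV[C]_3) : 'cV[C]_3 :=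
  \col_k cintegral (fun x => F x k 0).

Definition vaverage (F : R3 -> 'cV[C]_3) : 'cV[C]_3 :=
  ((2 * pi) ^- 3)%:C%C *: vintegral F.

Definition partial (k : 'I_3) (f : R3 -> R) : R3 -> R :=
  fun x => 'D_(basis_vec k) f x.

(** C^oo: all iterated partial derivatives are differentiable everywhere. *)
Definition smooth (f : R3 -> R) :=
  forall (s : seq 'I_3) (x : R3), differentiable (foldr partial f s) x.

(** The sup norm is the default norm on column vectors; the Euclidean one is
    needed here. *)
Definition enorm n (w : 'cV[R]_n) : R := Num.sqrt (\sum_k w k 0 ^+ 2).

Definition opnorm (M : 'M[R]_3) : R :=
  sup [set enorm (M *m w) | w in [set w | enorm w <= 1]].

Definition jacobian (U : R3 -> 'cV[R]_3) (x : R3) : 'M[R]_3 :=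
  \matrix_(k, l) partial l (fun y => U y k 0) x.

(** Indices in 'I_3 are added modulo 3. *)
Definition cross (a b : 'cV[C]_3) : 'cV[C]_3 :=
  \col_k (a (k + 1) 0 * b (k + 2) 0 - a (k + 2) 0 * b (k + 1) 0).

Definition cvec (w : 'cV[R]_3) : 'cV[C]_3 := map_mx (fun r : R => r%:C%C) w.

(** L^2(T^3; C^3), without identification of a.e. equal functions. *)
Definition L2 (F : R3 -> 'cV[C]_3) :=
  [/\ periodic F,
      forall k, measurable_fun setT (fun x => complex.Re (F x k 0)),
      forall k, measurable_fun setT (fun x => complex.Im (F x k 0)) &
      (\int[leb3]_(x in cube)
        (\sum_k (complex.Re (F x k 0) ^+ 2 + complex.Im (F x k 0) ^+ 2))%:E
          < +oo)%E].

(** Differential equations for L^2 functions are read in the sense of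
    distributions on T^3.  Real-valued test functions suffice by linearity.
    A functional on R3 -> R only matters through its values on test
    functions, see [distr_eq]. *)
Definition test (phi : R3 -> R) := smooth phi /\ periodic phi.

Definition distr := (R3 -> R) -> C.

Definition distr_eq (S T : distr) := forall phi, test phi -> S phi = T phi.

Definition distr_of (F : R3 -> 'cV[C]_3) (k : 'I_3) : distr :=
  fun phi => cintegral (fun x => F x k 0 * (phi x)%:C%C).

Definition dpartial (k : 'I_3) (T : distr) : distr :=
  fun phi => - T (partial k phi).

(** The [k]-th component of nabla + i j. *)
Definition nabla (j : 'cV[R]_3) (k : 'I_3) (T : distr) : distr :=
  fun phi => dpartial k T phi + 'i%C * (j k 0)%:C%C * T phi.

Definition curl (j : 'cV[R]_3) (T : 'I_3 -> distr) (k : 'I_3) : distr :=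
  fun phi => nabla j (k + 1) (T (k + 2)) phi - nabla j (k + 2) (T (k + 1)) phi.

Definition div (j : 'cV[R]_3) (T : 'I_3 -> distr) : distr :=
  fun phi => \sum_k nabla j k (T k) phi.

Definition laplacian (T : distr) : distr :=
  fun phi => \sum_k dpartial k (dpartial k T) phi.

(** (nabla + i j)^2 *)
Definition nabla_sq (j : 'cV[R]_3) (T : distr) : distr :=
  fun phi => laplacian T phi
           + 2 * 'i%C * (\sum_k (j k 0)%:C%C * dpartial k T phi)
           - (enorm j ^+ 2)%:C%C * T phi.

Definition admissible (U : R3 -> 'cV[R]_3) :=
  [/\ forall k, smooth (fun x => U x k 0),
      periodic U,
      forall k, Rintegral leb3 cube (fun x => U x k 0) = 0,
      forall x, \sum_k partial k (fun y => U y k 0) x = 0 &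
      (Lnorm leb3 +oo (fun x => (opnorm (jacobian U x))%:E) < 1)%E].

Definition is_corrector (U : R3 -> 'cV[R]_3) (v : 'cV[C]_3)
    (S : R3 -> 'cV[C]_3) :=
  [/\ L2 S,
      vintegral S = 0 &
      forall k, distr_eq
        (fun phi => curl 0 (distr_of (fun x => cross (cvec (U x)) (S x))) k phi
                  + laplacian (distr_of S k) phi)
        (curl 0 (distr_of (fun x => cross v (cvec (U x)))) k)].

(** Definite description of the (a.e. unique) solution. *)
Definition corrector (U : R3 -> 'cV[R]_3) (v : 'cV[C]_3) : R3 -> 'cV[C]_3 :=
  xget (fun=> 0) [set S | is_corrector U v S].

Definition is_alpha_matrix (U : R3 -> 'cV[R]_3) (j : 'cV[R]_3) (A : 'M[C]_3) :=
  forall v : 'cV[C]_3,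
    A *m v = 'i%C *: cross (cvec ((enorm j)^-1 *: j))
               (vaverage (fun x => cross (cvec (U x)) (corrector U v x))).

Definition simple_eigenvalue n (A : 'M[C]_n) (mu : C) :=
  mup mu (char_poly A) = 1%N.

Definition alpha_unstable (U : R3 -> 'cV[R]_3) :=
  admissible U /\
  exists (j : 'cV[R]_3) (A : 'M[C]_3) (mu : C),
    [/\ j != 0, is_alpha_matrix U j A, simple_eigenvalue A mu
      & 0 < complex.Re mu].

End Torus.

(* Main.v *)
(** For j = t e with e a unit vector and p = t q, the k-th Fourier mode (k <> 0)
    of the eigenvalue problem reads (|k + j|^2 + p) a_k = i (k + j) x (U x a)_k.
    Since |grad U| < 1, an energy estimate makes these equations uniquely
    solvable, uniformly in small t, once the mean a_0 = h is prescribed, and for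
    t = p = 0 the solution is h plus the corrector S(h).  The equation for k = 0
    becomes q h = i e x (U x a)_0 - t h, that is (q - A - E_t(q)) h = 0 with E_t
    of size O(t) in the Lipschitz norm.  As mu is a simple eigenvalue of A, for
    small t the determinant has a zero q near mu, found by contraction. *)

From HB Require Import structures.
Require Import Defs.
From mathcomp Require Import all_boot all_order all_algebra.
From mathcomp Require Import complex.
From mathcomp Require Import all_classical all_reals all_analysis.
From mathcomp Require Import perm ess_sup_inf measurable_realfun ring lra zify.
Import Order.TTheory GRing.Theory Num.Theory.
Import numFieldNormedType.Exports.
Local Open Scope classical_set_scope.
Local Open Scope ring_scope.

Set Implicit Arguments.
Unset Strict Implicit.
Unset Printing Implicit Defensive.

(** Everything is reduced to families of Fourier coefficients indexed by Z^3: weights [rho k ^- s]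
    play the role of Sobolev norms, and limits carry an explicit rate 1/(N+1). One obstacle is that
    the statement speaks of distributions and of an L^2 corrector picked by a definite description.
    Fourier inversion for smooth test functions makes a distributional equation equivalent to its
    mode equations, and a bootstrap shows that every L^2 corrector has rapidly decaying
    coefficients. The bound |grad U| < 1 is measured against the lowest nonzero eigenvalue of the
    negative Laplacian, which is 1: after integration by parts, curl (U x T) tested with T costs at
    most sup |grad U| times the squared norm of T. This requires T to be divergence-free for nabla +
    ij, which inhomogeneous truncated systems do not grant, whence a splitting of their solutions.
    Solutions are limits of Galerkin solutions on boxes of modes, where existence is injectivity in
    finite dimension. The error E_t depends on the unknown q itself, through p = tq; hence the
    Lipschitz norm. *)

Local Notation periodic := Defs.periodic.

(** * Real and imaginary parts, conjugation and modulus of complex numbers *)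

Section ComplexModulus.
Context {R : realType}.
Local Notation C := (R[i])%C.
Local Notation cm := (@Normc.normc R).
Local Notation Re := (@complex.Re R).
Local Notation Im := (@complex.Im R).
Implicit Types z w : C.

Lemma ReD z w : Re (z + w) = Re z + Re w. Proof. by case: z; case: w. Qed.
Lemma ImD z w : Im (z + w) = Im z + Im w. Proof. by case: z; case: w. Qed.
Lemma ReN z : Re (- z) = - Re z. Proof. by case: z. Qed.
Lemma ImN z : Im (- z) = - Im z. Proof. by case: z. Qed.
Lemma ReM z w : Re (z * w) = Re z * Re w - Im z * Im w.
Proof. by case: z; case: w. Qed.
Lemma ImM z w : Im (z * w) = Re z * Im w + Im z * Re w.
Proof. by case: z; case: w. Qed.
Lemma Re_conj z : Re z^*%C = Re z. Proof. by case: z. Qed.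
Lemma Im_conj z : Im z^*%C = - Im z. Proof. by case: z. Qed.
Lemma Re_sum (I : Type) (r : seq I) (P : pred I) (F : I -> C) :
  Re (\sum_(i <- r | P i) F i) = \sum_(i <- r | P i) Re (F i).
Proof. by apply: (big_morph Re ReD). Qed.
Lemma complex_ext z w : Re z = Re w -> Im z = Im w -> z = w.
Proof. by case: z; case: w => /= a b c d -> ->. Qed.

Lemma cm_ge0 z : 0 <= cm z. Proof. by case: z => a b; exact: sqrtr_ge0. Qed.
Lemma cm0 : cm 0 = 0. Proof. exact: Normc.normc0. Qed.
Lemma cm1 : cm 1 = 1. Proof. exact: Normc.normc1. Qed.
Lemma cmM z w : cm (z * w) = cm z * cm w. Proof. exact: Normc.normcM. Qed.
Lemma cmV z : cm z^-1 = (cm z)^-1. Proof. exact: Normc.normcV. Qed.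
Lemma cmD z w : cm (z + w) <= cm z + cm w. Proof. exact: le_normcD. Qed.
Lemma cmN z : cm (- z) = cm z. Proof. exact: normcN. Qed.
Lemma cmB z w : cm (z - w) <= cm z + cm w.
Proof. by rewrite (le_trans (cmD _ _))// cmN. Qed.
Lemma cm_eq0 z : (cm z == 0) = (z == 0).
Proof. by apply/eqP/eqP => [/Normc.eq0_normc//|->]; exact: cm0. Qed.
Lemma cm_gt0 z : (0 < cm z) = (z != 0).
Proof. by rewrite lt_neqAle cm_ge0 andbT eq_sym cm_eq0. Qed.
Lemma cm_sqr z : cm z ^+ 2 = Re z ^+ 2 + Im z ^+ 2.
Proof. by case: z => a b; rewrite /= sqr_sqrtr// addr_ge0// sqr_ge0. Qed.
Lemma cm_conj z : cm z^*%C = cm z.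
Proof. by case: z => a b /=; rewrite sqrrN. Qed.
Lemma cmR (r : R) : cm r%:C%C = `|r|.
Proof. by rewrite /= expr0n/= addr0 sqrtr_sqr. Qed.
Lemma cm_i : cm 'i%C = 1.
Proof. by rewrite /= expr0n/= add0r expr1n sqrtr1. Qed.
Lemma cmX z n : cm (z ^+ n) = cm z ^+ n.
Proof. by elim: n => [|n IH]; rewrite ?expr0 ?cm1// !exprS cmM IH. Qed.
Lemma cm_sum (I : Type) (r : seq I) (P : pred I) (F : I -> C) :
  cm (\sum_(i <- r | P i) F i) <= \sum_(i <- r | P i) cm (F i).
Proof.
elim/big_ind2: _ => [|x a y b xa yb|//]; first by rewrite cm0.
by rewrite (le_trans (cmD _ _))// lerD.
Qed.
Lemma Re_le_cm z : `|Re z| <= cm z.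
Proof.
rewrite -(@ler_pXn2r _ 2)// ?nnegrE ?cm_ge0//.
by rewrite cm_sqr real_normK ?num_real// lerDl sqr_ge0.
Qed.
Lemma Im_le_cm z : `|Im z| <= cm z.
Proof.
rewrite -(@ler_pXn2r _ 2)// ?nnegrE ?cm_ge0//.
by rewrite cm_sqr real_normK ?num_real// lerDr sqr_ge0.
Qed.
Lemma cm_le z : cm z <= `|Re z| + `|Im z|.
Proof.
rewrite -(@ler_pXn2r _ 2)// ?nnegrE ?cm_ge0 ?addr_ge0//.
rewrite cm_sqr sqrrD !real_normK ?num_real//.
by rewrite addrAC lerDl mulrn_wge0// mulr_ge0.
Qed.
Lemma mul_conj z : z * z^*%C = ((cm z) ^+ 2)%:C%C.
Proof.
apply: complex_ext; rewrite ?ReM ?ImM Re_conj Im_conj /=.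
  by rewrite cm_sqr; ring.
by ring.
Qed.
Lemma conjD z w : (z + w)^*%C = z^*%C + w^*%C.
Proof. by apply: complex_ext; rewrite !(Re_conj, Im_conj, ReD, ImD) ?opprD. Qed.
Lemma conjM z w : (z * w)^*%C = z^*%C * w^*%C.
Proof. by apply: complex_ext; rewrite !(Re_conj, Im_conj, ReM, ImM); ring. Qed.
Lemma conjK z : z^*%C^*%C = z.
Proof. by case: z => a b /=; rewrite opprK. Qed.
Lemma conj_real (r : R) : r%:C%C^*%C = r%:C%C.
Proof. by apply: complex_ext; rewrite ?Re_conj ?Im_conj //= oppr0. Qed.
Lemma conj_i : ('i%C : C)^*%C = - 'i%C.
Proof. by apply: complex_ext; rewrite ?Re_conj ?Im_conj ?ReN ?ImN //= oppr0. Qed.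
Lemma conj_sum (I : Type) (r : seq I) (P : pred I) (F : I -> C) :
  (\sum_(i <- r | P i) F i)^*%C = \sum_(i <- r | P i) (F i)^*%C.
Proof. by apply: (big_morph _ conjD); apply: complex_ext; rewrite /= ?oppr0. Qed.
End ComplexModulus.

(** * Fubini for integrals that vanish slice by slice *)

Section SlicedIntegral.
Context d1 d2 (T1 : measurableType d1) (T2 : measurableType d2) (R : realType).
Variable m1 : {sigma_finite_measure set T1 -> \bar R}.
Variable m2 : {sigma_finite_measure set T2 -> \bar R}.
Variables (A : set T1) (B : set T2) (f : T1 * T2 -> \bar R).
Hypotheses (mA : measurable A) (mB : measurable B).
Hypothesis if_ : (m1 \x m2)%E.-integrable (A `*` B) f.

Let iF : (m1 \x m2)%E.-integrable setT (f \_ (A `*` B)).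
Proof. exact: (integrable_mkcond f (measurableX mA mB)).1 if_. Qed.

Lemma integral_slice2 : (forall x, \int[m2]_(y in B) f (x, y) = 0)%E ->
  (\int[m1 \x m2]_(z in A `*` B) f z = 0)%E.
Proof.
move=> f0; rewrite integral_mkcond -integral12_prod_meas1//.
rewrite (eq_integral (fun=> 0%E)) ?integral0// => x _; rewrite /fubini_F.
case: (boolP (x \in A)) => xA.
  rewrite -[RHS](f0 x) [RHS]integral_mkcond; apply: eq_integral => y _.
  by rewrite !patchE in_setX xA.
rewrite (eq_integral (fun=> 0%E)) ?integral0// => y _.
by rewrite patchE in_setX (negbTE xA).
Qed.

Lemma integral_slice1 : (forall y, B y -> \int[m1]_(x in A) f (x, y) = 0)%E ->
  (\int[m1 \x m2]_(z in A `*` B) f z = 0)%E.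
Proof.
move=> f0; rewrite integral_mkcond -integral21_prod_meas1//.
rewrite (eq_integral (fun=> 0%E)) ?integral0// => y _; rewrite /fubini_G.
case: (boolP (y \in B)) => yB.
  rewrite -[RHS](f0 y (set_mem yB)) [RHS]integral_mkcond; apply: eq_integral => x _.
  by rewrite !patchE in_setX yB andbT.
rewrite (eq_integral (fun=> 0%E)) ?integral0// => x _.
by rewrite patchE in_setX (negbTE yB) andbF.
Qed.
End SlicedIntegral.

(** * Measurability and integration over the periodicity cube *)

Section CubeIntegral.
Context {R : realType}.
Local Notation R3 := (R * R * R)%type.
Implicit Types (f g : R3 -> R).

Let grid (n : nat) (t : R) : R := (Num.floor (t * n.+1%:R))%:~R / n.+1%:R.

Let grid_cvg (t : R) : grid ^~ t @ \oo --> t.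
Proof.
apply/cvgrPdist_le => /= e e0.
near=> n.
have n0 : 0 < n.+1%:R :> R by rewrite ltr0n.
have /andP[h1 h2] := floor_itv (t * n.+1%:R).
have -> : t - grid n t = (t * n.+1%:R - (Num.floor (t * n.+1%:R))%:~R) / n.+1%:R.
  by rewrite mulrBl mulfK// gt_eqF.
rewrite ger0_norm; last by rewrite divr_ge0 ?subr_ge0// ltW.
apply: (@le_trans _ _ (n.+1%:R^-1)).
  rewrite -[leRHS]mul1r ler_wpM2r ?invr_ge0 ?(ltW n0)//.
  by move: h2; rewrite intrD => h2; rewrite lerBlDl ltW.
near: n; by apply: filterS (near_infty_natSinv_lt (PosNum e0)) => n /ltW.
Unshelve. all: by end_near. Qed.

Let grid3_cvg (x : R3) :
  (fun n => (grid n x.1.1, grid n x.1.2, grid n x.2)) @ \oo --> x.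
Proof.
case: x => [[a b] c].
exact: (cvg_pair (cvg_pair (grid_cvg (t := a)) (grid_cvg (t := b))) (grid_cvg (t := c))).
Qed.

(** The measurable sets of R^3 are those of the product structure. Rounding every coordinate down to
    a multiple of 1/(n+1) writes [f] as a pointwise limit of functions that are constant on
    countably many half-open boxes, each of them a product of intervals. *)
Lemma continuous_measurable3 f : continuous f -> measurable_fun setT f.
Proof.
move=> cf.
pose h n (x : R3) : R := f (grid n x.1.1, grid n x.1.2, grid n x.2).
apply: (@measurable_fun_cvg _ _ _ _ h); last first.
  move=> x _; exact: cvg_comp (@grid3_cvg x) (cf x).
move=> n _ Y mY; rewrite setTI.
pose cell (q : int * int * int) : set R3 :=
  if f (q.1.1%:~R / n.+1%:R, q.1.2%:~R / n.+1%:R, q.2%:~R / n.+1%:R) \in Y then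
  [set x | [/\ Num.floor (x.1.1 * n.+1%:R) = q.1.1, Num.floor (x.1.2 * n.+1%:R) = q.1.2
     & Num.floor (x.2 * n.+1%:R) = q.2] ] else set0.
have -> : h n @^-1` Y = \bigcup_q cell q.
  apply/seteqP; split.
    move=> x Yx; exists (Num.floor (x.1.1 * n.+1%:R), Num.floor (x.1.2 * n.+1%:R), Num.floor (x.2 * n.+1%:R)) => //.
    by rewrite /cell/= mem_set.
  move=> x [[[a b] c] _]; rewrite /cell/=; case: ifPn => // /set_mem Yx [Ea Eb Ec].
  by move: Yx; rewrite /h /grid Ea Eb Ec.
apply: countable_bigcupT_measurable => // -[[a b] c]; rewrite /cell/=; case: ifP => // _.
pose I (z : int) : set R := [set` `[z%:~R / n.+1%:R, (z + 1)%:~R / n.+1%:R[].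
have IE (z : int) t : Num.floor (t * n.+1%:R) = z <-> I z t.
  rewrite /I/= in_itv/= ler_pdivrMr ?ltr0n// ltr_pdivlMr ?ltr0n//.
  split; first by move=> <-; exact: floor_itv.
  by move=> /floor_def.
have -> : [set x : R3 | [/\ Num.floor (x.1.1 * n.+1%:R) = a, Num.floor (x.1.2 * n.+1%:R) = b
     & Num.floor (x.2 * n.+1%:R) = c] ] = I a `*` I b `*` I c.
  apply/seteqP; split => [[[x y] z] /= [/IE ? /IE ? /IE ?] //|[[x y] z] /= [[/IE ? /IE ?] /IE ?]//].
by apply: measurableX; [apply: measurableX|]; exact: measurable_itv.
Qed.

Local Notation mu := (@lebesgue_measure R).
Local Notation mu2 := (mu \x mu)%E.
Local Notation mu3 := (mu2 \x mu)%E.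
Local Notation T1 := (measurableTypeR R).
Local Notation T3 := (T1 * T1 * T1)%type.

Lemma measurable_cube : measurable (@cube R : set T3).
Proof. by apply: measurableX; [apply: measurableX|]; exact: measurable_itv. Qed.

Lemma twopi_gt0 : 0 < 2 * pi :> R.
Proof. by rewrite mulr_gt0// pi_gt0. Qed.

Lemma leb3_cube : leb3 (@cube R) = ((2 * pi) ^+ 3)%:E.
Proof.
rewrite /leb3 /cube product_measure1E//=; last by apply: measurableX.
rewrite product_measure1E//= lebesgue_measure_itv/= lte_fin twopi_gt0 oppr0 adde0.
by rewrite -!EFinM !exprS expr0 mulr1 mulrA.
Qed.

Lemma cube_integrable f M : measurable_fun setT f -> (forall x, `|f x| <= M) ->
  mu3.-integrable (@cube R) (EFin \o f).
Proof.
move=> mf fM; apply: measurable_bounded_integrable.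
- exact: measurable_cube.
- by have := ltry ((2 * pi) ^+ 3 : R); rewrite -leb3_cube.
- exact: measurable_funTS.
- exists M; split; first exact: num_real.
  by move=> x Mx y _; exact: le_trans (fM y) (ltW Mx).
Qed.

Local Notation I := (`[0, 2 * pi]%classic : set R).

(** Naming the planar measure lets it carry its own sigma-finite structure, which Fubini for the
    outer product in [leb3] asks for. *)
Definition leb2 := (mu \x mu)%E.
HB.instance Definition _ := Measure.on leb2.

Let leb2_sigma_finite : sigma_finite setT leb2.
Proof.
have /sigma_finiteP[F [TF ndF Foo]] := sigma_finiteT mu.
exists (fun n => F n `*` F n).
 rewrite -setXTT TF predeqE => -[x y]; split.
    move=> [/= [n _ Fnx] [k _ Gky]]; exists (maxn n k) => //; split.
    - by move: x Fnx; exact/subsetPset/ndF/leq_maxl.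
    - by move: y Gky; exact/subsetPset/ndF/leq_maxr.
  by move=> [n _ []/= ? ?]; split; exists n.
move=> k; have [? ?] := Foo k.
split; first exact: measurableX.
by rewrite /leb2 product_measure1E// lte_mul_pinfty// ge0_fin_numE.
Qed.

HB.instance Definition _ := Measure_isSigmaFinite.Build _ _ _ leb2 leb2_sigma_finite.

Let mI : measurable (I : set T1).
Proof. exact: measurable_itv. Qed.

Let mI2 : measurable (I `*` I : set (T1 * T1)%type).
Proof. exact: measurableX. Qed.

Lemma cube_slice3 f M : measurable_fun setT f -> (forall x, `|f x| <= M) ->
  (forall ab, \int[mu]_(c in I) (f (ab, c))%:E = 0)%E ->
  Rintegral leb3 (@cube R) f = 0.
Proof.
move=> mf fM f0.
have := @integral_slice2 _ _ (T1 * T1)%type T1 R leb2 mu (I `*` I) I (EFin \o f) mI2 mI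
  (cube_integrable mf fM) f0.
by move=> /(congr1 fine).
Qed.

Let leb2_square : mu2 (I `*` I) = ((2 * pi) ^+ 2)%:E.
Proof.
rewrite (product_measure1E mu mu mI mI)/= lebesgue_measure_itv/= lte_fin twopi_gt0 oppr0 adde0.
by rewrite -EFinM.
Qed.

Let slice_integrable (c : R) f M : measurable_fun setT f -> (forall x, `|f x| <= M) ->
  mu2.-integrable (I `*` I) (EFin \o (fun ab => f (ab, c))).
Proof.
move=> mf fM.
apply: measurable_bounded_integrable => //.
- by have := ltry ((2 * pi) ^+ 2 : R); rewrite -leb2_square.
- apply: measurable_funTS; apply: (measurableT_comp (T2 := T3) mf); exact: pair2_measurable.
- exists M; split; first exact: num_real.
  by move=> x Mx y _; exact: le_trans (fM _) (ltW Mx).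
Qed.

Lemma cube_slice2 f M : measurable_fun setT f -> (forall x, `|f x| <= M) ->
  (forall a c, \int[mu]_(b in I) (f (a, b, c))%:E = 0)%E ->
  Rintegral leb3 (@cube R) f = 0.
Proof.
move=> mf fM f0.
have := @integral_slice1 _ _ (T1 * T1)%type T1 R leb2 mu (I `*` I) I (EFin \o f) mI2 mI
  (cube_integrable mf fM).
move=> H; apply: (congr1 fine (H _) : _ = fine 0%E) => c _.
exact: (@integral_slice2 _ _ T1 T1 R mu mu I I (fun ab => (f (ab, c))%:E) mI mI
  (slice_integrable c mf fM)).
Qed.

Lemma cube_slice1 f M : measurable_fun setT f -> (forall x, `|f x| <= M) ->
  (forall b c, \int[mu]_(a in I) (f (a, b, c))%:E = 0)%E ->
  Rintegral leb3 (@cube R) f = 0.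
Proof.
move=> mf fM f0.
have := @integral_slice1 _ _ (T1 * T1)%type T1 R leb2 mu (I `*` I) I (EFin \o f) mI2 mI
  (cube_integrable mf fM).
move=> H; apply: (congr1 fine (H _) : _ = fine 0%E) => c _.
exact: (@integral_slice1 _ _ T1 T1 R mu mu I I (fun ab => (f (ab, c))%:E) mI mI
  (slice_integrable c mf fM)).
Qed.

Lemma line_is_derive f (i : 'I_3) (x : R3) (t : R) : (forall y, differentiable f y) ->
  is_derive t 1 (fun s => f (x + s *: basis_vec i)) (partial i f (x + t *: basis_vec i)).
Proof.
move=> df; have E : (fun h : R => h^-1 *: (((fun s => f (x + s *: basis_vec i)) \o shift t) (h *: 1) -
    f (x + t *: basis_vec i))) =
   (fun h : R => h^-1 *: ((f \o shift (x + t *: basis_vec i)) (h *: basis_vec i) -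
    f (x + t *: basis_vec i))).
  apply/funext => h; congr (_ *: (f _ - _)).
  suff -> : (h *: (1 : R) + t) *: basis_vec i = h *: basis_vec i + t *: basis_vec i.
    by rewrite addrCA.
  by rewrite -[h *: (1 : R)]/(h * 1) mulr1 scalerDl.
split.
  by rewrite /derivable E; exact: diff_derivable.
by rewrite /derive E.
Qed.

(** The fundamental theorem of calculus over one full period: the two boundary values agree. *)
Lemma line_integral f (i : 'I_3) (x : R3) : (forall y, differentiable f y) ->
  continuous (partial i f) -> periodic f ->
  (\int[mu]_(t in I) ((fun s : R => partial i f (x + s *: basis_vec i)) t)%:E = 0)%E.
Proof.
move=> df cf pf.
have cl : continuous (fun t : R => x + t *: basis_vec i).
  move=> t; apply: cvgD; first exact: cvg_cst.
  by apply: cvgZr_tmp; exact: cvg_id.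
have dl := fun t => @line_is_derive f i x t df.
rewrite (@continuous_FTC2 _ _ (fun s => f (x + s *: basis_vec i))) ?twopi_gt0//.
- by rewrite scale0r addr0 pf subee.
- apply: continuous_subspaceT => t; apply: continuous_comp; [exact: cl|exact: cf].
- have ct : continuous (fun s : R => f (x + s *: basis_vec i)).
    move=> t; apply: continuous_comp; [exact: cl|exact/differentiable_continuous/df].
  split; first by move=> t _; case: (dl t).
  + exact/cvg_at_right_filter/ct.
  + exact/cvg_at_left_filter/ct.
- by move=> t _; rewrite derive1E; case: (dl t).
Qed.

End CubeIntegral.

Lemma ord3_ind (P : 'I_3 -> Prop) : P ord0 -> P 1 -> P (1 + 1) -> forall i, P i.
Proof.
move=> P0 P1 P2 [[|[|[|//]]] i3].
- by rewrite (_ : Ordinal i3 = ord0)//; exact: val_inj.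
- by rewrite (_ : Ordinal i3 = 1)//; exact: val_inj.
- by rewrite (_ : Ordinal i3 = 1 + 1)//; exact: val_inj.
Qed.

(** * Periodic and smooth functions *)

Section Periodic.
Context {R : realType}.
Local Notation R3 := (R * R * R)%type.
Implicit Types (f g : R3 -> R).

Lemma periodic_int (T : Type) (f : R3 -> T) : periodic f ->
  forall (i : 'I_3) (n : int) x, f (x + (2 * pi * n%:~R) *: basis_vec i) = f x.
Proof.
move=> pf i.
have H (n : nat) x : f (x + (2 * pi * n%:R) *: basis_vec i) = f x.
  elim: n => [|n IH] in x *; first by rewrite mulr0 scale0r addr0.
  by rewrite -[n.+1]addn1 natrD mulrDr mulr1 scalerDl addrA pf IH.
case=> n x; first exact: H.
by rewrite -(H n.+1) -addrA -scalerDl -mulrDr NegzE mulrNz addNr mulr0 scale0r addr0.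
Qed.

Lemma basis_decomp (x : R3) (u v w : R) :
  x + u *: basis_vec ord0 + v *: basis_vec 1 + w *: basis_vec (1 + 1) =
  (x.1.1 + u, x.1.2 + v, x.2 + w).
Proof.
case: x => [[a b] c].
have -> : @basis_vec R ord0 = (1, 0, 0) by [].
have -> : @basis_vec R 1 = (0, 1, 0) by [].
have -> : @basis_vec R (1 + 1) = (0, 0, 1) by [].
have Z (t p q r : R) : t *: ((p, q, r) : R3) = (t * p, t * q, t * r) by [].
have D (p q r p' q' r' : R) : ((p, q, r) : R3) + (p', q', r') = (p + p', q + q', r + r') by [].
by rewrite !Z !D !(mulr0, mulr1, addr0).
Qed.

Lemma periodic_cube (T : Type) (f : R3 -> T) x : periodic f ->
  exists2 y, cube y & f y = f x.
Proof.
move=> pf.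
pose n (t : R) := - Num.floor (t / (2 * pi)).
exists (x.1.1 + 2 * pi * (n x.1.1)%:~R, x.1.2 + 2 * pi * (n x.1.2)%:~R, x.2 + 2 * pi * (n x.2)%:~R).
  have H t : `[0, 2 * pi]%classic (t + 2 * pi * (n t)%:~R).
    have P := @twopi_gt0 R.
    rewrite /= in_itv/= /n mulrNz; have /andP[h1 h2] := floor_itv (t / (2 * pi)).
    move: h1 h2; rewrite ler_pdivlMr// ltr_pdivrMr// intrD.
    move: (Num.floor _)%:~R => z h1 h2; apply/andP; split; first lra.
    by move: h2; rewrite mulrDl => /ltW; lra.
  by split=> /=; [split|]; exact: H.
by rewrite -basis_decomp !(periodic_int pf).
Qed.

Lemma periodic_bounded f : continuous f -> periodic f -> exists M, forall x, `|f x| <= M.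
Proof.
move=> cf pf.
have cc : compact (@cube R).
  by apply: compact_setX; [apply: compact_setX|]; exact: segment_compact.
have cfc : compact (f @` @cube R) by apply: continuous_compact => //; exact: continuous_subspaceT.
have [M [_ HM]] := compact_bounded cfc.
exists (M + 1) => x; have [y cy <-] := periodic_cube x pf.
by apply: (HM (M + 1)); [rewrite ltrDl|exists y].
Qed.

Lemma periodic_partial f i : periodic f -> periodic (partial i f).
Proof.
move=> pf k x; rewrite /partial /derive; congr (lim (_ @ 0^')).
by apply/funext => h /=; rewrite pf addrA pf.
Qed.

Lemma smooth_partial f i : smooth f -> smooth (partial i f).
Proof. by move=> sf s x; have := sf (rcons s i) x; rewrite foldr_rcons. Qed.

Lemma smooth_differentiable f : smooth f -> forall x, differentiable f x.
Proof. by move=> sf x; exact: (sf [::]). Qed.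

Lemma smooth_continuous f : smooth f -> continuous f.
Proof. by move=> sf x; exact/differentiable_continuous/smooth_differentiable. Qed.

(** The variable in direction [i] is integrated first, over a full period. Integration by parts and
    the orthogonality of characters both rest on this. *)
Lemma cube_partial0 f i : (forall x, differentiable f x) ->
  continuous (partial i f) -> periodic f -> Rintegral leb3 (@cube R) (partial i f) = 0.
Proof.
move=> df + pf; have E (x : R3) t : (x + t *: basis_vec ord0 = (x.1.1 + t, x.1.2, x.2)) *
  (x + t *: basis_vec 1 = (x.1.1, x.1.2 + t, x.2)) *
  (x + t *: basis_vec (1 + 1) = (x.1.1, x.1.2, x.2 + t)).
  have := (basis_decomp x t 0 0, basis_decomp x 0 t 0, basis_decomp x 0 0 t).
  by rewrite !scale0r !addr0 => -[[]].
move: i; apply: ord3_ind => cf; have [M HM] := periodic_bounded cf (periodic_partial _ pf);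
  have mf := continuous_measurable3 cf.
- apply: (cube_slice1 mf HM) => b c; rewrite -[RHS](@line_integral R f ord0 (0, b, c) df cf pf).
  by apply: eq_integral => t _ /=; rewrite E/= add0r.
- apply: (cube_slice2 mf HM) => b c; rewrite -[RHS](@line_integral R f 1 (b, 0, c) df cf pf).
  by apply: eq_integral => t _ /=; rewrite E/= add0r.
- apply: (cube_slice3 mf HM) => -[b c]; rewrite -[RHS](@line_integral R f (1 + 1) (b, c, 0) df cf pf).
  by apply: eq_integral => t _ /=; rewrite E/= add0r.
Qed.

End Periodic.

(** * Integrable and bounded measurable complex functions *)

Section ComplexIntegral.
Context {R : realType}.
Local Notation C := (R[i])%C.
Local Notation R3 := (R * R * R)%type.
Local Notation cm := (@Normc.normc R).
Local Notation Re := (@complex.Re R).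
Local Notation Im := (@complex.Im R).
Local Notation mu := (@lebesgue_measure R).
Local Notation mu3 := ((mu \x mu) \x mu)%E.
Local Notation T1 := (measurableTypeR R).
Local Notation T3 := (T1 * T1 * T1)%type.
Implicit Types (f g : R3 -> R) (F G : R3 -> C).

(** Two classes are used: [rint] for a field known only to be integrable, and [rbm], bounded and
    measurable on the whole space, for its multipliers. The second is closed under products and acts
    on the first. *)
Definition rint f : Prop := mu3.-integrable (@cube R) (EFin \o f).
Definition rbm f : Prop := measurable_fun setT f /\ exists M, forall x, `|f x| <= M.

Lemma rintD f g : rint f -> rint g -> rint (fun x => f x + g x).
Proof. by move=> hf hg; exact: (integrableD measurable_cube hf hg). Qed.

Lemma rintZ c f : rint f -> rint (fun x => c * f x).
Proof. by move=> hf; exact: (integrableZl measurable_cube c hf). Qed.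

Lemma rintM f g : rint f -> rbm g -> rint (fun x => f x * g x).
Proof.
move=> hf [mg [M HM]].
have mg' : measurable_fun (T := T3) (@cube R) g by exact: (@measurable_funTS _ _ T3 _ _ _ mg).
apply: (integrableMl measurable_cube hf mg').
exists M; split; first exact: num_real.
by move=> x Mx y _; exact: le_trans (HM _) (ltW Mx).
Qed.

Lemma rbm_int f : rbm f -> rint f.
Proof. by move=> [mf [M HM]]; exact: cube_integrable mf HM. Qed.

Lemma rint_norm f : rint f -> rint (fun x => `|f x|).
Proof. by move=> hf; exact: integrable_norm hf. Qed.

Lemma rbm_cst c : rbm (fun=> c).
Proof. by split; [exact: measurable_cst|exists `|c|]. Qed.

Lemma rbmD f g : rbm f -> rbm g -> rbm (fun x => f x + g x).
Proof.
move=> [mf [M HM]] [mg [N HN]]; split; first exact: measurable_funD.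
by exists (M + N) => x; rewrite (le_trans (ler_normD _ _))// lerD.
Qed.

Lemma rbmM f g : rbm f -> rbm g -> rbm (fun x => f x * g x).
Proof.
move=> [mf [M HM]] [mg [N HN]]; split; first exact: measurable_funM.
by exists (M * N) => x; rewrite normrM ler_pM.
Qed.

Lemma rbmN f : rbm f -> rbm (fun x => - f x).
Proof.
move=> hf; have := rbmM (rbm_cst (-1)) hf.
by congr rbm; apply/funext => x; rewrite mulN1r.
Qed.

Lemma rintN f : rint f -> rint (fun x => - f x).
Proof.
move=> hf; have := rintZ (-1) hf.
by congr rint; apply/funext => x; rewrite mulN1r.
Qed.

Lemma rbm_continuous f : continuous f -> periodic f -> rbm f.
Proof. by move=> cf pf; split; [exact: continuous_measurable3|exact: periodic_bounded]. Qed.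

Definition icube f : R := Rintegral leb3 (@cube R) f.

Lemma icubeD f g : rint f -> rint g -> icube (fun x => f x + g x) = icube f + icube g.
Proof. exact: (@RintegralD _ T3 R mu3 (@cube R) f g measurable_cube). Qed.

Lemma icubeZ c f : rint f -> icube (fun x => c * f x) = c * icube f.
Proof. exact: (@RintegralZl _ T3 R mu3 (@cube R) f c measurable_cube). Qed.

Lemma icubeN f : rint f -> icube (fun x => - f x) = - icube f.
Proof.
move=> hf; have := icubeZ (-1) hf; rewrite mulN1r => <-.
by congr icube; apply/funext => x; rewrite mulN1r.
Qed.

Lemma icube_cst c : icube (fun=> c) = c * (2 * pi) ^+ 3.
Proof.
transitivity (c * fine (leb3 (@cube R))); last by rewrite leb3_cube.
exact: (@Rintegral_cst _ T3 R mu3 (@cube R) measurable_cube).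
Qed.

Lemma icube_le f g : rint f -> rint g -> (forall x, cube x -> f x <= g x) -> icube f <= icube g.
Proof. exact: (@le_Rintegral _ T3 R mu3 (@cube R) f g measurable_cube). Qed.

Lemma icube_ge0 f : (forall x, cube x -> 0 <= f x) -> 0 <= icube f.
Proof. exact: (@Rintegral_ge0 _ T3 R mu3 (@cube R) f). Qed.

Lemma icube_norm f : rint f -> `|icube f| <= icube (fun x => `|f x|).
Proof. exact: (@le_normr_Rintegral _ T3 R mu3 (@cube R) f measurable_cube). Qed.

Lemma icube_eq f g : (forall x, cube x -> f x = g x) -> icube f = icube g.
Proof. by move=> fg; apply: eq_Rintegral => x /set_mem /fg. Qed.

Definition cint F := rint (Re \o F) /\ rint (Im \o F).
Definition cbm F := rbm (Re \o F) /\ rbm (Im \o F).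

Lemma cint_ext F G : F =1 G -> cint F -> cint G.
Proof. by move=> /funext ->. Qed.

Lemma cbm_ext F G : F =1 G -> cbm F -> cbm G.
Proof. by move=> /funext ->. Qed.

Lemma cintD F G : cint F -> cint G -> cint (fun x => F x + G x).
Proof.
move=> [f1 f2] [g1 g2]; split.
  by rewrite (_ : _ \o _ = fun x => Re (F x) + Re (G x)); [exact: rintD|apply/funext => x /=; exact: ReD].
by rewrite (_ : _ \o _ = fun x => Im (F x) + Im (G x)); [exact: rintD|apply/funext => x /=; exact: ImD].
Qed.

Lemma cintM F G : cint F -> cbm G -> cint (fun x => F x * G x).
Proof.
move=> [f1 f2] [g1 g2]; split.
  rewrite (_ : _ \o _ = fun x => Re (F x) * Re (G x) + - (Im (F x) * Im (G x))).
    by apply: rintD; [exact: rintM|apply: rintN; exact: rintM].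
  by apply/funext => x /=; exact: ReM.
rewrite (_ : _ \o _ = fun x => Re (F x) * Im (G x) + Im (F x) * Re (G x)).
  by apply: rintD; exact: rintM.
by apply/funext => x /=; exact: ImM.
Qed.

Lemma cbm_int F : cbm F -> cint F.
Proof. by move=> [f1 f2]; split; exact: rbm_int. Qed.

Lemma cbm_cst c : cbm (fun=> c).
Proof. by split; exact: rbm_cst. Qed.

Lemma cbmD F G : cbm F -> cbm G -> cbm (fun x => F x + G x).
Proof.
move=> [f1 f2] [g1 g2]; split.
  by rewrite (_ : _ \o _ = fun x => Re (F x) + Re (G x)); [exact: rbmD|apply/funext => x /=; exact: ReD].
by rewrite (_ : _ \o _ = fun x => Im (F x) + Im (G x)); [exact: rbmD|apply/funext => x /=; exact: ImD].
Qed.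

Lemma cbmM F G : cbm F -> cbm G -> cbm (fun x => F x * G x).
Proof.
move=> [f1 f2] [g1 g2]; split.
  rewrite (_ : _ \o _ = fun x => Re (F x) * Re (G x) + - (Im (F x) * Im (G x))).
    by apply: rbmD; [exact: rbmM|apply: rbmN; exact: rbmM].
  by apply/funext => x /=; exact: ReM.
rewrite (_ : _ \o _ = fun x => Re (F x) * Im (G x) + Im (F x) * Re (G x)).
  by apply: rbmD; exact: rbmM.
by apply/funext => x /=; exact: ImM.
Qed.

Lemma cbm_conj F : cbm F -> cbm (fun x => (F x)^*%C).
Proof.
move=> [f1 f2]; split.
  by rewrite (_ : _ \o _ = Re \o F)//; apply/funext => x /=; exact: Re_conj.
by rewrite (_ : _ \o _ = fun x => - Im (F x)); [exact: rbmN|apply/funext => x /=; exact: Im_conj].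
Qed.

Lemma cbm_real f : rbm f -> cbm (fun x => (f x)%:C%C).
Proof. by move=> hf; split => //; exact: rbm_cst. Qed.

Lemma cint_real f : rint f -> cint (fun x => (f x)%:C%C).
Proof. by move=> hf; split => //; exact/rbm_int/rbm_cst. Qed.

Lemma cintZ c F : cint F -> cint (fun x => c * F x).
Proof.
by move=> hF; apply: (cint_ext (F := fun x => F x * c)) => [x|]; [rewrite mulrC|apply: cintM => //; exact: cbm_cst].
Qed.

Lemma cint_sum (J : Type) (r : seq J) (P : pred J) (F : J -> R3 -> C) :
  (forall j, P j -> cint (F j)) -> cint (fun x => \sum_(j <- r | P j) F j x).
Proof.
move=> hF; elim: r => [|j r IH].
  by apply: (cint_ext (F := fun=> 0)) => [x|]; [rewrite big_nil|exact/cbm_int/cbm_cst].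
case Pj : (P j); last by apply: cint_ext IH => x; rewrite big_cons Pj.
by apply: cint_ext (cintD (hF _ Pj) IH) => x; rewrite big_cons Pj.
Qed.

Lemma cbm_sum (J : Type) (r : seq J) (P : pred J) (F : J -> R3 -> C) :
  (forall j, P j -> cbm (F j)) -> cbm (fun x => \sum_(j <- r | P j) F j x).
Proof.
move=> hF; elim: r => [|j r IH].
  by apply: (cbm_ext (F := fun=> 0)) => [x|]; [rewrite big_nil|exact/cbm_cst].
case Pj : (P j); last by apply: cbm_ext IH => x; rewrite big_cons Pj.
by apply: cbm_ext (cbmD (hF _ Pj) IH) => x; rewrite big_cons Pj.
Qed.

Lemma cintegralE F : cintegral F = Complex (icube (Re \o F)) (icube (Im \o F)).
Proof. by []. Qed.

Lemma cintegral_eq F G : (forall x, cube x -> F x = G x) -> cintegral F = cintegral G.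
Proof.
by move=> FG; rewrite !cintegralE; congr Complex; apply: icube_eq => x cx /=; rewrite FG.
Qed.

Lemma cintegralD F G : cint F -> cint G ->
  cintegral (fun x => F x + G x) = cintegral F + cintegral G.
Proof.
move=> [f1 f2] [g1 g2]; rewrite !cintegralE; apply: complex_ext; rewrite ?ReD ?ImD /=.
  by rewrite -icubeD//; apply: icube_eq => x _ /=; exact: ReD.
by rewrite -icubeD//; apply: icube_eq => x _ /=; exact: ImD.
Qed.

Lemma cintegralZ c F : cint F -> cintegral (fun x => c * F x) = c * cintegral F.
Proof.
move=> [f1 f2]; rewrite !cintegralE; apply: complex_ext; rewrite ?ReM ?ImM /=.
  rewrite -!icubeZ// -icubeN -?icubeD; try by [exact: rintZ|apply: rintN; exact: rintZ].
  by apply: icube_eq => x _ /=; rewrite ReM.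
rewrite -!icubeZ// -?icubeD; try exact: rintZ.
by apply: icube_eq => x _ /=; rewrite ImM.
Qed.

Lemma cintegral0 : cintegral (fun=> 0 : C) = 0.
Proof. by rewrite cintegralE; apply: complex_ext => /=; rewrite icube_cst mul0r. Qed.

Lemma cintegral_sum (J : Type) (r : seq J) (P : pred J) (F : J -> R3 -> C) :
  (forall j, P j -> cint (F j)) ->
  cintegral (fun x => \sum_(j <- r | P j) F j x) = \sum_(j <- r | P j) cintegral (F j).
Proof.
move=> hF; elim: r => [|j r IH].
  by rewrite big_nil -[RHS]cintegral0; apply: cintegral_eq => x _; rewrite big_nil.
rewrite big_cons; case Pj : (P j); last first.
  by rewrite -IH; apply: cintegral_eq => x _; rewrite big_cons Pj.
rewrite -IH -cintegralD//; [|exact: hF|exact: cint_sum].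
by apply: cintegral_eq => x _; rewrite big_cons Pj.
Qed.

Lemma cintegral_cst (c : C) : cintegral (fun=> c : C) = ((2 * pi) ^+ 3)%:C%C * c.
Proof.
rewrite cintegralE; apply: complex_ext; rewrite ?ReM ?ImM /= icube_cst mul0r.
  by rewrite subr0 mulrC.
by rewrite addr0 mulrC.
Qed.

Lemma cintegral_conj F : cint F -> cintegral (fun x => (F x)^*%C) = (cintegral F)^*%C.
Proof.
move=> [f1 f2]; rewrite !cintegralE; apply: complex_ext; rewrite ?Re_conj ?Im_conj /=.
  by apply: icube_eq => x _ /=; rewrite Re_conj.
by rewrite -icubeN//; apply: icube_eq => x _ /=; rewrite Im_conj.
Qed.

(** Pairing L^1 with the supremum norm: the constant depends on [F] only, so uniform convergence of
    [G] passes under the integral. The factor 2 comes from bounding real and imaginary parts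
    separately. *)
Lemma cintegral_bound F : cint F -> exists2 K, 0 <= K & forall G M, cbm G ->
  (forall x, cube x -> cm (G x) <= M) -> cm (cintegral (fun x => F x * G x)) <= K * M.
Proof.
move=> hF; have [f1 f2] := hF; pose N x := `|Re (F x)| + `|Im (F x)|.
have hN : rint N by apply: rintD; exact: rint_norm.
exists (2 * icube N); first by rewrite mulr_ge0// icube_ge0// => x _; rewrite addr_ge0.
move=> G M hG HM; have [h1 h2] := cintM hF hG.
have B (h : C -> R) : (forall z, `|h z| <= cm z) -> rint (h \o (fun x => F x * G x)) ->
    `|icube (h \o (fun x => F x * G x))| <= icube N * M.
  move=> hh hi; rewrite (le_trans (icube_norm hi))// mulrC -icubeZ//.
  apply: icube_le; [exact: rint_norm|exact: rintZ|move=> x cx /=].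
  rewrite (le_trans (hh _))// cmM mulrC ler_pM ?cm_ge0 ?HM//.
  exact: cm_le.
rewrite (le_trans (cm_le _))// -mulrA mulr2n mulrDl !mul1r cintegralE /= lerD//.
  exact: (B Re Re_le_cm h1).
exact: (B Im Im_le_cm h2).
Qed.

End ComplexIntegral.

(** * Characters and Fourier coefficients *)

Section Modes.
Context {R : realType}.
Local Notation C := (R[i])%C.
Local Notation R3 := (R * R * R)%type.
Local Notation K := 'cV[int]_3.
Local Notation cm := (@Normc.normc R).
Local Notation Re := (@complex.Re R).
Implicit Types (f g : R3 -> R) (F G : R3 -> C) (k l : K) (x y : R3).

Definition kc k (i : 'I_3) : R := (k i 0)%:~R.

Definition kd k x : R := kc k ord0 * x.1.1 + kc k 1 * x.1.2 + kc k (1 + 1) * x.2.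

(** The character exp (i k.x); [kd k x] is the product k.x. *)
Definition ee k x : C := Complex (cos (kd k x)) (sin (kd k x)).

Lemma kcD k l i : kc (k + l) i = kc k i + kc l i.
Proof. by rewrite /kc !mxE intrD. Qed.

Lemma kcN k i : kc (- k) i = - kc k i.
Proof. by rewrite /kc !mxE mulrNz. Qed.

Lemma kcB k l i : kc (k - l) i = kc k i - kc l i.
Proof. by rewrite kcD kcN. Qed.

Lemma kc0 i : kc 0 i = 0.
Proof. by rewrite /kc mxE. Qed.

Lemma kc_eq0 k : (forall i, kc k i = 0) -> k = 0.
Proof.
move=> h; apply/matrixP => i j; rewrite ord1 mxE.
by have /eqP := h i; rewrite /kc intr_eq0 => /eqP.
Qed.

Lemma kdD k l x : kd (k + l) x = kd k x + kd l x.
Proof. by rewrite /kd !kcD; ring. Qed.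

Lemma kdN k x : kd (- k) x = - kd k x.
Proof. by rewrite /kd !kcN; ring. Qed.

Lemma kd0 x : kd 0 x = 0.
Proof. by rewrite /kd !kc0 !mul0r !addr0. Qed.

Lemma kd_shift k x i t : kd k (x + t *: basis_vec i) = kd k x + t * kc k i.
Proof.
have := (basis_decomp x t 0 0, basis_decomp x 0 t 0, basis_decomp x 0 0 t).
by rewrite !scale0r !addr0 => -[[h0 h1] h2]; move: i; apply: ord3_ind;
  rewrite ?h0 ?h1 ?h2 /kd /=; ring.
Qed.

Lemma eeD k l x : ee (k + l) x = ee k x * ee l x.
Proof.
apply: complex_ext.
  rewrite ReM -[LHS]/(cos (kd (k + l) x)) kdD cosD.
  by rewrite -[Re (ee k x)]/(cos (kd k x)) -[Re (ee l x)]/(cos (kd l x)).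
rewrite ImM -[LHS]/(sin (kd (k + l) x)) kdD sinD [RHS]addrC.
by rewrite -[Re (ee k x)]/(cos (kd k x)) -[Re (ee l x)]/(cos (kd l x)).
Qed.

Lemma ee0 x : ee 0 x = 1.
Proof. by apply: complex_ext => /=; rewrite kd0 ?cos0 ?sin0. Qed.

Lemma ee_conj k x : (ee k x)^*%C = ee (- k) x.
Proof. by apply: complex_ext; rewrite ?Re_conj ?Im_conj /= kdN ?cosN ?sinN. Qed.

Lemma cm_ee k x : cm (ee k x) = 1.
Proof. by rewrite /= cos2Dsin2 sqrtr1. Qed.

Lemma kd_differentiable k x : differentiable (kd k) x.
Proof.
have d1 (z : R * R) : differentiable (fst : R * R -> R) z.
  by apply: linear_differentiable => w; exact: cvg_fst.
have d2 (z : R * R) : differentiable (snd : R * R -> R) z.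
  by apply: linear_differentiable => w; exact: cvg_snd.
have d3 (z : R3) : differentiable (fst : R3 -> R * R) z.
  by apply: linear_differentiable => w; exact: cvg_fst.
have d4 (z : R3) : differentiable (snd : R3 -> R) z.
  by apply: linear_differentiable => w; exact: cvg_snd.
have -> : kd k = (cst (kc k ord0) * ((fst : R * R -> R) \o (fst : R3 -> R * R)) +
   cst (kc k 1) * ((snd : R * R -> R) \o (fst : R3 -> R * R)) +
   cst (kc k (1 + 1)) * (snd : R3 -> R)) by [].
apply: differentiableD; [apply: differentiableD|]; apply: differentiableM => //;
  by apply: differentiable_comp.
Qed.

(** Test functions are real-valued, so characters enter through their real and imaginary parts. This
    two-parameter family is closed under [partial], which gives smoothness. *)
Definition trig k (a b : R) : R3 -> R := fun x => a * cos (kd k x) + b * sin (kd k x).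

Lemma trig_differentiable k a b x : differentiable (trig k a b) x.
Proof.
have -> : trig k a b = cst a * (cos \o kd k) + cst b * (sin \o kd k) by [].
have dc : differentiable (@cos R) (kd k x) by exact/derivable1_diffP/derivable_cos.
have ds : differentiable (@sin R) (kd k x) by exact/derivable1_diffP/derivable_sin.
apply: differentiableD; apply: differentiableM => //;
  apply: differentiable_comp => //; exact: kd_differentiable.
Qed.

Lemma partial_trig k a b i : partial i (trig k a b) = trig k (b * kc k i) (- a * kc k i).
Proof.
apply/funext => x.
have := line_is_derive i x 0 (trig_differentiable k a b).
rewrite scale0r addr0 => d1.
have d2 : is_derive (0 : R) 1 (fun s => trig k a b (x + s *: basis_vec i))
   (trig k (b * kc k i) (- a * kc k i) x).
  have -> : (fun s => trig k a b (x + s *: basis_vec i)) =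
     (cst a * (cos \o (fun s => kd k x + s * kc k i)) + cst b * (sin \o (fun s => kd k x + s * kc k i))).
    by apply/funext => s; rewrite /trig kd_shift.
  have dl : is_derive (0 : R) 1 (fun s => kd k x + s * kc k i) (kc k i).
    by apply: is_derive_eq; rewrite /GRing.scale/= !(mulr0, mulr1, mul1r, add0r, addr0).
  have dc : is_derive (0 : R) 1 (cos \o (fun s => kd k x + s * kc k i)) (- sin (kd k x + 0 * kc k i) * kc k i).
    exact: is_derive1_comp.
  have ds : is_derive (0 : R) 1 (sin \o (fun s => kd k x + s * kc k i)) (cos (kd k x + 0 * kc k i) * kc k i).
    exact: is_derive1_comp.
  apply: (@is_derive_eq _ _ _ _ _ _ _ _ (is_deriveD (is_deriveZ a dc) (is_deriveZ b ds))).
  by rewrite /trig mul0r addr0 /GRing.scale /=; ring.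
by rewrite -(@derive_val _ _ _ _ _ _ _ d1) -(@derive_val _ _ _ _ _ _ _ d2).
Qed.

Lemma trig_smooth k a b : smooth (trig k a b).
Proof.
move=> s; suff [a' [b' ->]] : exists a' b', foldr partial (trig k a b) s = trig k a' b'.
  exact: trig_differentiable.
elim: s => [|i s [a' [b' IH]]] /=; first by exists a, b.
by rewrite IH partial_trig; do 2 eexists.
Qed.

Lemma cos_int (t : R) (n : int) : cos (t + 2 * pi * n%:~R) = cos t.
Proof.
have H (m : nat) s : cos (s + 2 * pi * m%:R) = cos s :> R.
  elim: m => [|m IH]; first by rewrite mulr0 addr0.
  have E : 2 * pi = pi *+ 2 :> R by rewrite mulr_natl.
  by rewrite -[m.+1]addn1 natrD mulrDr mulr1 addrA [X in cos (_ + X)]E cosD2pi IH.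
case: n => n; first exact: H.
by rewrite -(H n.+1) -addrA -mulrDr NegzE mulrNz addNr mulr0 addr0.
Qed.

Lemma sin_int (t : R) (n : int) : sin (t + 2 * pi * n%:~R) = sin t.
Proof.
have E s : sin s = - cos (s + pi / 2) :> R.
  by rewrite cosD cos_pihalf sin_pihalf mulr0 mulr1 add0r opprK.
by rewrite !E addrAC cos_int.
Qed.

Lemma trig_periodic k a b : periodic (trig k a b).
Proof.
move=> i x; by rewrite /trig kd_shift /kc cos_int sin_int.
Qed.

Lemma ee_trig k : ee k = fun x => Complex (trig k 1 0 x) (trig k 0 1 x).
Proof. by apply/funext => x; rewrite /trig !mul0r !mul1r addr0 add0r. Qed.

Lemma ee_periodic k : periodic (ee k).
Proof. by move=> i x; rewrite ee_trig !trig_periodic. Qed.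

Lemma trig_rbm k a b : rbm (trig k a b).
Proof.
by apply: rbm_continuous; [exact/smooth_continuous/trig_smooth|exact: trig_periodic].
Qed.

Lemma cbm_ee k : cbm (ee k).
Proof. by rewrite ee_trig; split; exact: trig_rbm. Qed.

(** Such a function is itself a partial derivative, in a direction where the frequency does not
    vanish. *)
Lemma icube_trig k a b : k != 0 -> icube (trig k a b) = 0.
Proof.
move=> k0; have [i ki] : exists i, kc k i != 0.
  apply: contrapT => /forallNP h; move/eqP: k0; apply.
  by apply: kc_eq0 => i; apply/eqP/negP => /negP; exact: h.
have <- : partial i (trig k (- b / kc k i) (a / kc k i)) = trig k a b.
  by rewrite partial_trig; congr (trig k); rewrite ?mulNr ?opprK divfK.
apply: cube_partial0; [exact: trig_differentiable| |exact: trig_periodic].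
by rewrite partial_trig; exact/smooth_continuous/trig_smooth.
Qed.

Definition avg F : C := ((2 * pi) ^- 3)%:C%C * cintegral F.

(** The k-th Fourier coefficient; [fcr] is its variant for real functions. *)
Definition fc F k : C := avg (fun x => F x * ee (- k) x).

Definition fcr f k : C := fc (fun x => (f x)%:C%C) k.

Lemma pi3_neq0 : (2 * pi) ^+ 3 != 0 :> R.
Proof. by rewrite expf_neq0// gt_eqF// twopi_gt0. Qed.

Lemma avg_cst (c : C) : avg (fun=> c : C) = c.
Proof.
by rewrite /avg cintegral_cst mulrA -rmorphM/= mulVf ?pi3_neq0// mul1r.
Qed.

Lemma avgD F G : cint F -> cint G -> avg (fun x => F x + G x) = avg F + avg G.
Proof. by move=> hF hG; rewrite /avg cintegralD// mulrDr. Qed.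

Lemma avgZ c F : cint F -> avg (fun x => c * F x) = c * avg F.
Proof. by move=> hF; rewrite /avg cintegralZ// mulrCA. Qed.

Lemma avg_sum (J : Type) (r : seq J) (P : pred J) (F : J -> R3 -> C) :
  (forall j, P j -> cint (F j)) ->
  avg (fun x => \sum_(j <- r | P j) F j x) = \sum_(j <- r | P j) avg (F j).
Proof. by move=> hF; rewrite /avg cintegral_sum// mulr_sumr. Qed.

Lemma avg_eq F G : (forall x, cube x -> F x = G x) -> avg F = avg G.
Proof. by move=> FG; rewrite /avg (cintegral_eq FG). Qed.

Lemma avg_conj F : cint F -> avg (fun x => (F x)^*%C) = (avg F)^*%C.
Proof. by move=> hF; rewrite /avg cintegral_conj// conjM conj_real. Qed.

Lemma avg_bound F : cint F -> exists2 L, 0 <= L & forall G M, cbm G ->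
  (forall x, cube x -> cm (G x) <= M) -> cm (avg (fun x => F x * G x)) <= L * M.
Proof.
move=> hF; have [L L0 HL] := cintegral_bound hF.
exists (`|(2 * pi) ^- 3| * L); first by rewrite mulr_ge0.
move=> G M hG HM; rewrite /avg cmM cmR -mulrA ler_wpM2l//.
exact: HL.
Qed.

Lemma avg_ee k : avg (ee k) = (k == 0)%:R.
Proof.
have [->|k0] := eqVneq k 0.
  by rewrite -[RHS]avg_cst; apply: avg_eq => x _; rewrite ee0.
rewrite /avg cintegralE ee_trig /=.
rewrite -[X in Complex X]/(icube (trig k 1 0)) -[X in Complex _ X]/(icube (trig k 0 1)).
by rewrite !icube_trig// mulr0.
Qed.

Lemma fcrE f k : rint f ->
  fcr f k = ((2 * pi) ^- 3)%:C%C *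
     Complex (icube (fun x => f x * cos (kd k x))) (- icube (fun x => f x * sin (kd k x))).
Proof.
move=> hf; rewrite /fcr /fc /avg; congr (_ * _); rewrite cintegralE; congr Complex.
  by apply: icube_eq => x _ /=; rewrite mul0r subr0 kdN cosN.
rewrite -icubeN; last first.
  have -> : (fun x => f x * sin (kd k x)) = (fun x => f x * trig k 0 1 x).
    by apply/funext => x; rewrite /trig mul0r add0r mul1r.
  by apply: rintM => //; exact: trig_rbm.
by apply: icube_eq => x _ /=; rewrite mul0r addr0 kdN sinN mulrN.
Qed.

Lemma partialM f g i x : differentiable f x -> differentiable g x ->
  partial i (f * g) x = f x * partial i g x + g x * partial i f x.
Proof. by move=> df dg; rewrite /partial deriveM//; exact: diff_derivable. Qed.

Lemma smooth_rbm f : smooth f -> periodic f -> rbm f.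
Proof. by move=> sf pf; apply: rbm_continuous => //; exact: smooth_continuous. Qed.

Lemma icube_parts f k a b i : smooth f -> periodic f ->
  icube (fun x => partial i f x * trig k a b x) =
  - icube (fun x => f x * trig k (b * kc k i) (- a * kc k i) x).
Proof.
move=> sf pf; set g := trig k a b.
have E : partial i (f * g) =
   fun x => f x * trig k (b * kc k i) (- a * kc k i) x + partial i f x * g x.
  apply/funext => x; rewrite partialM; last 2 first.
  - exact: smooth_differentiable.
  - exact: trig_differentiable.
  by rewrite partial_trig [g x * _]mulrC.
have sc := smooth_continuous sf.
have spc := smooth_continuous (smooth_partial i sf).
have tc k' a' b' := smooth_continuous (trig_smooth k' a' b').
have : icube (partial i (f * g)) = 0.
  apply: cube_partial0.
  - by move=> x; apply: differentiableM; [exact: smooth_differentiable|exact: trig_differentiable].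
  - by rewrite E => x; apply: cvgD; apply: cvgM; [exact: sc|exact: tc|exact: spc|exact: tc].
  - by move=> j x; rewrite -[LHS]/(f _ * g _) pf /g trig_periodic.
rewrite E icubeD.
- by move/eqP; rewrite addrC addr_eq0 => /eqP.
- by apply: rintM; [exact/rbm_int/smooth_rbm|exact: trig_rbm].
- by apply: rintM; [apply/rbm_int/smooth_rbm; [exact: smooth_partial|exact: periodic_partial]|exact: trig_rbm].
Qed.

Lemma fcr_partial f k i : smooth f -> periodic f ->
  fcr (partial i f) k = 'i%C * (kc k i)%:C%C * fcr f k.
Proof.
move=> sf pf.
have hf : rint f by exact/rbm_int/smooth_rbm.
have hp : rint (partial i f) by apply/rbm_int/smooth_rbm; [exact: smooth_partial|exact: periodic_partial].
rewrite !fcrE// mulrCA; congr (_ * _).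
have Ec (h : R3 -> R) (c : R) : rint h ->
  icube (fun x => h x * trig k c 0 x) = c * icube (fun x => h x * cos (kd k x)).
  move=> hh; rewrite -icubeZ.
    by apply: icube_eq => x _; rewrite /trig mul0r addr0; ring.
  have -> : (fun x => h x * cos (kd k x)) = (fun x => h x * trig k 1 0 x).
    by apply/funext => x; rewrite /trig mul0r addr0 mul1r.
  by apply: rintM => //; exact: trig_rbm.
have Es (h : R3 -> R) (c : R) : rint h ->
  icube (fun x => h x * trig k 0 c x) = c * icube (fun x => h x * sin (kd k x)).
  move=> hh; rewrite -icubeZ.
    by apply: icube_eq => x _; rewrite /trig mul0r add0r; ring.
  have -> : (fun x => h x * sin (kd k x)) = (fun x => h x * trig k 0 1 x).
    by apply/funext => x; rewrite /trig mul0r add0r mul1r.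
  by apply: rintM => //; exact: trig_rbm.
have H1 := @icube_parts f k 1 0 i sf pf; have H2 := @icube_parts f k 0 1 i sf pf.
rewrite mul0r mulN1r Es// Ec// mul1r mulNr opprK in H1.
rewrite oppr0 mul0r mul1r Ec// Es// mul1r in H2.
apply: complex_ext; rewrite ?ReM ?ImM /= ?H1 ?H2; ring.
Qed.

Lemma fcr_bound f : smooth f -> periodic f -> exists2 M, 0 <= M & forall k, cm (fcr f k) <= M.
Proof.
move=> sf pf; have hf : cint (fun x => (f x)%:C%C) by exact/cint_real/rbm_int/smooth_rbm.
have [L L0 HL] := avg_bound hf; exists L => // k.
by rewrite -[L]mulr1; apply: HL; [exact: cbm_ee|move=> x _; rewrite cm_ee].
Qed.

End Modes.

Lemma sum_sub (V : zmodType) (T : eqType) (t s : seq T) (F : T -> V) :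
  uniq t -> uniq s -> {subset t <= s} ->
  \sum_(x <- s) F x = \sum_(x <- t) F x + \sum_(x <- [seq x <- s | x \notin t]) F x.
Proof.
move=> ut us ts; rewrite (bigID (mem t)) /= big_filter; congr (_ + _).
rewrite -big_filter; apply: perm_big; apply: uniq_perm => //; first exact: filter_uniq.
by move=> x; rewrite mem_filter; apply: andb_idr; exact: ts.
Qed.

(** * Boxes of frequencies and polynomial weights *)

Section Weights.
Context {R : realType}.
Local Notation K := 'cV[int]_3.
Implicit Types (k l : K).
Local Notation kc := (@kc R).

(** Boxes of frequencies are enumerated by finite functions, shifted by N, so that a sum over a box
    of a product over coordinates factors into one-dimensional sums. *)
Definition emb N (f : {ffun 'I_3 -> 'I_(N.*2.+1)}) : K := \col_i ((f i : nat)%:Z - N%:Z).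

Definition box N : seq K := [seq emb f | f <- enum {ffun 'I_3 -> 'I_(N.*2.+1)}].

Lemma emb_inj N : injective (@emb N).
Proof.
move=> f g /matrixP fg; apply/ffunP => i; apply: val_inj => /=.
by have := fg i 0; rewrite !mxE => /addIr [].
Qed.

Lemma box_uniq N : uniq (box N).
Proof. by rewrite map_inj_uniq ?enum_uniq//; exact: emb_inj. Qed.

Lemma mem_box N k : (k \in box N) = [forall i, (absz (k i 0%R) <= N)%N].
Proof.
apply/idP/forallP => [/mapP[f _ ->] i|h].
  by rewrite mxE; case: (f i) => a /= ha; rewrite -addnn in ha; lia.
have h' i : (absz (k i 0 + N%:Z)%R < N.*2.+1)%N by have := h i; rewrite -addnn; lia.
apply/mapP; exists [ffun i => Ordinal (h' i)]; first by rewrite mem_enum.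
apply/matrixP => i j; rewrite ord1 !mxE ffunE /=; have := h i; lia.
Qed.

Lemma mem_boxP N k : reflect (forall i, (absz (k i 0%R) <= N)%N) (k \in box N).
Proof. by rewrite mem_box; exact: forallP. Qed.

Lemma box_le M N : (M <= N)%N -> {subset box M <= box N}.
Proof. by move=> MN k /mem_boxP h; apply/mem_boxP => i; rewrite (leq_trans (h i)). Qed.

Lemma in_some_box (s : seq K) : exists N, {subset s <= box N}.
Proof.
elim: s => [|k s [N IH]]; first by exists 0%N.
exists (maxn N (\max_i absz (k i 0%R))) => l; rewrite inE => /predU1P[->|ls].
  apply/mem_boxP => i; rewrite leq_max; apply/orP; right.
  exact: (leq_bigmax (F := fun i => absz (k i 0%R))).
by apply: (@box_le N); [exact: leq_maxl|exact: IH].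
Qed.

Lemma box0 N : 0 \in box N.
Proof. by apply/mem_boxP => i; rewrite mxE. Qed.

Definition rho k : R := 1 + \sum_i `|kc k i|.

Lemma rhoE k : rho k = 1 + \sum_i `|kc k i|.
Proof. by []. Qed.

Lemma rho_ge1 k : 1 <= rho k.
Proof. by rewrite lerDl sumr_ge0. Qed.

Lemma rho_gt0 k : 0 < rho k.
Proof. exact: lt_le_trans (rho_ge1 k). Qed.

Lemma rho_neq0 k : rho k != 0.
Proof. by rewrite gt_eqF// rho_gt0. Qed.

Lemma rho0 : rho 0 = 1.
Proof. by rewrite /rho big1 ?addr0// => i _; rewrite kc0 normr0. Qed.

Lemma rhoD k l : rho (k + l) <= rho k * rho l.
Proof.
rewrite /rho; set a := \sum_i `|kc k i|; set b := \sum_i `|kc l i|.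
have a0 : 0 <= a by exact: sumr_ge0.
have b0 : 0 <= b by exact: sumr_ge0.
have : \sum_i `|kc (k + l) i| <= a + b.
  by rewrite -big_split ler_sum// => i _; rewrite kcD ler_normD.
have := mulr_ge0 a0 b0; lra.
Qed.

Lemma rho_ge k i : 1 + `|kc k i| <= rho k.
Proof. by rewrite lerD2l (bigD1 i)//= lerDl sumr_ge0. Qed.

(** Peetre's inequality, from the submultiplicativity [rhoD]. It moves a weight through a
    convolution. *)
Lemma rho_peetre s k l : rho (k - l) ^- s * rho l ^- s <= rho k ^- s.
Proof.
rewrite -invfM -exprMn lef_pV2 ?posrE ?exprn_gt0 ?mulr_gt0 ?rho_gt0//.
rewrite lerXn2r ?nnegrE ?mulr_ge0 ?(ltW (rho_gt0 _))//.
by rewrite -[in leLHS](subrK l k) rhoD.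
Qed.

Lemma rho_le s t k : (s <= t)%N -> rho k ^- t <= rho k ^- s.
Proof.
by move=> st; rewrite lef_pV2 ?posrE ?exprn_gt0 ?rho_gt0// ler_weXn2l// rho_ge1.
Qed.

Let h N (a : int) : R := (1 + `|(a - N%:Z)%:~R|) ^- 2.

(** This is the sum of (1 + |m|)^-2 over |m| <= N. The bound carries the slack 2/(N+1) for the
    induction: the two new end terms are at most 2/(N+1) - 2/(N+2). *)
Let sum1 N : \sum_(a < N.*2.+1) h N (a : nat)%:Z <= 4 - 2 / N.+1%:R.
Proof.
elim: N => [|N IH].
  rewrite big_ord_recl big_ord0 addr0 /h /= subr0 normr0 addr0 expr1n invr1; lra.
rewrite doubleS big_ord_recr big_ord_recl /=.
under eq_bigr => i _.
  have -> : h N.+1 (bump 0 i) = h N (i : nat).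
    by rewrite /h /bump leq0n; congr ((1 + `|_%:~R|) ^- 2); lia.
  over.
have -> : h N.+1 0 = (N.+2%:R) ^- 2.
  by rewrite /h sub0r mulrNz normrN ger0_norm ?ler0n// -natrD.
have -> : h N.+1 (N.*2.+2%:Z) = (N.+2%:R) ^- 2.
  rewrite /h (_ : (N.*2.+2%:Z - N.+1%:Z) = N.+1%:Z); last by rewrite -addnn; lia.
  by rewrite ger0_norm ?ler0n// -natrD.
have n0 : 0 < N.+1%:R :> R by rewrite ltr0n.
have n1 : 0 < N.+2%:R :> R by rewrite ltr0n.
have E : N.+2%:R = N.+1%:R + 1 :> R by rewrite -natr1.
suff : 2 * N.+2%:R ^- 2 <= 2 / N.+1%:R - 2 / N.+2%:R :> R.
  move: IH; move: (N.+2%:R ^- 2) (2 / N.+1%:R) (2 / N.+2%:R) (\sum_(i < _) _) => a b c S.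
  by lra.
rewrite E; rewrite E in n1.
have -> : 2 / N.+1%:R - 2 / (N.+1%:R + 1) = 2 / (N.+1%:R * (N.+1%:R + 1)) :> R.
  by field; rewrite !gt_eqF.
rewrite ler_wpM2l// lef_pV2 ?posrE ?mulr_gt0 ?exprn_gt0//.
by rewrite expr2 ler_wpM2r ?(ltW n1)// lerDl.
Qed.

(** Since [rho k] dominates each 1 + |k_i|, its sixth power dominates the product of the three
    squares (1 + |k_i|)^2. The sum then factors, and 64 = 4^3 by [sum1]. *)
Lemma rho6_sum (s : seq K) : uniq s -> \sum_(k <- s) rho k ^- 6 <= 64.
Proof.
move=> us; have [N sN] := in_some_box s.
apply: (@le_trans _ _ (\sum_(k <- box N) rho k ^- 6)).
  rewrite (sum_sub _ us (box_uniq N) sN) lerDl sumr_ge0// => k _.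
  by rewrite invr_ge0 exprn_ge0// ltW// rho_gt0.
rewrite big_map big_enum /=.
apply: (@le_trans _ _ (\sum_(f : {ffun 'I_3 -> 'I_(N.*2.+1)}) \prod_i h N (f i : nat))).
  apply: ler_sum => f _.
  rewrite /h; rewrite [leRHS](_ : _ = (\prod_(i < 3) (1 + `|kc (emb f) i|) ^+ 2)^-1); last first.
    by rewrite -prodfV; apply: eq_bigr => i _; rewrite /kc mxE.
  have p0 i : 0 < 1 + `|kc (emb f) i| by rewrite ltr_pwDl.
  rewrite lef_pV2 ?posrE ?exprn_gt0 ?rho_gt0//; last by apply: prodr_gt0 => i _; rewrite exprn_gt0.
  rewrite (_ : 6 = 2 * 3)%N// exprM -[in leRHS](card_ord 3) -prodr_const.
  apply: ler_prod => i _; rewrite exprn_ge0 ?(ltW (p0 i))//=.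
  by rewrite lerXn2r ?nnegrE ?(ltW (p0 i)) ?(ltW (rho_gt0 _))// rho_ge.
rewrite -(bigA_distr_bigA (fun=> fun a : 'I_(N.*2.+1) => h N (a : nat))) /=.
rewrite prodr_const card_ord.
have -> : 64 = 4 ^+ 3 :> R by rewrite -natrX.
rewrite lerXn2r ?nnegrE//.
  by apply: sumr_ge0 => i _; rewrite invr_ge0 exprn_ge0// addr_ge0.
by apply: le_trans (sum1 N) _; rewrite lerBlDr lerDl divr_ge0.
Qed.

Lemma rho_out N k : k \notin box N -> N.+1%:R <= rho k.
Proof.
rewrite mem_box negb_forall => /existsP[m]; rewrite -ltnNge => km.
apply: le_trans (rho_ge k m).
rewrite -natr1 addrC lerD2l /kc -intr_norm -[N%:R]/(N%:~R) ler_int; lia.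
Qed.

(** Outside the box one spare power of the weight is worth N + 1. This is the origin of the exponent
    7 below. *)
Lemma rho7_tail (s : seq K) N : uniq s -> (forall k, k \in s -> k \notin box N) ->
  \sum_(k <- s) rho k ^- 7 <= 64 / N.+1%:R.
Proof.
move=> us sN; apply: (@le_trans _ _ (\sum_(k <- s) rho k ^- 6 / N.+1%:R)).
  rewrite big_seq [leRHS]big_seq; apply: ler_sum => k ks.
  rewrite exprS invfM mulrC ler_wpM2l ?invr_ge0 ?exprn_ge0 ?(ltW (rho_gt0 _))//.
  by rewrite lef_pV2 ?posrE ?rho_gt0 ?ltr0n// rho_out// sN.
by rewrite -mulr_suml ler_wpM2r ?invr_ge0 ?ler0n// rho6_sum.
Qed.

(** Peetre's inequality extracts the weight at k from each term and leaves six powers, which are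
    summable. So convolution with coefficients of decay s + 6 preserves the decay s. *)
Lemma rho_conv (A : seq K) s k : uniq A ->
  \sum_(l <- A) rho (k - l) ^- (s + 6) * rho l ^- s <= 64 * rho k ^- s.
Proof.
move=> uA; apply: (@le_trans _ _ (\sum_(l <- A) rho (k - l) ^- 6 * rho k ^- s)).
  apply: ler_sum => l _; rewrite addnC exprD invfM -mulrA ler_wpM2l ?rho_peetre//.
  by rewrite invr_ge0 exprn_ge0// ltW// rho_gt0.
rewrite -mulr_suml ler_wpM2r ?invr_ge0 ?exprn_ge0 ?(ltW (rho_gt0 _))//.
rewrite -(big_map (fun l => k - l) xpredT (fun l => rho l ^- 6)) rho6_sum//.
by rewrite map_inj_uniq// => x y /addrI/oppr_inj.
Qed.

End Weights.

Lemma sum3 (V : nmodType) (F : 'I_3 -> V) : \sum_i F i = F ord0 + F 1 + F (1 + 1).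
Proof.
rewrite !big_ord_recl big_ord0 addr0 addrA.
by congr (_ + F _ + F _); exact: val_inj.
Qed.

(** * Decay of coefficients and convergence of Fourier series *)

Section FourierSeries.
Context {R : realType}.
Local Notation C := (R[i])%C.
Local Notation R3 := (R * R * R)%type.
Local Notation K := 'cV[int]_3.
Local Notation cm := (@Normc.normc R).
Local Notation Re := (@complex.Re R).
Local Notation Im := (@complex.Im R).
Local Notation kc := (@kc R).
Local Notation rho := (@rho R).
Implicit Types (f : R3 -> R) (F G : R3 -> C) (k l : K) (x y : R3) (a : K -> C).

Lemma smooth_iter f i n : smooth f -> smooth (iter n (partial i) f).
Proof. by move=> sf; elim: n => //= n IH; exact: smooth_partial. Qed.

Lemma periodic_iter f i n : periodic f -> periodic (iter n (partial i) f).
Proof. by move=> sf; elim: n => //= n IH; exact: periodic_partial. Qed.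

Lemma fcr_iter f k i n : smooth f -> periodic f ->
  cm (fcr (iter n (partial i) f) k) = `|kc k i| ^+ n * cm (fcr f k).
Proof.
move=> sf pf; elim: n => [|n IH]; first by rewrite expr0 mul1r.
rewrite iterS fcr_partial; [|exact: smooth_iter|exact: periodic_iter].
by rewrite cmM IH cmM cm_i cmR mul1r exprS mulrA.
Qed.

(** [rho k] is at most four times the largest of 1 and the |k_i|. Hence decay of order s can be read
    off from s-fold derivatives in one direction at a time. *)
Lemma rho_pow s k : rho k ^+ s <= 4 ^+ s * (1 + \sum_i `|kc k i| ^+ s).
Proof.
pose m := Num.max 1 (\big[Num.max/0]_i `|kc k i|).
have m1 : 1 <= m by rewrite le_max lexx.
have m0 : 0 <= m by exact: le_trans m1.
have km i : `|kc k i| <= m by rewrite le_max; apply/orP; right; exact: le_bigmax.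
have rm : rho k <= 4 * m.
  rewrite rhoE sum3; have := km ord0; have := km 1; have := km (1 + 1); lra.
apply: (@le_trans _ _ ((4 * m) ^+ s)).
  by rewrite lerXn2r ?nnegrE ?mulr_ge0// ltW// rho_gt0.
rewrite exprMn ler_wpM2l ?exprn_ge0//.
have S0 : 0 <= \sum_i `|kc k i| ^+ s by apply: sumr_ge0 => i _; exact: exprn_ge0.
have [->|[j ->]] : m = 1 \/ exists j, m = `|kc k j|.
  rewrite /m; case: (leP 1 (\big[Num.max/0]_i `|kc k i|)) => h; last by left.
  right; have [j _ hj] := eq_bigmax (x := 0) ord0 predT (fun i => `|kc k i|) erefl (fun i _ => normr_ge0 _).
  by exists j.
- by rewrite expr1n lerDl.
- by rewrite (bigD1 j)//= addrCA lerDl addr_ge0// sumr_ge0// => i _; exact: exprn_ge0.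
Qed.

Lemma fcr_decay f s : smooth f -> periodic f ->
  exists2 D, 0 <= D & forall k, cm (fcr f k) <= D * rho k ^- s.
Proof.
move=> sf pf; have [M M0 HM] := fcr_bound sf pf.
have HB i : exists2 B, 0 <= B & forall k, `|kc k i| ^+ s * cm (fcr f k) <= B.
  have [B B0 HB] := fcr_bound (smooth_iter i s sf) (periodic_iter i s pf).
  by exists B => // k; rewrite -fcr_iter.
have [B0 p0 h0] := HB ord0; have [B1 p1 h1] := HB 1; have [B2 p2 h2] := HB (1 + 1).
exists (4 ^+ s * (M + (B0 + B1 + B2))); first by rewrite mulr_ge0 ?exprn_ge0 ?addr_ge0.
move=> k; rewrite ler_pdivlMr ?exprn_gt0 ?rho_gt0// mulrC.
apply: le_trans (ler_wpM2r (cm_ge0 _) (rho_pow s k)) _.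
rewrite -mulrA ler_wpM2l ?exprn_ge0// mulrDl mul1r lerD//.
rewrite sum3 !mulrDl.
by rewrite !lerD.
Qed.

(** The limit inherits the Cauchy rate. Carrying rates instead of bare convergence keeps the
    dependence on parameters explicit. *)
Lemma cvg_of_rate (u : R^nat) (e : R) : (forall N M, (N <= M)%N -> `|u M - u N| <= e / N.+1%:R) ->
  cvg (u @ \oo) /\ forall N, `|limn u - u N| <= e / N.+1%:R.
Proof.
move=> hu.
have cu : cvg (u @ \oo).
  apply/cauchy_cvgP/cauchy_ballP => /= r r0.
  have e0 : 0 <= e.
    by have := hu 0%N 0%N (leqnn _); rewrite subrr normr0 divr1.
  have [N hN] : exists N, e / N.+1%:R < r / 2.
    pose N := Num.truncn (2 * e / r); exists N.
    rewrite ltr_pdivrMr ?ltr0n//.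
    have := truncnS_gt (2 * e / r); rewrite -/N.
    by rewrite ltr_pdivrMr//; lra.
  exists (u @` [set n | (N <= n)%N], u @` [set n | (N <= n)%N]) => /=.
    by split; exists N => // n /= Nn; exists n.
  move=> [_ _] [[n Nn <-] [m Nm <-]] /=; rewrite /ball/=.
  have := hu _ _ Nn; have := hu _ _ Nm; rewrite -[`|u m - _|]normrN opprB => h1 h2.
  have := ler_normD (u n - u N) (u N - u m); rewrite addrA subrK => h3.
  by apply: (le_lt_trans h3); rewrite [ltRHS]splitr ltrD// (le_lt_trans _ hN).
split=> // N.
have cd : (fun M => `|u M - u N|) @ \oo --> `|limn u - u N|.
  by apply: cvg_norm; apply: cvgB => //; exact: cvg_cst.
rewrite -(cvg_lim _ cd)//; apply: limr_le; first by apply/cvg_ex; eexists; exact: cd.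
by exists N => // M /= NM; exact: hu.
Qed.

Definition psum a N x : C := \sum_(k <- box N) a k * ee k x.

Definition fser a x : C :=
  Complex (limn (fun N => Re (psum a N x))) (limn (fun N => Im (psum a N x))).

Lemma psum_diff a (D : R) N M x : 0 <= D -> (forall k, cm (a k) <= D * rho k ^- 7) -> (N <= M)%N ->
  cm (psum a M x - psum a N x) <= (D * 64) / N.+1%:R.
Proof.
move=> D0 ha NM; rewrite /psum (sum_sub _ (box_uniq N) (box_uniq M) (box_le NM)) addrC addKr.
apply: le_trans (cm_sum _ _ _) _.
apply: (@le_trans _ _ (D * \sum_(k <- [seq k <- box M | k \notin box N]) rho k ^- 7)).
  by rewrite mulr_sumr; apply: ler_sum => k _; rewrite cmM cm_ee mulr1.
rewrite -mulrA ler_wpM2l//; apply: rho7_tail; first exact/filter_uniq/box_uniq.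
by move=> k; rewrite mem_filter => /andP[].
Qed.

Lemma cbm_psum a N : cbm (psum a N).
Proof.
by apply: cbm_sum => k _; apply: cbmM; [exact: cbm_cst|exact: cbm_ee].
Qed.

Lemma fc_psum a N k : k \in box N -> fc (psum a N) k = a k.
Proof.
move=> kN; rewrite /fc.
rewrite (_ : (fun x => _) = fun x => \sum_(l <- box N) a l * ee (l - k) x); last first.
  apply/funext => x; rewrite /psum mulr_suml; apply: eq_bigr => l _.
  by rewrite -mulrA -eeD.
rewrite avg_sum => [|l _]; last by apply/cintZ/cbm_int/cbm_ee.
have E l : avg (fun x => a l * ee (l - k) x) = a l * avg (ee (l - k)).
  by apply: avgZ; exact/cbm_int/cbm_ee.
rewrite (eq_bigr _ (fun l _ => E l)).
rewrite (bigD1_seq k) ?box_uniq//= subrr avg_ee eqxx mulr1 big1_seq ?addr0// => l /andP[lk _].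
by rewrite avg_ee subr_eq0 (negbTE lk) mulr0.
Qed.

Section Series.
Variables (a : K -> C) (D : R).
Hypothesis D0 : 0 <= D.
Hypothesis ha : forall k, cm (a k) <= D * rho k ^- 7.

Let part (h : C -> R) : (forall z w, h (z - w) = h z - h w) -> (forall z, `|h z| <= cm z) ->
  forall x, cvg ((fun N => h (psum a N x)) @ \oo) /\
  forall N, `|limn (fun N => h (psum a N x)) - h (psum a N x)| <= (D * 64) / N.+1%:R.
Proof.
move=> hB hc x; apply: cvg_of_rate => N M NM.
by rewrite -hB (le_trans (hc _))// (psum_diff x D0 ha NM).
Qed.

Let ReB z w : Re (z - w) = Re z - Re w. Proof. by rewrite ReD ReN. Qed.
Let ImB z w : Im (z - w) = Im z - Im w. Proof. by rewrite ImD ImN. Qed.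

Lemma fser_rate x N : cm (fser a x - psum a N x) <= (D * 128) / N.+1%:R.
Proof.
have [_ /(_ N) h1] := part ReB (@Re_le_cm R) x.
have [_ /(_ N) h2] := part ImB (@Im_le_cm R) x.
apply: le_trans (cm_le _) _; rewrite ReB ImB.
have -> : D * 128 / N.+1%:R = D * 64 / N.+1%:R + D * 64 / N.+1%:R by ring.
exact: lerD.
Qed.

Lemma fser_cbm : cbm (fser a).
Proof.
have [[mr [M1 H1]] [mi [M2 H2]]] := cbm_psum a 0.
have B x := fser_rate x 0.
split; split.
- apply: (@measurable_fun_cvg _ _ _ _ (fun N x => Re (psum a N x))) => [N|x _].
    by have [[]] := cbm_psum a N.
  by have [] := part ReB (@Re_le_cm R) x.
- exists (M1 + D * 128) => x /=.
  have := le_trans (Re_le_cm _) (B x); rewrite ReB divr1 => h.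
  have := ler_normD (Re (fser a x) - Re (psum a 0 x)) (Re (psum a 0 x)).
  rewrite subrK; have := H1 x; rewrite /=; lra.
- apply: (@measurable_fun_cvg _ _ _ _ (fun N x => Im (psum a N x))) => [N|x _].
    by have [_ []] := cbm_psum a N.
  by have [] := part ImB (@Im_le_cm R) x.
- exists (M2 + D * 128) => x /=.
  have := le_trans (Im_le_cm _) (B x); rewrite ImB divr1 => h.
  have := ler_normD (Im (fser a x) - Im (psum a 0 x)) (Im (psum a 0 x)).
  rewrite subrK; have := H2 x; rewrite /=; lra.
Qed.

Lemma fser_periodic : periodic (fser a).
Proof.
have pp N : periodic (psum a N) by move=> i x; apply: eq_bigr => k _; rewrite ee_periodic.
by move=> i x; rewrite /fser; congr (Complex (limn _) (limn _)); apply/funext => N; rewrite pp.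
Qed.

(** The Archimedean property. Limit arguments end here: a quantity that does not depend on N is
    bounded by c/(N+1) for all large N. *)
Lemma le0_of_rate (t c : R) N0 : (forall N, (N0 <= N)%N -> t <= c / N.+1%:R) -> t <= 0.
Proof.
move=> h; rewrite leNgt; apply/negP => t0.
pose N := maxn N0 (Num.truncn (c / t)).
have := h N (leq_maxl _ _); apply/negP; rewrite -ltNge ltr_pdivrMr ?ltr0n//.
rewrite -ltr_pdivrMl// mulrC.
by rewrite -truncn_le_nat leq_maxr.
Qed.

Lemma cm_le0 (z w : C) : cm (z - w) <= 0 -> z = w.
Proof.
move=> h; have /eqP : cm (z - w) = 0 by apply/eqP; rewrite eq_le h cm_ge0.
by rewrite cm_eq0 subr_eq0 => /eqP.
Qed.

(** The partial sums have the exact coefficient as soon as the box contains k, and they converge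
    uniformly. *)
Lemma fc_fser k : fc (fser a) k = a k.
Proof.
have [N0 hN0] := in_some_box [:: k].
have [L L0 HL] := avg_bound (cbm_int (@cbm_ee R (- k))).
apply: cm_le0.
apply: (le0_of_rate (c := L * (D * 128)) (N0 := N0)) => N NN.
have kN : k \in box N by apply: (box_le NN); apply: hN0; rewrite inE.
rewrite -(fc_psum a kN) -mulrA.
have cp := cbm_psum a N; have cs := fser_cbm.
have -> : fc (fser a) k - fc (psum a N) k = avg (fun x => ee (- k) x * (fser a x - psum a N x)).
  rewrite /fc -[X in _ + X]mulN1r -avgZ; last by apply: cbm_int; apply: cbmM => //; exact: cbm_ee.
  rewrite -avgD.
  - by apply: avg_eq => x _; ring.
  - by apply: cbm_int; apply: cbmM => //; exact: cbm_ee.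
  - by apply/cintZ/cbm_int; apply: cbmM => //; exact: cbm_ee.
apply: HL => [|x _]; last exact: fser_rate.
by apply: cbm_ext (cbmD cs (cbmM (cbm_cst (-1)) cp)) => x; rewrite mulN1r.
Qed.

End Series.

End FourierSeries.

(** * Chord length on the circle *)

Section Chord.
Context {R : realType}.
Local Notation C := (R[i])%C.
Local Notation cm := (@Normc.normc R).

Lemma cos_ge_half (s : R) : 0 <= s <= pi / 4 -> 2^-1 <= cos s.
Proof.
move=> /andP[s0 s1]; have P := @pi_gt0 R.
have c0 : 0 <= cos s by apply: cos_ge0_pihalf; apply/andP; split; lra.
have : 0 <= cos (s *+ 2) by apply: cos_ge0_pihalf; apply/andP; split; lra.
rewrite cos_mulr2n; set c := cos s in c0 *; rewrite leNgt => h; apply/negP => ch.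
move: h => /negP; apply; nra.
Qed.

(** Double-angle formula, then the mean value theorem on [0, s/2]. Both cosines that appear are at
    least 1/2, their arguments lying in [0, pi/4]. *)
Lemma sin_ge_quarter (s : R) : 0 <= s <= pi / 2 -> s / 4 <= sin s.
Proof.
move=> /andP[s0 s1]; have P := @pi_gt0 R.
have s2 : 0 <= s / 2 by lra.
have [x xI] := MVT_segment s2 (fun x _ => is_derive_sin x)
  (continuous_subspaceT (@continuous_sin R)).
move: xI; rewrite in_itv /= sin0 !subr0 => /andP[x0 x1] E.
have c1 : 2^-1 <= cos x by apply: cos_ge_half; apply/andP; split; lra.
have c2 : 2^-1 <= cos (s / 2) by apply: cos_ge_half; apply/andP; split; lra.
have Es : s = (s / 2) *+ 2 by rewrite mulr2n; lra.
rewrite [in sin s]Es sin_mulr2n E mulr2n.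
move: c1 c2; move: (cos x) (cos (s / 2)) => a b c1 c2.
have h : 4^-1 <= b * a by nra.
nra.
Qed.

Definition cexp (t : R) : C := Complex (cos t) (sin t).
(** The distance from 1 to exp (i t): insensitive to multiples of 2 pi, subadditive, and with square
    2 - 2 cos t, a trigonometric polynomial. *)
Definition chord (t : R) : R := cm (1 - cexp t).

Lemma cexpD s t : cexp (s + t) = cexp s * cexp t.
Proof. by apply: complex_ext; rewrite ?ReM ?ImM /= ?cosD ?sinD //; rewrite addrC. Qed.

Lemma cm_cexp t : cm (cexp t) = 1.
Proof. by rewrite /= cos2Dsin2 sqrtr1. Qed.

Lemma chord_sqr t : chord t ^+ 2 = 2 - 2 * cos t.
Proof.
rewrite /chord cm_sqr ReD ImD ReN ImN /=.
by have := cos2Dsin2 t; move: (cos t) (sin t) => a b h; nra.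
Qed.

Lemma chord_ge0 t : 0 <= chord t. Proof. exact: cm_ge0. Qed.

Lemma cexp_dist s t : cm (cexp s - cexp t) = chord (s - t).
Proof.
rewrite /chord; have -> : cexp s - cexp t = (cexp (s - t) - 1) * cexp t.
  by rewrite mulrBl -cexpD subrK mul1r.
rewrite cmM cm_cexp mulr1.
by rewrite -cmN opprB.
Qed.

Lemma chordN t : chord (- t) = chord t.
Proof. by rewrite -(sub0r t) -cexp_dist -cmN opprB cexp_dist subr0. Qed.

Lemma chordD s t : chord (s + t) <= chord s + chord t.
Proof.
have := cmD (cexp (s + t) - cexp t) (cexp t - cexp 0).
by rewrite addrA subrK !cexp_dist !subr0 addrK.
Qed.

Lemma chordMn (n : nat) t : chord (n%:R * t) <= n%:R * chord t.
Proof.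
elim: n => [|n IH].
  by rewrite !mul0r -[X in chord X](subrr 0) -cexp_dist subrr cm0.
rewrite -[n.+1]addn1 natrD !mulrDl !mul1r (le_trans (chordD _ _))//.
by rewrite lerD2r.
Qed.

Lemma chordMz (n : int) t : chord (n%:~R * t) <= `|n%:~R| * chord t.
Proof.
case: n => n; first by rewrite ger0_norm ?ler0n// chordMn.
by rewrite NegzE mulrNz mulNr chordN normrN ger0_norm ?ler0n// chordMn.
Qed.

(** For t >= 0 the chord is 2 sin (t/2), to which [sin_ge_quarter] applies. *)
Lemma chord_ge t : `|t| <= pi -> `|t| <= 4 * chord t.
Proof.
move=> tp; have t0 := normr_ge0 t.
have -> : chord t = chord `|t| by case: (ger0P t) => // _; rewrite chordN.
move: (`|t|) tp t0 => u up u0.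
have s4 := @sin_ge_quarter (u / 2).
have h : u / 2 / 4 <= sin (u / 2) by apply: s4; apply/andP; split; lra.
have : (2 * sin (u / 2)) ^+ 2 = chord u ^+ 2.
  rewrite chord_sqr -[in RHS](mulr1 u) (_ : u * 1 = (u / 2) *+ 2); last by rewrite mulr2n; lra.
  rewrite cos_mulr2n; have := cos2Dsin2 (u / 2); rewrite mulr2n.
  by move: (cos _) (sin _) => a b hh; nra.
move/eqP; rewrite eqrXn2// ?chord_ge0// => [/eqP <-|]; lra.
Qed.

Lemma near_period (t : R) : exists n : int, `|t - 2 * pi * n%:~R| <= pi.
Proof.
have P := @pi_gt0 R; have P2 := @twopi_gt0 R.
exists (Num.floor (t / (2 * pi) + 2^-1)).
have /andP[] := floor_itv (t / (2 * pi) + 2^-1); rewrite intrD.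
move: (Num.floor _)%:~R => z h1 h2; rewrite ler_norml.
have e : t = t / (2 * pi) * (2 * pi) by rewrite divfK// gt_eqF.
rewrite [in X in X && _]e [in X in _ && X]e; move: (t / (2 * pi)) h1 h2 => v h1 h2.
apply/andP; split; nra.
Qed.

End Chord.

(** * Lipschitz estimates in the chord distance *)

Section Fejer.
Context {R : realType}.
Local Notation C := (R[i])%C.
Local Notation R3 := (R * R * R)%type.
Local Notation K := 'cV[int]_3.
Local Notation cm := (@Normc.normc R).
Local Notation kc := (@kc R).
Local Notation rho := (@rho R).
Implicit Types (f : R3 -> R) (F G : R3 -> C) (k l : K) (x y : R3).

Definition dl (i : 'I_3) : K := \col_j (j == i)%:Z.

Definition co (i : 'I_3) x : R := kd (dl i) x.

Lemma kc_dl i j : kc (dl i) j = (j == i)%:R.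
Proof. by rewrite -[LHS]/((dl i j 0)%:~R) mxE; case: (j == i). Qed.

Lemma coE x : (co ord0 x = x.1.1) * (co 1 x = x.1.2) * (co (1 + 1) x = x.2).
Proof. by rewrite /co /kd !kc_dl /= !(mul0r, mul1r, add0r, addr0). Qed.

Lemma kd_co k x : kd k x = \sum_i kc k i * co i x.
Proof. by rewrite sum3 !coE. Qed.

(* Translation-invariant stand-in for the distance on the torus. *)
Definition tdist x y : R := \sum_i chord (co i x - co i y).

Lemma tdist_ge0 x y : 0 <= tdist x y.
Proof. by apply: sumr_ge0 => i _; exact: chord_ge0. Qed.

Lemma ee_lip k x y : cm (ee k x - ee k y) <= rho k * tdist x y.
Proof.
rewrite -[ee k x]/(cexp (kd k x)) -[ee k y]/(cexp (kd k y)) cexp_dist.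
have -> : kd k x - kd k y = kc k ord0 * (co ord0 x - co ord0 y) +
    kc k 1 * (co 1 x - co 1 y) + kc k (1 + 1) * (co (1 + 1) x - co (1 + 1) y).
  by rewrite !kd_co !sum3; ring.
apply: (@le_trans _ _ (\sum_i `|kc k i| * chord (co i x - co i y))).
  rewrite sum3; apply: le_trans (chordD _ _) _; apply: lerD; last exact: chordMz.
  by apply: le_trans (chordD _ _) _; apply: lerD; exact: chordMz.
rewrite /tdist mulr_sumr; apply: ler_sum => i _; rewrite ler_wpM2r ?chord_ge0//.
by have := rho_ge (R := R) k i; lra.
Qed.

(** A character of frequency k costs one power of [rho k], and the six powers that remain are
    summable. *)
Lemma fser_lip (a : K -> C) D x y : 0 <= D -> (forall k, cm (a k) <= D * rho k ^- 7) ->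
  cm (fser a x - fser a y) <= D * 64 * tdist x y.
Proof.
move=> D0 ha; rewrite -subr_le0.
apply: (le0_of_rate (c := D * 256) (N0 := 0%N)) => N _.
have h1 := fser_rate D0 ha x N; have h2 := fser_rate D0 ha y N.
have h3 : cm (psum a N x - psum a N y) <= D * 64 * tdist x y.
  rewrite /psum -sumrB; apply: le_trans (cm_sum _ _ _) _.
  apply: (@le_trans _ _ (\sum_(k <- box N) D * tdist x y * rho k ^- 6)).
    apply: ler_sum => k _; rewrite -mulrBr cmM.
    apply: le_trans (ler_pM (cm_ge0 _) (cm_ge0 _) (ha k) (ee_lip k x y)) _.
    rewrite le_eqVlt; apply/orP; left; apply/eqP.
    by field; rewrite rho_neq0.
  rewrite -mulr_sumr [leRHS]mulrAC ler_wpM2l ?mulr_ge0 ?tdist_ge0//.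
  by rewrite rho6_sum// box_uniq.
have e : fser a x - fser a y = (fser a x - psum a N x) + (psum a N x - psum a N y) - (fser a y - psum a N y).
  by ring.
rewrite e lerBlDr.
have := cmB ((fser a x - psum a N x) + (psum a N x - psum a N y)) (fser a y - psum a N y).
have := cmD (fser a x - psum a N x) (psum a N x - psum a N y).
have -> : D * 256 / N.+1%:R = D * 128 / N.+1%:R + D * 128 / N.+1%:R by ring.
move: (D * 128 / N.+1%:R) (D * 64 * tdist x y) h1 h2 h3 => p q h1 h2 h3 h4 h5; lra.
Qed.

(** Periodicity first reduces t modulo 2 pi to some |s| <= pi, where |s| <= 4 chord s; the mean
    value theorem does the rest. *)
Lemma line_lip f i M x t : smooth f -> periodic f -> (forall y, `|partial i f y| <= M) ->
  `|f (x + t *: basis_vec i) - f x| <= M * (4 * chord t).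
Proof.
move=> sf pf hM; have [n hn] := near_period t.
set s := t - 2 * pi * n%:~R in hn *.
have -> : f (x + t *: basis_vec i) = f (x + s *: basis_vec i).
  rewrite -(periodic_int pf i n (x + s *: basis_vec i)) -addrA -scalerDl /s.
  by rewrite subrK.
have -> : chord t = chord s.
  apply/eqP; rewrite -(@eqrXn2 _ 2)// ?chord_ge0// !chord_sqr.
  by rewrite -(cos_int s n) /s subrK.
have M0 : 0 <= M by exact: le_trans (hM x).
have hs := chord_ge hn.
apply: (@le_trans _ _ (M * `|s|)); last by rewrite ler_wpM2l.
have dl' u := line_is_derive i x u (smooth_differentiable sf).
have cf : continuous (fun u : R => f (x + u *: basis_vec i)).
  move=> u; apply/differentiable_continuous/derivable1_diffP.
  by case: (dl' u).
have mvt a b : a <= b -> `|f (x + b *: basis_vec i) - f (x + a *: basis_vec i)| <= M * (b - a).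
  move=> ab; have [c _ ->] := MVT_segment ab (fun u _ => dl' u) (continuous_subspaceT cf).
  by rewrite normrM ler_pM// ger0_norm ?subr_ge0.
have [s0|/ltW s0] := lerP 0 s.
  by rewrite (ger0_norm s0); have := mvt 0 s s0; rewrite scale0r addr0 subr0.
by rewrite (ler0_norm s0) distrC; have := mvt s 0 s0; rewrite scale0r addr0 sub0r.
Qed.

(** The path from y to x changes one coordinate at a time. *)
Lemma smooth_lip f : smooth f -> periodic f -> exists2 L, 0 <= L &
  forall x y, `|f x - f y| <= L * tdist x y.
Proof.
move=> sf pf.
have HB i : exists M, forall y, `|partial i f y| <= M.
  apply: periodic_bounded; first exact/smooth_continuous/smooth_partial.
  exact: periodic_partial.
have [M0 h0] := HB ord0; have [M1 h1] := HB 1; have [M2 h2] := HB (1 + 1).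
have p0 : 0 <= M0 := le_trans (normr_ge0 _) (h0 0).
have p1 : 0 <= M1 := le_trans (normr_ge0 _) (h1 0).
have p2 : 0 <= M2 := le_trans (normr_ge0 _) (h2 0).
exists (4 * (M0 + M1 + M2)); first by rewrite mulr_ge0 ?addr_ge0.
move=> x y; rewrite /tdist sum3 !coE.
pose y1 := y + (x.1.1 - y.1.1) *: basis_vec ord0.
pose y2 := y1 + (x.1.2 - y.1.2) *: basis_vec 1.
have e : x = y2 + (x.2 - y.2) *: basis_vec (1 + 1).
  by rewrite /y2 /y1 basis_decomp !subrKC; case: (x) => [[? ?] ?].
have g2 := line_lip y2 (x.2 - y.2) sf pf h2.
have g1 := line_lip y1 (x.1.2 - y.1.2) sf pf h1.
have g0 := line_lip y (x.1.1 - y.1.1) sf pf h0.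
rewrite -e in g2; rewrite -/y2 in g1; rewrite -/y1 in g0.
have := ler_normD (f x - f y2) (f y2 - f y); rewrite addrA subrK.
have := ler_normD (f y2 - f y1) (f y1 - f y); rewrite addrA subrK.
have := chord_ge0 (x.1.1 - y.1.1); have := chord_ge0 (x.1.2 - y.1.2); have := chord_ge0 (x.2 - y.2).
move: (chord _) (chord _) (chord _) g0 g1 g2 => a b c g0 g1 g2 a0 b0 c0 t1 t2.
have := mulr_ge0 p0 a0; have := mulr_ge0 p0 b0; have := mulr_ge0 p0 c0.
have := mulr_ge0 p1 a0; have := mulr_ge0 p1 b0; have := mulr_ge0 p1 c0.
have := mulr_ge0 p2 a0; have := mulr_ge0 p2 b0; have := mulr_ge0 p2 c0.
lra.
Qed.

End Fejer.

(** * Fourier inversion by the Fejer kernel, Parseval and convolution *)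

Section Inversion.
Context {R : realType}.
Local Notation C := (R[i])%C.
Local Notation R3 := (R * R * R)%type.
Local Notation K := 'cV[int]_3.
Local Notation cm := (@Normc.normc R).
Local Notation Re := (@complex.Re R).
Local Notation rho := (@rho R).
Implicit Types (f : R3 -> R) (F G : R3 -> C) (k l : K) (x y : R3).

(** The squared modulus of the Dirichlet kernel of the box, hence nonnegative. It is not normalized:
    its mean in y is the number of modes of the box. *)
Definition fejer_kernel N x y : R := cm (\sum_(a <- box N) ee a x * ee (- a) y) ^+ 2.
Local Notation ker := fejer_kernel.

Lemma fejer_kernelE N x y : (ker N x y)%:C%C =
  \sum_(a <- box N) \sum_(b <- box N) ee (a - b) x * ee (- (a - b)) y.
Proof.
rewrite /ker -mul_conj conj_sum mulr_suml; apply: eq_bigr => a _.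
rewrite mulr_sumr; apply: eq_bigr => b _.
rewrite conjM !ee_conj opprK opprB (eeD a (- b) x) (eeD b (- a) y); ring.
Qed.

Lemma cbm_fejer N x : cbm (fun y => (ker N x y)%:C%C).
Proof.
apply: (cbm_ext (F := fun y => \sum_(a <- box N) \sum_(b <- box N) ee (a - b) x * ee (- (a - b)) y)).
  by move=> y; rewrite fejer_kernelE.
by apply: cbm_sum => a _; apply: cbm_sum => b _; apply: cbmM; [exact: cbm_cst|exact: cbm_ee].
Qed.

Lemma avg_fejer F N x : cint F -> avg (fun y => F y * (ker N x y)%:C%C) =
  \sum_(a <- box N) \sum_(b <- box N) ee (a - b) x * fc F (a - b).
Proof.
move=> hF.
have hE k : cint (fun y => F y * ee k y) by apply: cintM => //; exact: cbm_ee.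
rewrite (_ : (fun y => _) = fun y => \sum_(a <- box N) \sum_(b <- box N)
    ee (a - b) x * (F y * ee (- (a - b)) y)); last first.
  apply/funext => y; rewrite fejer_kernelE mulr_sumr; apply: eq_bigr => a _.
  by rewrite mulr_sumr; apply: eq_bigr => b _; ring.
rewrite avg_sum => [|a _]; last by apply: cint_sum => b _; exact/cintZ/hE.
apply: eq_bigr => a _; rewrite avg_sum => [|b _]; last exact/cintZ/hE.
by apply: eq_bigr => b _; rewrite avgZ.
Qed.

Lemma fc_ee k l : fc (ee k) l = (k == l)%:R :> C.
Proof.
rewrite /fc (_ : (fun x => _) = ee (k - l)); first by rewrite avg_ee subr_eq0.
by apply/funext => x; rewrite -eeD.
Qed.

Lemma fc_cst (c : C) k : fc (fun=> c) k = c * (k == 0)%:R.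
Proof.
rewrite /fc avgZ; last exact/cbm_int/cbm_ee.
by rewrite avg_ee oppr_eq0.
Qed.

Lemma fcD F G k : cint F -> cint G -> fc (fun x => F x + G x) k = fc F k + fc G k.
Proof.
move=> hF hG; rewrite /fc -avgD; [|by apply: cintM => //; exact: cbm_ee..].
by apply: avg_eq => x _; rewrite mulrDl.
Qed.

Lemma fcZ c F k : cint F -> fc (fun x => c * F x) k = c * fc F k.
Proof.
move=> hF; rewrite /fc -avgZ; last by apply: cintM => //; exact: cbm_ee.
by apply: avg_eq => x _; rewrite mulrA.
Qed.

Lemma avg_Re_le F G : cint F -> cint G -> (forall x, cube x -> Re (F x) <= Re (G x)) ->
  Re (avg F) <= Re (avg G).
Proof.
move=> [f1 f2] [g1 g2] h; rewrite /avg !ReM /= !mul0r !subr0.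
have P : 0 <= (2 * pi) ^- 3 :> R by rewrite invr_ge0 exprn_ge0// ltW// twopi_gt0.
exact/(ler_wpM2l P)/(icube_le f1 g1 h).
Qed.

Lemma size_box N : size (box N) = ((N.*2.+1) ^ 3)%N.
Proof. by rewrite size_map -cardE card_ffun !card_ord. Qed.

Let m N i : R := \sum_(a <- box N) \sum_(b <- box N) (a - b == - dl i)%:R.

(** [m N i] is the weight of the mode [- dl i] in the kernel. Each b of the smaller box provides the
    pair (b - dl i, b) in the larger one, so this weight is almost that of the mode 0. *)
Let m_ge M i : (size (box M))%:R <= m M.+1 i.
Proof.
rewrite /m exchange_big (sum_sub _ (box_uniq M) (box_uniq M.+1) (box_le (leqnSn M))) /=.
rewrite -[leLHS]addr0 lerD//; last by apply: sumr_ge0 => b _; apply: sumr_ge0.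
rewrite -sum1_size natr_sum big_seq [leRHS]big_seq; apply: ler_sum => b bM.
have h : b - dl i \in box M.+1.
  apply/mem_boxP => j; have := mem_boxP _ _ bM j; rewrite !mxE.
  by case: (j == i); move: (b j 0) => z; lia.
by rewrite (bigD1_seq (b - dl i)) ?box_uniq//= addrAC subrr add0r eqxx lerDl sumr_ge0.
Qed.

Let split_exchange (V : nmodType) (s : seq K) (X : K -> K -> V) (Y : K -> K -> 'I_3 -> V) :
  \sum_(a <- s) \sum_(b <- s) (X a b + \sum_i Y a b i) =
  \sum_(a <- s) \sum_(b <- s) X a b + \sum_i \sum_(a <- s) \sum_(b <- s) Y a b i.
Proof.
rewrite [X in _ = _ + X]exchange_big -big_split; apply: eq_bigr => a _ /=.
by rewrite [X in _ = _ + X]exchange_big -big_split.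
Qed.

(* The kernel concentrates at [y = x]; as in Korovkin's theorem, this only has to
   be checked on the modes 0 and [- dl i], since [chord ^+ 2] is [2 - 2 cos]. *)
Lemma fejer_le0 F x : cbm F -> (forall k, fc F k = 0) ->
  (forall e, 0 < e -> exists2 L, 0 <= L & forall y, cube y ->
     cm (F x - F y) <= e + L * \sum_i chord (co i x - co i y) ^+ 2) ->
  Re (F x) <= 0.
Proof.
move=> hF F0 hosc; apply/ler_addgt0Pr => e e0; rewrite add0r -subr_le0.
have [L L0 hL] := hosc e e0.
(* 18 = 6 * 3: the squared chords contribute at most 6 (n - n'), and (n - n') (M + 1) <= 3 n. *)
apply: (le0_of_rate (c := 18 * L) (N0 := 0%N)) => M _.
pose n : R := (size (box M.+1))%:R; pose n' : R := (size (box M))%:R.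
have cF := cbm_int hF; have ck := cbm_fejer M.+1 x.
pose c2 : C := (2 : R)%:C%C; have Rec2 z : Re (c2 * z) = 2 * Re z by rewrite ReM /= mul0r subr0.
(* A trigonometric polynomial whose real part is the bound supplied by [hL]. *)
pose G y : C := (e%:C%C + L%:C%C * \sum_i (c2 + - c2 * (ee (dl i) x * ee (- dl i) y))).
have cG : cbm G.
  apply: cbmD; first exact: cbm_cst.
  apply: cbmM; first exact: cbm_cst.
  apply: cbm_sum => i _; apply: cbmD; first exact: cbm_cst.
  apply: cbmM; first exact: cbm_cst.
  by apply: cbmM; [exact: cbm_cst|exact: cbm_ee].
have ReG y : Re (G y) = e + L * \sum_i chord (co i x - co i y) ^+ 2.
  rewrite /G ReD ReM /= mul0r subr0 Re_sum; congr (_ + _ * _).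
  apply: eq_bigr => i _; rewrite chord_sqr cosB ReD mulNr ReN Rec2 ReM /=.
  by rewrite kdN cosN sinN mulrN opprK -[kd (dl i) x]/(co i x) -[kd (dl i) y]/(co i y).
have key : Re (avg (fun y => (F x - F y) * (ker M.+1 x y)%:C%C)) <=
           Re (avg (fun y => G y * (ker M.+1 x y)%:C%C)).
  apply: avg_Re_le.
  - apply/cbm_int/cbmM => //; apply: (cbm_ext (F := fun y => F x + (-1) * F y)).
      by move=> y; rewrite mulN1r.
    by apply: cbmD; [exact: cbm_cst|apply: cbmM => //; exact: cbm_cst].
  - exact/cbm_int/cbmM.
  move=> y cy; rewrite !ReM /= !mulr0 !subr0 ler_wpM2r ?sqr_ge0// ReG.
  exact: le_trans (le_trans (ler_norm _) (Re_le_cm _)) (hL y cy).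
have sumD (c : C) : \sum_(a <- box M.+1) \sum_(b <- box M.+1)
    (ee (a - b) x * (c * (a - b == 0)%:R)) = c * n%:C%C.
  have H a : a \in box M.+1 -> \sum_(b <- box M.+1) (ee (a - b) x * (c * (a - b == 0)%:R)) = c.
    move=> aM; rewrite (bigD1_seq a) ?box_uniq//= subrr ee0 eqxx mul1r mulr1.
    by rewrite big1 ?addr0// => b ba; rewrite subr_eq0 eq_sym (negbTE ba) !mulr0.
  rewrite (eq_big_seq (fun=> c) H).
  by rewrite big_const_seq count_predT iter_addr_0 -mulr_natr /n rmorph_nat.
(* All coefficients of F vanish, so only the constant F x meets the kernel, through its mode 0. *)
have E1 : avg (fun y => (F x - F y) * (ker M.+1 x y)%:C%C) = F x * n%:C%C.
  rewrite (_ : (fun y => _) = fun y => (F x + (-1) * F y) * (ker M.+1 x y)%:C%C); last first.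
    by apply/funext => y; rewrite mulN1r.
  rewrite avg_fejer; last by apply: cintD; [exact/cbm_int/cbm_cst|exact: cintZ].
  rewrite -sumD; apply: eq_bigr => a _; apply: eq_bigr => b _; congr (_ * _).
  rewrite fcD; [|exact/cbm_int/cbm_cst|exact: cintZ].
  by rewrite fcZ// F0 mulr0 addr0 fc_cst.
have E2 : Re (avg (fun y => G y * (ker M.+1 x y)%:C%C)) = e * n + L * \sum_i (2 * n - 2 * m M.+1 i).
  have cE i : cint (fun y => ee (dl i) x * ee (- dl i) y) by exact/cintZ/cbm_int/cbm_ee.
  have cS i : cint (fun y => c2 + - c2 * (ee (dl i) x * ee (- dl i) y)).
    by apply: cintD; [exact/cbm_int/cbm_cst|exact: cintZ].
  have cSS : cint (fun y => \sum_i (c2 + - c2 * (ee (dl i) x * ee (- dl i) y))).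
    by apply: cint_sum => i _; exact: cS.
  rewrite avg_fejer; last exact: cbm_int.
  have fcG k : fc G k = e%:C%C * (k == 0)%:R +
      L%:C%C * \sum_i (c2 * (k == 0)%:R - c2 * (ee (dl i) x * (k == - dl i)%:R)).
    rewrite /G fcD; [|exact/cbm_int/cbm_cst|exact: cintZ].
    rewrite fc_cst fcZ//; congr (_ + _ * _).
    rewrite /fc (_ : (fun y => _) = fun y => \sum_i (c2 + - c2 * (ee (dl i) x * ee (- dl i) y)) * ee (- k) y); last first.
      by apply/funext => y; rewrite mulr_suml.
    rewrite avg_sum => [|i _]; last by apply: cintM => //; exact: cbm_ee.
    apply: eq_bigr => i _; rewrite -[LHS]/(fc (fun y => c2 + - c2 * (ee (dl i) x * ee (- dl i) y)) k).
    rewrite fcD; [|exact/cbm_int/cbm_cst|exact: cintZ].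
    rewrite fc_cst fcZ// fcZ; last exact/cbm_int/cbm_ee.
    by rewrite fc_ee mulNr [- dl i == k]eq_sym.
  transitivity (Re (e%:C%C * n%:C%C + L%:C%C * \sum_i (c2 * n%:C%C - c2 * (m M.+1 i)%:C%C))); last first.
    rewrite ReD !ReM /= !mul0r !subr0 Re_sum; congr (_ + _ * _); apply: eq_bigr => i _.
    by rewrite ReD ReN !Rec2.
  congr Re.
  have mE i : \sum_(a <- box M.+1) \sum_(b <- box M.+1)
      (ee (a - b) x * (ee (dl i) x * (a - b == - dl i)%:R)) = (m M.+1 i)%:C%C.
    rewrite /m rmorph_sum; apply: eq_bigr => a _; rewrite rmorph_sum; apply: eq_bigr => b _.
    case: eqP => [->|_]; last by rewrite !mulr0.
    by rewrite mulr1 -eeD addNr ee0.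
  have T a b : ee (a - b) x * fc G (a - b) = ee (a - b) x * (e%:C%C * (a - b == 0)%:R) +
      \sum_i L%:C%C * (ee (a - b) x * (c2 * (a - b == 0)%:R - c2 * (ee (dl i) x * (a - b == - dl i)%:R))).
    by rewrite fcG mulrDr mulrCA [X in _ + X]mulrCA !mulr_sumr [X in X + _]mulrCA.
  rewrite (eq_bigr _ (fun a _ => eq_bigr _ (fun b _ => T a b))) split_exchange sumD.
  congr (_ + _); rewrite mulr_sumr; apply: eq_bigr => i _.
  rewrite -sumD -mE mulrBr !mulr_sumr -sumrB; apply: eq_bigr => a _.
  rewrite !mulr_sumr -sumrB; apply: eq_bigr => b _; ring.
have mi i : n' <= m M.+1 i := m_ge M i.
have n0 : 0 < n by rewrite /n size_box ltr0n expn_gt0.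
move: key; rewrite E1 E2 ReM /= mulr0 subr0 sum3 => key.
have h1 : Re (F x) * n <= e * n + L * (6 * (n - n')).
  apply: le_trans key _; rewrite lerD2l ler_wpM2l//.
  by have := mi ord0; have := mi 1; have := mi (1 + 1); lra.
rewrite ler_pdivlMr ?ltr0n// -(ler_pM2r n0).
have h2 : (n - n') * M.+1%:R <= 3 * n.
  rewrite /n /n' !size_box !natrX doubleS -addnn -![in leLHS]natr1 -![in leRHS]natr1 !natrD.
  by have : 0 <= M%:R :> R by []; move: (M%:R) => u u0; nra.
have M1 : 0 <= M.+1%:R :> R by rewrite ler0n.
have := ler_wpM2r M1 h1; have := ler_wpM2l (mulr_ge0 (ler0n R 6) L0) h2.
move: (Re (F x)) (M.+1%:R) => r w; nra.
Qed.

(** [fejer_le0] controls a real part only, so it is applied to u F for u among 1, -1, i and -i. *)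
Lemma fejer_eq0 F x L : cbm F -> (forall k, fc F k = 0) ->
  0 <= L -> (forall y, cm (F x - F y) <= L * tdist x y) -> F x = 0.
Proof.
move=> hF F0 L0 hlip.
have H (u : C) : cm u = 1 -> Re (u * F x) <= 0.
  move=> u1; apply: (@fejer_le0 (fun y => u * F y)).
  - by apply: cbmM => //; exact: cbm_cst.
  - by move=> k; rewrite fcZ ?F0 ?mulr0//; exact: cbm_int.
  (* The bound c <= d + c^2 / d makes the Lipschitz bound quadratic in the chords; summed over three
     coordinates, the constant part is 3 (L + 1) d = e. *)
  move=> e e0; pose d := e / (3 * (L + 1)).
  have d0 : 0 < d by rewrite divr_gt0// mulr_gt0// ltr_wpDl.
  exists ((L + 1) / d); first by rewrite divr_ge0 ?addr_ge0// ltW.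
  move=> y _; rewrite -mulrBr cmM u1 mul1r (le_trans (hlip y))//.
  have hc i : chord (co i x - co i y) <= d + chord (co i x - co i y) ^+ 2 / d.
    have := chord_ge0 (co i x - co i y); move: (chord _) => c c0.
    have [cd|dc] := lerP c d; first by rewrite -[leLHS]addr0 lerD// divr_ge0 ?sqr_ge0// ltW.
    rewrite -[leLHS]add0r lerD// ?(ltW d0)// ler_pdivlMr// expr2 ler_wpM2l//; exact: ltW.
  apply: (@le_trans _ _ ((L + 1) * tdist x y)).
    by rewrite ler_wpM2r ?tdist_ge0// lerDl.
  apply: (@le_trans _ _ ((L + 1) * (\sum_i (d + chord (co i x - co i y) ^+ 2 / d)))).
    by rewrite ler_wpM2l ?addr_ge0// ler_sum.
  rewrite big_split /= sumr_const card_ord mulrDr.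
  rewrite le_eqVlt; apply/orP; left; apply/eqP; congr (_ + _); last first.
    by rewrite !mulr_sumr; apply: eq_bigr => i _; rewrite mulrA mulrAC.
  by rewrite /d -mulr_natr; field; rewrite gt_eqF// ltr_wpDl.
have i1 : cm (- 'i%C : C) = 1 by rewrite cmN cm_i.
have a1 : cm (-1 : C) = 1 by rewrite cmN cm1.
have := H 1 cm1; have := H (-1) a1; have := H 'i%C cm_i; have := H (- 'i%C) i1.
rewrite !mulNr !ReN mul1r ReM /= mul0r mul1r sub0r opprK => h1 h2 h3 h4.
by apply: complex_ext => /=; apply/eqP; rewrite eq_le; apply/andP; split; lra.
Qed.

(** The difference of the two sides is Lipschitz for [tdist] and has vanishing Fourier
    coefficients. *)
Lemma fourier_inversion f x : smooth f -> periodic f -> (f x)%:C%C = fser (fcr f) x.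
Proof.
move=> sf pf; have [D D0 hD] := fcr_decay 7 sf pf.
have cs := fser_cbm D0 hD; have cf := cbm_real (smooth_rbm sf pf).
have [L L0 hL] := smooth_lip sf pf.
apply/eqP; rewrite -subr_eq0; apply/eqP.
apply: (@fejer_eq0 (fun y => (f y)%:C%C - fser (fcr f) y) x (L + D * 64)).
- by apply: cbm_ext (cbmD cf (cbmM (cbm_cst (-1)) cs)) => y; rewrite mulN1r.
- move=> k; rewrite (_ : (fun y => _) = fun y => (f y)%:C%C + (-1) * fser (fcr f) y); last first.
    by apply/funext => y; rewrite mulN1r.
  rewrite fcD; [|exact: cbm_int|exact/cintZ/cbm_int].
  by rewrite fcZ ?(fc_fser D0 hD) ?mulN1r ?subrr//; exact: cbm_int.
- by rewrite addr_ge0// mulr_ge0.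
move=> y; rewrite mulrDl.
have -> : (f x)%:C%C - fser (fcr f) x - ((f y)%:C%C - fser (fcr f) y) =
    (f x - f y)%:C%C - (fser (fcr f) x - fser (fcr f) y) by rewrite rmorphB; ring.
rewrite (le_trans (cmB _ _))// lerD//; last exact: fser_lip.
by rewrite cmR.
Qed.

Lemma fourier_rate f : smooth f -> periodic f -> exists2 D, 0 <= D &
  forall x N, cm ((f x)%:C%C - psum (fcr f) N x) <= D / N.+1%:R.
Proof.
move=> sf pf; have [D D0 hD] := fcr_decay 7 sf pf.
exists (D * 128); first by rewrite mulr_ge0.
by move=> x N; rewrite fourier_inversion//; exact: fser_rate.
Qed.

(** Only f is expanded, and its series converges uniformly, so integrability of F suffices. The
    pairing has no conjugation, hence the opposite frequency. *)
Lemma parseval F f : cint F -> smooth f -> periodic f -> exists2 D, 0 <= D & forall N,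
  cm (avg (fun x => F x * (f x)%:C%C) - \sum_(k <- box N) fcr f k * fc F (- k)) <= D / N.+1%:R.
Proof.
move=> hF sf pf; have [D D0 hD] := fourier_rate sf pf.
have [L L0 hL] := avg_bound hF; exists (L * D); first exact: mulr_ge0.
move=> N; rewrite -mulrA.
have cf := cbm_real (smooth_rbm sf pf); have cp := cbm_psum (fcr f) N.
have -> : \sum_(k <- box N) fcr f k * fc F (- k) = avg (fun x => F x * psum (fcr f) N x).
  rewrite (_ : (fun x => _) = fun x => \sum_(k <- box N) fcr f k * (F x * ee k x)); last first.
    by apply/funext => x; rewrite /psum mulr_sumr; apply: eq_bigr => k _; ring.
  rewrite avg_sum => [|k _]; last by apply/cintZ/cintM => //; exact: cbm_ee.
  apply: eq_bigr => k _; rewrite avgZ /fc ?opprK//.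
  by apply: cintM => //; exact: cbm_ee.
have -> : avg (fun x => F x * (f x)%:C%C) - avg (fun x => F x * psum (fcr f) N x) =
    avg (fun x => F x * ((f x)%:C%C - psum (fcr f) N x)).
  rewrite -mulN1r -avgZ; last exact: cintM.
  rewrite -avgD; [|exact: cintM|exact/cintZ/cintM].
  by apply: avg_eq => x _; ring.
apply: hL => [|x _]; last exact: hD.
by apply: cbm_ext (cbmD cf (cbmM (cbm_cst (-1)) cp)) => x; rewrite mulN1r.
Qed.

(** [parseval] is applied to F times the character of -k, on boxes that grow while M is fixed. The
    modes k - l with l in [box M] give the stated sum. On the others Peetre's inequality extracts
    the weight at k, and the seven spare powers of decay of F give the rate in M. *)
Lemma fourier_conv F f s A : cint F -> smooth f -> periodic f -> 0 <= A ->
  (forall k, cm (fc F k) <= A * rho k ^- (s + 7)) ->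
  exists2 D, 0 <= D & forall k M,
  cm (fc (fun x => F x * (f x)%:C%C) k - \sum_(l <- box M) fcr f (k - l) * fc F l)
    <= D / M.+1%:R * rho k ^- s.
Proof.
move=> hF sf pf A0 hA; have [B B0 hB] := fcr_decay s sf pf.
exists (B * A * 64); first by rewrite !mulr_ge0.
move=> k M; rewrite -subr_le0.
have hFk : cint (fun x => F x * ee (- k) x) by apply: cintM => //; exact: cbm_ee.
have [D D0 hD] := parseval hFk sf pf.
pose sk : seq K := [seq k - l | l <- box M]; have [N0 hN0] := in_some_box sk.
apply: (le0_of_rate (c := D) (N0 := N0)) => N NN.
have e1 : fc (fun x => F x * (f x)%:C%C) k = avg (fun x => F x * ee (- k) x * (f x)%:C%C).
  by apply: avg_eq => x _; ring.
have e2 l : fc (fun x => F x * ee (- k) x) (- l) = fc F (k - l).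
  by apply: avg_eq => x _; rewrite opprK opprB -mulrA -eeD addrC.
have := hD N; rewrite -e1; under eq_bigr => l _ do rewrite e2.
have usk : uniq sk by rewrite map_inj_uniq ?box_uniq// => p q /addrI/oppr_inj.
have ssk : {subset sk <= box N} by move=> l /hN0; exact: box_le.
rewrite (sum_sub _ usk (box_uniq N) ssk) big_map.
under [X in _ - (X + _)]eq_bigr => l _ do rewrite subKr.
set S1 := \sum_(l <- box M) _; set S2 := \sum_(l <- _ | _) _; set z := fc _ k.
move=> h; have : cm S2 <= B * A * 64 / M.+1%:R * rho k ^- s.
  apply: le_trans (cm_sum _ _ _) _.
  set t := [seq x <- box N | x \notin sk].
  apply: (@le_trans _ _ (\sum_(l <- t) B * A * rho k ^- s * rho (k - l) ^- 7)).
    apply: ler_sum => l _; rewrite cmM.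
    apply: le_trans (ler_pM (cm_ge0 _) (cm_ge0 _) (hB l) (hA (k - l))) _.
    have -> : B / rho l ^+ s * (A / rho (k - l) ^+ (s + 7)) =
       B * A * (rho (k - l) ^- s * rho l ^- s) * rho (k - l) ^- 7 by rewrite exprD invfM; ring.
    rewrite ler_wpM2r ?invr_ge0 ?exprn_ge0 ?(ltW (rho_gt0 _))//.
    by rewrite ler_wpM2l ?mulr_ge0// rho_peetre.
  have r0 : 0 <= rho k ^- s by rewrite invr_ge0 exprn_ge0 ?(ltW (rho_gt0 _)).
  rewrite -mulr_sumr.
  have -> : B * A * 64 / M.+1%:R * rho k ^- s = B * A * rho k ^- s * (64 / M.+1%:R) by ring.
  rewrite ler_wpM2l ?mulr_ge0//.
  have -> : \sum_(l <- t) rho (k - l) ^- 7 = \sum_(l <- [seq k - l | l <- t]) rho l ^- 7.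
    by rewrite big_map.
  have T := @rho7_tail R [seq k - l | l <- t] M.
  apply: T.
    by rewrite map_inj_uniq ?filter_uniq ?box_uniq// => p q /addrI/oppr_inj.
  move=> q /mapP[l]; rewrite mem_filter => /andP[lt _] ->; apply: contra lt => lt.
  by apply/mapP; exists (k - l) => //; rewrite subKr.
move=> h2; have := cmD (z - (S1 + S2)) S2.
have -> : z - (S1 + S2) + S2 = z - S1 by ring.
by move=> h3; rewrite lerBlDr (le_trans h3)// lerD.
Qed.

End Inversion.

(** * Vector algebra in C^3 *)

Section Vectors.
Context {R : realType}.
Local Notation C := (R[i])%C.
Local Notation V := 'cV[C]_3.
Local Notation K := 'cV[int]_3.
Local Notation cm := (@Normc.normc R).
Implicit Types (a b c : V) (z w : C) (k l : K).

(** Bilinear; Hermitian products are written with [conjv]. Pointwise bounds use the l^1 norm [vn],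
    energies the squared Euclidean norm [v2]. *)
Definition dotc a b : C := \sum_i a i 0 * b i 0.
Definition vn a : R := \sum_i cm (a i 0).
Definition v2 a : R := \sum_i cm (a i 0) ^+ 2.
Definition conjv a : V := \col_i (a i 0)^*%C.

Lemma vec3P a b : a ord0 0 = b ord0 0 -> a 1 0 = b 1 0 -> a (1 + 1) 0 = b (1 + 1) 0 -> a = b.
Proof.
move=> h0 h1 h2; apply/matrixP => i j; rewrite ord1; move: i; exact: ord3_ind.
Qed.

Lemma crossE a b : ((cross a b) ord0 0 = a 1 0 * b (1 + 1) 0 - a (1 + 1) 0 * b 1 0) *
  ((cross a b) 1 0 = a (1 + 1) 0 * b ord0 0 - a ord0 0 * b (1 + 1) 0) *
  ((cross a b) (1 + 1) 0 = a ord0 0 * b 1 0 - a 1 0 * b ord0 0).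
Proof.
by split; [split|]; rewrite /cross !mxE; congr (a _ 0 * b _ 0 - a _ 0 * b _ 0); exact: val_inj.
Qed.

Lemma crossDr a b c : cross a (b + c) = cross a b + cross a c.
Proof. by apply: vec3P; rewrite !(crossE, mxE); ring. Qed.
Lemma crossDl a b c : cross (a + b) c = cross a c + cross b c.
Proof. by apply: vec3P; rewrite !(crossE, mxE); ring. Qed.
Lemma crossZr z a b : cross a (z *: b) = z *: cross a b.
Proof. by apply: vec3P; rewrite !(crossE, mxE); ring. Qed.
Lemma crossZl z a b : cross (z *: a) b = z *: cross a b.
Proof. by apply: vec3P; rewrite !(crossE, mxE); ring. Qed.
Lemma cross0r a : cross a 0 = 0.
Proof. by apply: vec3P; rewrite !(crossE, mxE); ring. Qed.
Lemma cross0l a : cross 0 a = 0.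
Proof. by apply: vec3P; rewrite !(crossE, mxE); ring. Qed.
Lemma crossNr a b : cross a (- b) = - cross a b.
Proof. by rewrite -scaleN1r crossZr scaleN1r. Qed.
Lemma crossNl a b : cross (- a) b = - cross a b.
Proof. by rewrite -scaleN1r crossZl scaleN1r. Qed.
Lemma crossBr a b c : cross a (b - c) = cross a b - cross a c.
Proof. by rewrite crossDr crossNr. Qed.
Lemma crossBl a b c : cross (a - b) c = cross a c - cross b c.
Proof. by rewrite crossDl crossNl. Qed.
Lemma cross_sumr (J : Type) (r : seq J) (P : pred J) a (F : J -> V) :
  cross a (\sum_(i <- r | P i) F i) = \sum_(i <- r | P i) cross a (F i).
Proof. by apply: (big_morph (cross a)); [move=> x y; exact: crossDr|exact: cross0r]. Qed.
Lemma crossC a b : cross a b = - cross b a.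
Proof. by apply: vec3P; rewrite !(crossE, mxE); ring. Qed.

Lemma cross_bac a b c : cross a (cross b c) = dotc a c *: b - dotc a b *: c.
Proof. by apply: vec3P; rewrite /dotc !(crossE, mxE, sum3); ring. Qed.

Lemma dotc_cross a b : dotc a (cross a b) = 0.
Proof. by rewrite /dotc sum3 !crossE; ring. Qed.

Lemma dotcDr a b c : dotc a (b + c) = dotc a b + dotc a c.
Proof. by rewrite /dotc -big_split; apply: eq_bigr => i _; rewrite mxE mulrDr. Qed.
Lemma dotcZr z a b : dotc a (z *: b) = z * dotc a b.
Proof. by rewrite /dotc mulr_sumr; apply: eq_bigr => i _; rewrite mxE mulrCA. Qed.
Lemma dotcC a b : dotc a b = dotc b a.
Proof. by apply: eq_bigr => i _; rewrite mulrC. Qed.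
Lemma dotc0r a : dotc a 0 = 0.
Proof. by rewrite -(scale0r (0 : V)) dotcZr mul0r. Qed.
Lemma dotcNr a b : dotc a (- b) = - dotc a b.
Proof. by rewrite -scaleN1r dotcZr mulN1r. Qed.
Lemma dotcBr a b c : dotc a (b - c) = dotc a b - dotc a c.
Proof. by rewrite dotcDr dotcNr. Qed.
Lemma dotcBl a b c : dotc (a - b) c = dotc a c - dotc b c.
Proof. by rewrite !(dotcC _ c) dotcBr. Qed.
Lemma dotc_sumr (J : Type) (r : seq J) (P : pred J) a (F : J -> V) :
  dotc a (\sum_(i <- r | P i) F i) = \sum_(i <- r | P i) dotc a (F i).
Proof. by apply: (big_morph (dotc a)); [move=> x y; exact: dotcDr|exact: dotc0r]. Qed.

Lemma conj_dotc a b : (dotc a b)^*%C = dotc (conjv a) (conjv b).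
Proof. by rewrite /dotc conj_sum; apply: eq_bigr => i _; rewrite conjM !mxE. Qed.
Lemma conjvK a : conjv (conjv a) = a.
Proof. by apply/matrixP => i j; rewrite ord1 !mxE conjK. Qed.
Lemma dotc_conj a : dotc (conjv a) a = (v2 a)%:C%C.
Proof.
rewrite /dotc /v2 rmorph_sum; apply: eq_bigr => i _.
by rewrite mxE mulrC mul_conj.
Qed.

Lemma vn_ge0 a : 0 <= vn a. Proof. by apply: sumr_ge0 => i _; exact: cm_ge0. Qed.
Lemma v2_ge0 a : 0 <= v2 a. Proof. by apply: sumr_ge0 => i _; exact: sqr_ge0. Qed.
Lemma vnD a b : vn (a + b) <= vn a + vn b.
Proof. by rewrite /vn -big_split ler_sum// => i _; rewrite mxE cmD. Qed.
Lemma vnN a : vn (- a) = vn a.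
Proof. by apply: eq_bigr => i _; rewrite mxE cmN. Qed.
Lemma vnB a b : vn (a - b) <= vn a + vn b.
Proof. by rewrite -(vnN b) vnD. Qed.
Lemma vnZ z a : vn (z *: a) = cm z * vn a.
Proof. by rewrite /vn mulr_sumr; apply: eq_bigr => i _; rewrite mxE cmM. Qed.
Lemma vn0 : vn 0 = 0.
Proof. by apply: big1 => i _; rewrite mxE cm0. Qed.
Lemma vn_sum (J : Type) (r : seq J) (P : pred J) (F : J -> V) :
  vn (\sum_(i <- r | P i) F i) <= \sum_(i <- r | P i) vn (F i).
Proof.
elim/big_ind2: _ => [|x y x' y' h h'|//]; first by rewrite vn0.
by rewrite (le_trans (vnD _ _))// lerD.
Qed.
Lemma vn_coord a i : cm (a i 0) <= vn a.
Proof. by rewrite /vn (bigD1 i)//= lerDl sumr_ge0// => j _; exact: cm_ge0. Qed.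
Lemma vn_eq0 a : vn a = 0 -> a = 0.
Proof.
move=> h; apply/matrixP => i j; rewrite ord1 mxE; apply/eqP; rewrite -cm_eq0 eq_le cm_ge0 andbT.
by rewrite -h vn_coord.
Qed.
Lemma vn_le0 a : vn a <= 0 -> a = 0.
Proof. by move=> h; apply: vn_eq0; apply/eqP; rewrite eq_le h vn_ge0. Qed.

Lemma vn_cross a b : vn (cross a b) <= vn a * vn b.
Proof.
rewrite /vn !sum3 !crossE.
have h x y z w : cm (x * y - z * w) <= cm x * cm y + cm z * cm w.
  by apply: le_trans (cmB _ _) _; rewrite !cmM.
apply: le_trans (lerD (lerD (h _ _ _ _) (h _ _ _ _)) (h _ _ _ _)) _.
have := (cm_ge0 (a ord0 0), cm_ge0 (a 1 0), cm_ge0 (a (1 + 1) 0)).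
have := (cm_ge0 (b ord0 0), cm_ge0 (b 1 0), cm_ge0 (b (1 + 1) 0)).
move: (cm _) (cm _) (cm _) (cm _) (cm _) (cm _) => b2 a0 b0 a2 b1 a1 [[p q] r] [[s t] v].
have := mulr_ge0 s p; have := mulr_ge0 t q; have := mulr_ge0 v r.
by lra.
Qed.

Lemma vn_dotc a b : cm (dotc a b) <= vn a * vn b.
Proof.
apply: le_trans (cm_sum _ _ _) _; rewrite /vn mulr_suml; apply: ler_sum => i _.
by rewrite cmM ler_wpM2l ?cm_ge0// -/(vn b) vn_coord.
Qed.

Lemma vn_conj a : vn (conjv a) = vn a.
Proof. by apply: eq_bigr => i _; rewrite mxE cm_conj. Qed.

Lemma vn_sqr a : vn a ^+ 2 <= 3 * v2 a.
Proof.
rewrite /vn /v2 !sum3; move: (cm _) (cm _) (cm _) => p q r.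
have := sqr_ge0 (p - q); have := sqr_ge0 (p - r); have := sqr_ge0 (q - r); nra.
Qed.

End Vectors.

(** * Energy estimate and a priori bounds for truncated systems *)

Section Stability.
Context {R : realType}.
Local Notation C := (R[i])%C.
Local Notation V := 'cV[C]_3.
Local Notation K := 'cV[int]_3.
Local Notation cm := (@Normc.normc R).
Local Notation Re := (@complex.Re R).
Local Notation kc := (@kc R).
Local Notation rho := (@rho R).
Implicit Types (k l : K) (j : 'cV[R]_3).

(* The symbols of [- i (nabla + i j)] and [- (nabla + i j)^2] at the mode k. *)
Definition kap j k : V := \col_i (kc k i + j i 0)%:C%C.
Definition kap2 j k : R := \sum_i (kc k i + j i 0) ^+ 2.

Lemma kap_sub j k l : kap j k - kap j l = kap 0 (k - l).
Proof.
by apply/matrixP => i o; rewrite ord1 !mxE -rmorphB kcB; congr (_%:C%C); ring.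
Qed.

Lemma kap_conj j k : conjv (kap j k) = kap j k.
Proof. by apply/matrixP => i o; rewrite ord1 !mxE conj_real. Qed.

(* [fc_form] is the pointwise bound |grad U| <= kU on the Fourier side. *)
Record field_coefs (u : K -> V) (kU : R) : Prop := FieldCoefs {
  fc_kU : 0 <= kU < 1;
  fc_conj : forall k, u (- k) = conjv (u k);
  fc_div : forall k, dotc (kap 0 k) (u k) = 0;
  fc_zero : u 0 = 0;
  fc_decay : forall s : nat, exists2 D, 0 <= D & forall k, vn (u k) <= D * rho k ^- s;
  fc_form : forall (A : seq K) (T : K -> V), uniq A ->
    Re (\sum_(k <- A) \sum_(l <- A) dotc (conjv (T k)) (('i%C * dotc (kap 0 (k - l)) (T l)) *: u (k - l)))
      <= kU * \sum_(k <- A) v2 (T k) }.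

Definition conv (u : K -> V) (A : seq K) (a : K -> V) k : V := \sum_(l <- A) cross (u (k - l)) (a l).

Section Energy.
Variables (u : K -> V) (kU : R).
Hypothesis hu : field_coefs u kU.

(* In [kap x (u x a) = (kap . a) u - (kap . u) a] the second term contributes a
   skew-adjoint operator because u is divergence-free. *)
Lemma energy j (A : seq K) (T : K -> V) : uniq A ->
  (forall k, k \in A -> dotc (kap j k) (T k) = 0) ->
  Re (\sum_(k <- A) dotc (conjv (T k)) ('i%C *: cross (kap j k) (conv u A T k)))
    <= kU * \sum_(k <- A) v2 (T k).
Proof.
move=> uA hT.
pose X := \sum_(k <- A) \sum_(l <- A) dotc (conjv (T k)) (('i%C * dotc (kap 0 (k - l)) (T l)) *: u (k - l)).
pose Y := \sum_(k <- A) \sum_(l <- A) ('i%C * dotc (kap j l) (u (k - l))) * dotc (conjv (T k)) (T l).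
have shift k l : dotc (kap j k) (u (k - l)) = dotc (kap j l) (u (k - l)).
  by apply/eqP; rewrite -subr_eq0 -dotcBl kap_sub (fc_div hu).
have E : \sum_(k <- A) dotc (conjv (T k)) ('i%C *: cross (kap j k) (conv u A T k)) = X - Y.
  rewrite /X /Y -sumrB; apply: eq_big_seq => k kA.
  rewrite /conv cross_sumr scaler_sumr dotc_sumr -sumrB; apply: eq_big_seq => l lA.
  rewrite cross_bac shift.
  (* As [T] is divergence-free, [kap j k] may be replaced by its difference with [kap j l], the
     frequency of u: the derivative falls on U, and X becomes the form bounded by [fc_form]. *)
  have -> : dotc (kap j k) (T l) = dotc (kap 0 (k - l)) (T l).
    by rewrite -(kap_sub j) dotcBl (hT l lA) subr0.
  by rewrite scalerBr dotcBr !scalerA !dotcZr.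
have Yskew : Re Y = 0.
  suff : Y^*%C = - Y.
    move=> /(congr1 Re); rewrite Re_conj ReN => /eqP; rewrite -subr_eq0 opprK -mulr2n mulrn_eq0.
    by move=> /= /eqP.
  rewrite /Y conj_sum; under eq_bigr => k _ do rewrite conj_sum.
  rewrite exchange_big -sumrN; apply: eq_bigr => k _ /=.
  rewrite -sumrN; apply: eq_bigr => l _.
  rewrite !conjM !conj_dotc conjvK conj_i kap_conj -(fc_conj hu) opprB -(shift k l).
  by rewrite [dotc (T _) _]dotcC; ring.
rewrite E ReD ReN Yskew oppr0 addr0; exact: (fc_form hu).
Qed.

(** What the estimates use of a small wave vector: ellipticity, an upper bound on the symbol, and
    coercivity, that is, kU stays below the nonzero symbols by a relative margin c0. *)
Record small_wave (c0 : R) j : Prop := SmallWave {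
  sw_lower : forall k, k != 0 -> rho k ^+ 2 / 48 <= kap2 j k;
  sw_upper : forall k, vn (kap j k) <= rho k;
  sw_coer : forall k, k != 0 -> kU <= (1 - c0) * kap2 j k }.

Definition nz (N : nat) : seq K := [seq k <- box N | k != 0].

Lemma nz_uniq N : uniq (nz N). Proof. exact/filter_uniq/box_uniq. Qed.

Lemma mem_nz N k : (k \in nz N) = (k != 0) && (k \in box N).
Proof. by rewrite mem_filter. Qed.

Lemma vn_kap2 j k : vn (kap j k) ^+ 2 <= 3 * kap2 j k.
Proof.
apply: le_trans (vn_sqr _) _; rewrite ler_wpM2l// /v2 /kap2; apply: ler_sum => i _.
by rewrite mxE cmR real_normK ?num_real.
Qed.

Lemma rho_nz k : k != 0 -> 2 <= rho k.
Proof.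
move=> k0; rewrite leNgt; apply/negP => h.
have [i ki] : exists i, kc k i != 0.
  by apply: contrapT => /forallNP hh; move/eqP: k0; apply; apply: (@kc_eq0 R) => i; apply/eqP/negP => /negP; exact: hh.
have := rho_ge (R := R) k i.
have : 1 <= `|kc k i|.
  rewrite /kc -intr_norm -[1]/(1%:~R) ler_int; move: ki; rewrite /kc intr_eq0; lia.
lra.
Qed.

Lemma kap2_ge c0 j k : small_wave c0 j -> k != 0 -> 12^-1 <= kap2 j k.
Proof.
move=> sw k0; apply: le_trans (sw_lower sw k0).
have := rho_nz k0; move: (rho k) => r hr; nra.
Qed.

(** A p in the right half-plane can only enlarge the symbol; this makes the bounds uniform in p. *)
Lemma cm_symbol (q : R) (p : C) : 0 < q -> 0 <= Re p -> q%:C%C + p != 0 /\ cm (q%:C%C + p)^-1 <= q^-1.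
Proof.
move=> q0 p0; have h : q <= cm (q%:C%C + p).
  apply: le_trans (Re_le_cm _); rewrite ReD /=; apply: le_trans (ler_norm _); lra.
split; first by rewrite -cm_gt0 (lt_le_trans q0).
by rewrite cmV lef_pV2 ?posrE// (lt_le_trans q0).
Qed.

Lemma conv_bound s : exists2 D, 0 <= D & forall (A : seq K) (a : K -> V) B, uniq A -> 0 <= B ->
  (forall l, l \in A -> vn (a l) <= B * rho l ^- s) -> forall k, vn (conv u A a k) <= D * B * rho k ^- s.
Proof.
have [D D0 hD] := fc_decay hu (s + 6); exists (D * 64); first by rewrite mulr_ge0.
move=> A a B uA B0 ha k; apply: le_trans (vn_sum _ _ _) _.
apply: (@le_trans _ _ (\sum_(l <- A) D * B * (rho (k - l) ^- (s + 6) * rho l ^- s))).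
  rewrite big_seq [leRHS]big_seq; apply: ler_sum => l lA; apply: le_trans (vn_cross _ _) _.
  by rewrite mulrACA; apply: ler_pM; rewrite ?vn_ge0 ?ha.
rewrite -mulr_sumr.
have -> : D * 64 * B / rho k ^+ s = D * B * (64 * rho k ^- s) by ring.
by rewrite ler_wpM2l ?mulr_ge0// rho_conv.
Qed.

Lemma convD A a b k : conv u A (fun l => a l + b l) k = conv u A a k + conv u A b k.
Proof. by rewrite /conv -big_split; apply: eq_bigr => l _; rewrite crossDr. Qed.

Lemma convZ A z a k : conv u A (fun l => z *: a l) k = z *: conv u A a k.
Proof. by rewrite /conv scaler_sumr; apply: eq_bigr => l _; rewrite crossZr. Qed.

Lemma conv_eq A a b k : {in A, a =1 b} -> conv u A a k = conv u A b k.
Proof. by move=> ab; apply: eq_big_seq => l lA; rewrite ab. Qed.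

(** The mode equations truncated to the nonzero frequencies of a box. The convolution leaves out the
    mean, which acts through the source g. *)
Definition gal_eq j (p : C) N (g a : K -> V) := forall k, k \in nz N ->
  ((kap2 j k)%:C%C + p) *: a k = 'i%C *: cross (kap j k) (conv u (nz N) a k) + g k.

Section Bounds.
Variable c0 : R.
Hypothesis c0_gt0 : 0 < c0.

Let kap2_gt0 j k : small_wave c0 j -> k != 0 -> 0 < kap2 j k.
Proof. by move=> sw k0; apply: lt_le_trans (kap2_ge sw k0). Qed.

(** Young's inequality, weighted so that half of the margin c0 absorbs the first term. In its use
    the 9 is 3 * 3, from comparing l^1 with l^2 norms for both T and kap. *)
Let young (x y q v : R) : 0 <= v -> x ^+ 2 <= 9 * (q * v) ->
  x * y <= c0 / 2 * (q * v) + 9 / (2 * c0) * y ^+ 2.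
Proof.
move=> v0 hx.
have h : 0 <= (c0 * x - 9 * y) ^+ 2 by exact: sqr_ge0.
have -> : 9 / (2 * c0) * y ^+ 2 = (9 ^+ 2 * y ^+ 2) / (18 * c0) by field; rewrite gt_eqF.
rewrite -subr_ge0.
have -> : c0 / 2 * (q * v) + 9 ^+ 2 * y ^+ 2 / (18 * c0) - x * y =
  ((c0 * x - 9 * y) ^+ 2 + c0 ^+ 2 * (9 * (q * v) - x ^+ 2)) / (18 * c0) by field; rewrite gt_eqF.
apply: divr_ge0; last by rewrite mulr_ge0// ltW.
by apply: addr_ge0; [exact: sqr_ge0|apply: mulr_ge0; [exact: sqr_ge0|rewrite subr_ge0]].
Qed.

(** The equation is tested with T: [energy] bounds the convolution by kU, coercivity leaves c0 times
    the symbol, and [young] spends half of it on the source. A single mode is then read off from the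
    sum, so the result is a bound without decay. *)
Let solenoidal_bound j p N (T w : K -> V) W s : (3 <= s)%N -> small_wave c0 j -> 0 <= Re p -> 0 <= W ->
  (forall k, k \in nz N -> dotc (kap j k) (T k) = 0) ->
  gal_eq j p N (fun k => 'i%C *: cross (kap j k) (w k)) T ->
  (forall k, k \in nz N -> vn (w k) <= W * rho k ^- s) ->
  forall k, k \in nz N -> vn (T k) <= 144 / c0 * W.
Proof.
move=> s3 sw p0 W0 hT hG hw k kN.
pose q := kap2 j.
have E : \sum_(k <- nz N) (q k + Re p) * v2 (T k) <=
    kU * (\sum_(k <- nz N) v2 (T k)) +
    \sum_(k <- nz N) (c0 / 2 * (q k * v2 (T k)) + 9 / (2 * c0) * vn (w k) ^+ 2).
  have -> : \sum_(k <- nz N) (q k + Re p) * v2 (T k) =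
     Re (\sum_(k <- nz N) dotc (conjv (T k)) (((q k)%:C%C + p) *: T k)).
    rewrite Re_sum; apply: eq_bigr => l _.
    by rewrite dotcZr dotc_conj ReM ReD /= mulr0 subr0.
  have -> : \sum_(k <- nz N) dotc (conjv (T k)) (((q k)%:C%C + p) *: T k) =
     \sum_(k <- nz N) dotc (conjv (T k)) ('i%C *: cross (kap j k) (conv u (nz N) T k)) +
     \sum_(k <- nz N) dotc (conjv (T k)) ('i%C *: cross (kap j k) (w k)).
    by rewrite -big_split; apply: eq_big_seq => l lN; rewrite hG// dotcDr.
  rewrite ReD lerD//; first exact: (energy (nz_uniq N) hT).
  rewrite Re_sum big_seq [leRHS]big_seq; apply: ler_sum => l lN.
  apply: le_trans (le_trans (ler_norm _) (Re_le_cm _)) _.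
  apply: (@le_trans _ _ (vn (T l) * vn (kap j l) * vn (w l))).
    apply: le_trans (vn_dotc _ _) _; rewrite vn_conj vnZ cm_i mul1r -mulrA.
    by rewrite ler_wpM2l ?vn_ge0// vn_cross.
  apply: young; first exact: v2_ge0.
  rewrite exprMn; have := vn_sqr (T l); have := vn_kap2 j l.
  have := sqr_ge0 (vn (T l)); have := sqr_ge0 (vn (kap j l)); have := v2_ge0 (T l).
  rewrite -/(q l); move: (vn (T l) ^+ 2) (vn (kap j l) ^+ 2) (v2 (T l)) (q l) => x y v r v0 y0 x0 yr xv.
  have := ler_pM x0 y0 xv yr; lra.
have F : \sum_(k <- nz N) c0 / 2 * (q k * v2 (T k)) <= \sum_(k <- nz N) 9 / (2 * c0) * vn (w k) ^+ 2.
  move: E; rewrite big_split /= mulr_sumr addrA -big_split /= -lerBlDl -sumrB.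
  apply: le_trans; rewrite big_seq [leRHS]big_seq; apply: ler_sum => l.
  rewrite mem_nz => /andP[l0 _]; have := sw_coer sw l0; rewrite -/(q l).
  have := v2_ge0 (T l); move: (v2 _) (q l) => v r v0 h.
  have := ler_wpM2r v0 h; have := mulr_ge0 p0 v0; nra.
(* With s >= 3 the squares decay like rho^-6, whose sum is at most 64; 288 = 9 / 2 * 64. *)
have G : \sum_(k <- nz N) 9 / (2 * c0) * vn (w k) ^+ 2 <= 288 / c0 * W ^+ 2.
  apply: (@le_trans _ _ (\sum_(k <- nz N) 9 / (2 * c0) * W ^+ 2 * rho k ^- 6)).
    rewrite big_seq [leRHS]big_seq; apply: ler_sum => l lN.
    have K0 : 0 <= 9 / (2 * c0) by rewrite divr_ge0// mulr_ge0// ltW.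
    rewrite -[leRHS]mulrA ler_wpM2l//.
    apply: (@le_trans _ _ ((W * rho l ^- s) ^+ 2)).
      by rewrite lerXn2r ?nnegrE ?vn_ge0 ?mulr_ge0 ?invr_ge0 ?exprn_ge0 ?(ltW (rho_gt0 _))// hw.
    rewrite exprMn ler_wpM2l ?sqr_ge0// exprVn -exprM.
    by apply: rho_le; lia.
  rewrite -mulr_sumr.
  have -> : 288 / c0 * W ^+ 2 = 9 / (2 * c0) * W ^+ 2 * 64 by field; rewrite gt_eqF.
  apply: ler_wpM2l; last by rewrite rho6_sum ?nz_uniq.
  by apply: mulr_ge0; [rewrite divr_ge0// mulr_ge0// ltW|exact: sqr_ge0].
have H : c0 / 24 * v2 (T k) <= 288 / c0 * W ^+ 2.
  apply: le_trans (le_trans F G).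
  rewrite (bigD1_seq k) ?nz_uniq//= -[leLHS]addr0 lerD//.
    have k0 : k != 0 by move: kN; rewrite mem_nz => /andP[].
    have := kap2_ge sw k0; rewrite -/(q k).
    have := v2_ge0 (T k); move: (v2 _) (q k) => v r v0 h; have := mulr_ge0 (ltW c0_gt0) v0; nra.
  rewrite big_seq_cond; apply: sumr_ge0 => l /andP[lN _].
  move: lN; rewrite mem_nz => /andP[l0 _].
  by rewrite !mulr_ge0 ?v2_ge0 ?invr_ge0 ?(ltW c0_gt0)// ltW// kap2_gt0.
rewrite -(@ler_pXn2r _ 2)// ?nnegrE ?vn_ge0 ?mulr_ge0 ?invr_ge0 ?(ltW c0_gt0)//.
apply: le_trans (vn_sqr _) _.
have -> : (144 / c0 * W) ^+ 2 = 3 * (24 / c0 * (288 / c0 * W ^+ 2)) by field; rewrite gt_eqF.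
rewrite ler_wpM2l//.
have -> : v2 (T k) = 24 / c0 * (c0 / 24 * v2 (T k)) by field; rewrite gt_eqF.
by rewrite ler_wpM2l ?divr_ge0 ?(ltW c0_gt0).
Qed.

(* The part of a along kap is determined by g; the energy estimate bounds the rest,
   and each use of the equation then gains one power of rho. *)
Lemma gal_stability s : (3 <= s)%N -> exists2 D, 0 <= D & forall j p N g a M,
  small_wave c0 j -> 0 <= Re p -> 0 <= M -> gal_eq j p N g a ->
  (forall k, k \in nz N -> vn (g k) <= M * rho k ^- s) ->
  forall k, k \in nz N -> vn (a k) <= D * M * rho k ^- s.
Proof.
move=> s3.
suff H t : (t <= s)%N -> exists2 D, 0 <= D & forall j p N g a M,
    small_wave c0 j -> 0 <= Re p -> 0 <= M -> gal_eq j p N g a ->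
    (forall k, k \in nz N -> vn (g k) <= M * rho k ^- s) ->
    forall k, k \in nz N -> vn (a k) <= D * M * rho k ^- t by exact: H.
have r0 t' k : 0 <= rho k ^- t' by rewrite invr_ge0 exprn_ge0// ltW// rho_gt0.
elim: t => [_|t IH ts].
  have [D1 D10 hD1] := conv_bound s.
  exists (144 / c0 * (D1 * 12) + 12); first by rewrite addr_ge0 ?mulr_ge0 ?invr_ge0 ?(ltW c0_gt0).
  move=> j p N g a M sw p0 M0 ha hg k kN.
  (* Subtracting all of g divided by the symbol makes [T] divergence-free and leaves a source in
     curl form, as [solenoidal_bound] requires. *)
  pose c l := ((kap2 j l)%:C%C + p)^-1 *: g l; pose T l := a l - c l.
  have sym l : l \in nz N -> (kap2 j l)%:C%C + p != 0 /\ cm ((kap2 j l)%:C%C + p)^-1 <= 12.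
    rewrite mem_nz => /andP[l0 _]; have [h1 h2] := cm_symbol (kap2_gt0 sw l0) p0.
    split=> //; apply: le_trans h2 _; rewrite -[12]invrK lef_pV2 ?posrE ?invr_gt0 ?kap2_gt0//.
    exact: kap2_ge sw l0.
  have hc l : l \in nz N -> vn (c l) <= 12 * M * rho l ^- s.
    move=> lN; have [_ h] := sym l lN; rewrite vnZ -mulrA.
    by apply: ler_pM; rewrite ?cm_ge0 ?vn_ge0// hg.
  have hT l : l \in nz N -> dotc (kap j l) (T l) = 0.
    move=> lN; have [h _] := sym l lN; rewrite /T dotcBr /c dotcZr.
    apply: (mulfI h); rewrite mulr0 mulrBr mulVKf// -dotcZr ha// dotcDr dotcZr dotc_cross mulr0 add0r.
    by rewrite subrr.
  have hGT : gal_eq j p N (fun l => 'i%C *: cross (kap j l) (conv u (nz N) c l)) T.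
    move=> l lN; have [h _] := sym l lN.
    rewrite -scalerDr -crossDr -convD (conv_eq (b := a)); last by move=> i _; rewrite /T subrK.
    by rewrite /T scalerBr ha// /c scalerA mulfV// scale1r addrK.
  have hw l : l \in nz N -> vn (conv u (nz N) c l) <= D1 * (12 * M) * rho l ^- s.
    by move=> lN; apply: hD1; rewrite ?nz_uniq ?mulr_ge0.
  have W0 : 0 <= D1 * (12 * M) by rewrite !mulr_ge0.
  have hTk := solenoidal_bound s3 sw p0 W0 hT hGT hw kN.
  rewrite expr0 invr1 mulr1 -[a k](subrK (c k)) (le_trans (vnD _ _))// mulrDl.
  apply: lerD; first by rewrite -/(T k) (le_trans hTk)// !mulrA.
  by rewrite (le_trans (hc k kN))// ler_piMr ?mulr_ge0// invf_le1 ?exprn_ege1 ?exprn_gt0 ?rho_gt0 ?rho_ge1.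
have [E E0 hE] := IH (ltnW ts); have [D1 D10 hD1] := conv_bound t.
exists (48 * (D1 * E + 1)); first by rewrite mulr_ge0 ?addr_ge0 ?mulr_ge0.
move=> j p N g a M sw p0 M0 ha hg k kN.
have hak := hE j p N g a M sw p0 M0 ha hg.
have k0 : k != 0 by move: kN; rewrite mem_nz => /andP[].
have [h1 h2] := cm_symbol (kap2_gt0 sw k0) p0.
have -> : a k = ((kap2 j k)%:C%C + p)^-1 *: ('i%C *: cross (kap j k) (conv u (nz N) a k) + g k).
  by rewrite -ha// scalerA mulVf// scale1r.
have hq : cm ((kap2 j k)%:C%C + p)^-1 <= 48 * rho k ^- 2.
  apply: le_trans h2 _; have -> : 48 * rho k ^- 2 = (rho k ^+ 2 / 48)^-1 by field; rewrite rho_neq0.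
  by rewrite lef_pV2 ?posrE ?(sw_lower sw)// ?(kap2_gt0 sw)// divr_gt0 ?exprn_gt0 ?rho_gt0.
have hconv : vn (conv u (nz N) a k) <= D1 * (E * M) * rho k ^- t.
  by apply: hD1; rewrite ?nz_uniq ?mulr_ge0.
rewrite vnZ; apply: (@le_trans _ _ (48 * rho k ^- 2 * (rho k * (D1 * (E * M) * rho k ^- t) + M * rho k ^- s))).
  apply: ler_pM; rewrite ?cm_ge0 ?vn_ge0//.
  apply: le_trans (vnD _ _) _; rewrite vnZ cm_i mul1r lerD ?hg//.
  by apply: le_trans (vn_cross _ _) _; apply: ler_pM; rewrite ?vn_ge0//; exact: sw_upper sw k.
have rk := rho_gt0 (R := R) k.
have -> : 48 * rho k ^- 2 * (rho k * (D1 * (E * M) / rho k ^+ t) + M / rho k ^+ s) =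
   48 * (D1 * E) * M * rho k ^- t.+1 + 48 * M * (rho k ^- 2 * rho k ^- s).
  by rewrite [rho k ^+ t.+1]exprS; field; rewrite !expf_neq0 ?rho_neq0.
have -> : 48 * (D1 * E + 1) * M / rho k ^+ t.+1 = 48 * (D1 * E) * M * rho k ^- t.+1 + 48 * M * rho k ^- t.+1 by ring.
apply: lerD => //; apply: ler_wpM2l; first by rewrite mulr_ge0.
apply: (@le_trans _ _ (1 * rho k ^- s)); last by rewrite mul1r rho_le.
by rewrite ler_wpM2r// invf_le1 ?exprn_ege1 ?exprn_gt0 ?rho_ge1 ?rho_gt0.
Qed.

End Bounds.
End Energy.
End Stability.

(** * Limits of complex vectors with a rate *)

Section Limits.
Context {R : realType}.
Local Notation C := (R[i])%C.
Local Notation V := 'cV[C]_3.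
Local Notation cm := (@Normc.normc R).
Local Notation Re := (@complex.Re R).
Local Notation Im := (@complex.Im R).

Definition clim (x : nat -> C) : C := Complex (limn (fun N => Re (x N))) (limn (fun N => Im (x N))).
Definition vlim (x : nat -> V) : V := \col_i clim (fun N => x N i 0).

Lemma clim_rate x (e : R) : (forall N M, (N <= M)%N -> cm (x M - x N) <= e / N.+1%:R) ->
  forall N, cm (clim x - x N) <= 2 * e / N.+1%:R.
Proof.
move=> hx N.
have hr n m : (n <= m)%N -> `|Re (x m) - Re (x n)| <= e / n.+1%:R.
  by move=> nm; rewrite -ReN -ReD (le_trans (Re_le_cm _))// hx.
have hi n m : (n <= m)%N -> `|Im (x m) - Im (x n)| <= e / n.+1%:R.
  by move=> nm; rewrite -ImN -ImD (le_trans (Im_le_cm _))// hx.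
have [_ /(_ N) h1] := cvg_of_rate hr; have [_ /(_ N) h2] := cvg_of_rate hi.
apply: le_trans (cm_le _) _; rewrite ReD ReN ImD ImN.
have -> : 2 * e / N.+1%:R = e / N.+1%:R + e / N.+1%:R by ring.
exact: lerD.
Qed.

Lemma vlim_rate x (e : R) : (forall N M, (N <= M)%N -> vn (x M - x N) <= e / N.+1%:R) ->
  forall N, vn (vlim x - x N) <= 6 * e / N.+1%:R.
Proof.
move=> hx N; rewrite /vn.
have h i : cm (clim (fun N => x N i 0) - x N i 0) <= 2 * e / N.+1%:R.
  apply: clim_rate => n m nm; apply: le_trans (hx _ _ nm).
  by apply: le_trans (vn_coord _ i); rewrite !mxE.
rewrite sum3 !mxE; have := h ord0; have := h 1; have := h (1 + 1).
have -> : 6 * e / N.+1%:R = 2 * e / N.+1%:R + 2 * e / N.+1%:R + 2 * e / N.+1%:R by ring.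
by move=> h1 h2 h3; rewrite !lerD.
Qed.

End Limits.

(** * Solutions on all modes: stability and existence *)

Section Solutions.
Context {R : realType}.
Local Notation C := (R[i])%C.
Local Notation V := 'cV[C]_3.
Local Notation K := 'cV[int]_3.
Local Notation cm := (@Normc.normc R).
Local Notation Re := (@complex.Re R).
Local Notation rho := (@rho R).
Implicit Types (k l : K) (j : 'cV[R]_3) (a b g : K -> V).
Variables (u : K -> V) (kU : R).
Hypothesis hu : field_coefs u kU.

Let r0 t k : 0 <= rho k ^- t.
Proof. by rewrite invr_ge0 exprn_ge0// ltW// rho_gt0. Qed.

Definition decays a := forall s : nat, exists2 B, 0 <= B & forall k, vn (a k) <= B * rho k ^- s.

(* The Fourier coefficients of U x H when a are those of H. *)
Definition convs a k : V := vlim (fun N => conv u (box N) a k).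

(** On the discarded modes rho is at least N + 1, so one power of the decay of a turns into the
    rate. *)
Lemma conv_tail s : exists2 D, 0 <= D & forall a B, 0 <= B ->
  (forall l, vn (a l) <= B * rho l ^- s.+1) -> forall N M k, (N <= M)%N ->
  vn (conv u (box M) a k - conv u (box N) a k) <= D * B / N.+1%:R * rho k ^- s.
Proof.
have [D D0 hD] := conv_bound hu s; exists D => // a B B0 ha N M k NM.
rewrite /conv (sum_sub _ (box_uniq N) (box_uniq M) (box_le NM)) addrC addKr.
rewrite -[D * B / _]mulrA; apply: hD => [|//|l]; first exact/filter_uniq/box_uniq.
  by rewrite divr_ge0.
rewrite mem_filter => /andP[lN _]; apply: le_trans (ha l) _.
rewrite -mulrA ler_wpM2l// exprSr invfM mulrC ler_wpM2r//.
by rewrite lef_pV2 ?posrE ?ltr0n ?rho_gt0// rho_out.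
Qed.

Lemma convs_rate s : exists2 D, 0 <= D & forall a B, 0 <= B ->
  (forall l, vn (a l) <= B * rho l ^- s.+1) -> forall N k,
  vn (convs a k - conv u (box N) a k) <= D * B / N.+1%:R * rho k ^- s.
Proof.
have [D D0 hD] := conv_tail s; exists (6 * D); first by rewrite mulr_ge0.
move=> a B B0 ha N k.
have -> : 6 * D * B / N.+1%:R * rho k ^- s = 6 * (D * B * rho k ^- s) / N.+1%:R by ring.
apply: (vlim_rate (e := D * B * rho k ^- s)) => n m nm.
by rewrite mulrAC; exact: hD.
Qed.

Lemma convs_bound s : exists2 D, 0 <= D & forall a B, 0 <= B ->
  (forall l, vn (a l) <= B * rho l ^- s.+1) -> forall k, vn (convs a k) <= D * B * rho k ^- s.
Proof.
have [D D0 hD] := convs_rate s; have [E E0 hE] := conv_bound hu s.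
exists (D + E); first exact: addr_ge0.
move=> a B B0 ha k; rewrite -[convs a k](subrK (conv u (box 0) a k)).
apply: le_trans (vnD _ _) _; rewrite 2!mulrDl; apply: lerD.
  by have := hD a B B0 ha 0%N k; rewrite divr1.
apply: hE => //; first exact: box_uniq.
by move=> l _; apply: le_trans (ha l) _; rewrite ler_wpM2l// rho_le.
Qed.

Lemma convs_unique a L (c : R) k : decays a ->
  (forall N, vn (L - conv u (box N) a k) <= c / N.+1%:R) -> convs a k = L.
Proof.
move=> da hL; have [B B0 hB] := da 1%N; have [D D0 hD] := convs_rate 0.
apply/eqP; rewrite -subr_eq0; apply/eqP/vn_le0.
apply: (le0_of_rate (c := D * B + c) (N0 := 0)) => N _.
have -> : convs a k - L = (convs a k - conv u (box N) a k) - (L - conv u (box N) a k).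
  by rewrite opprB addrA subrK.
apply: le_trans (vnB _ _) _; rewrite mulrDl lerD//.
by have := hD a B B0 hB N k; rewrite expr0 invr1 mulr1.
Qed.

Lemma decaysZ z a : decays a -> decays (fun k => z *: a k).
Proof.
move=> da s; have [B B0 hB] := da s; exists (cm z * B); first by rewrite mulr_ge0 ?cm_ge0.
by move=> k; rewrite vnZ -mulrA ler_wpM2l ?cm_ge0.
Qed.

Lemma decaysD a b : decays a -> decays b -> decays (fun k => a k + b k).
Proof.
move=> da db s; have [B B0 hB] := da s; have [D D0 hD] := db s.
exists (B + D); first exact: addr_ge0.
by move=> k; rewrite (le_trans (vnD _ _))// mulrDl lerD.
Qed.

Lemma convsD a b k : decays a -> decays b -> convs (fun l => a l + b l) k = convs a k + convs b k.
Proof.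
move=> da db; have [B B0 hB] := da 1%N; have [E E0 hE] := db 1%N; have [D D0 hD] := convs_rate 0.
apply: (convs_unique (c := D * B + D * E)); first exact: decaysD.
move=> N; rewrite (convD u).
have -> : convs a k + convs b k - (conv u (box N) a k + conv u (box N) b k) =
  (convs a k - conv u (box N) a k) + (convs b k - conv u (box N) b k) by rewrite addrACA opprD.
apply: le_trans (vnD _ _) _; rewrite mulrDl.
have := hD a B B0 hB N k; have := hD b E E0 hE N k; rewrite expr0 invr1 !mulr1 => h1 h2.
exact: lerD.
Qed.

Lemma convsZ z a k : decays a -> convs (fun l => z *: a l) k = z *: convs a k.
Proof.
move=> da; have [B B0 hB] := da 1%N; have [D D0 hD] := convs_rate 0.
apply: (convs_unique (c := cm z * (D * B))); first exact: decaysZ.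
move=> N; rewrite (convZ u) -scalerBr vnZ -mulrA ler_wpM2l ?cm_ge0//.
by have := hD a B B0 hB N k; rewrite expr0 invr1 !mulr1.
Qed.

(** The system on all nonzero modes. There is no equation at 0: the mean [a 0] is a free datum and
    acts through [convs]. *)
Definition sol j (p : C) g a := decays a /\ forall k, k != 0 ->
  ((kap2 j k)%:C%C + p) *: a k = 'i%C *: cross (kap j k) (convs a k) + g k.

Lemma solD j p g h a b : sol j p g a -> sol j p h b ->
  sol j p (fun k => g k + h k) (fun k => a k + b k).
Proof.
move=> [da ea] [db eb]; split=> [|k k0]; first exact: decaysD.
by rewrite scalerDr ea// eb// convsD// crossDr scalerDr addrACA.
Qed.

Lemma solZ j p g a z : sol j p g a -> sol j p (fun k => z *: g k) (fun k => z *: a k).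
Proof.
move=> [da ea]; split=> [|k k0]; first exact: decaysZ.
by rewrite scalerA mulrC -scalerA ea// convsZ// crossZr scalerDr !scalerA mulrC.
Qed.

Lemma conv_box N a k : conv u (box N) a k = conv u (nz N) a k + cross (u k) (a 0).
Proof.
rewrite /conv /nz big_filter (bigD1_seq 0) ?box_uniq ?box0//= subr0 addrC.
by congr (_ + _).
Qed.

Section Stability.
Variable c0 : R.
Hypothesis c0_gt0 : 0 < c0.

(* Restricted to the modes of a box, a solution is a Galerkin solution up to an
   O(1/N) error. *)
Lemma sol_stability s : (3 <= s)%N -> exists2 D, 0 <= D & forall j p g a M,
  small_wave kU c0 j -> 0 <= Re p -> 0 <= M -> sol j p g a ->
  (forall k, k != 0 -> vn (g k) <= M * rho k ^- s) ->
  forall k, vn (a k) <= D * (M + vn (a 0)) * rho k ^- s.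
Proof.
move=> s3; have [D D0 hD] := gal_stability hu c0_gt0 s3.
have [E E0 hE] := convs_rate s.+1; have [F F0 hF] := fc_decay hu s.+1.
exists (D * (1 + F) + 1); first by rewrite !addr_ge0 ?mulr_ge0 ?addr_ge0.
move=> j p g a M sw p0 M0 [da ea] hg k.
have va := vn_ge0 (a 0).
have [->|k0] := eqVneq k 0.
  rewrite rho0 expr1n invr1 mulr1 mulrDl mul1r -[leLHS]add0r; apply: lerD; last by rewrite lerDr.
  by rewrite mulr_ge0 ?addr_ge0 ?mulr_ge0 ?addr_ge0.
have [B B0 hB] := da s.+2.
have [N0 hN0] := in_some_box [:: k].
have H : vn (a k) - D * (M + F * vn (a 0)) * rho k ^- s <= 0.
  apply: (le0_of_rate (c := D * (E * B) * rho k ^- s) (N0 := N0)) => N NN.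
  have kN : k \in nz N by rewrite mem_nz k0 (box_le NN)// hN0// inE.
  (* The Galerkin source: the given one, the contribution of the mean, and the truncation error,
     which [convs_rate] bounds with one extra power to pay for kap. *)
  pose g' l := g l + 'i%C *: cross (kap j l) (cross (u l) (a 0)) +
     'i%C *: cross (kap j l) (convs a l - conv u (box N) a l).
  have := hD j p N g' a (M + F * vn (a 0) + E * B / N.+1%:R) sw p0.
  rewrite lerBlDr.
  have -> : D * (E * B) / rho k ^+ s / N.+1%:R + D * (M + F * vn (a 0)) / rho k ^+ s =
     D * (M + F * vn (a 0) + E * B / N.+1%:R) / rho k ^+ s by ring.
  apply=> //.
  - by rewrite !addr_ge0 ?mulr_ge0 ?invr_ge0.
  - move=> l; rewrite mem_nz => /andP[l0 _]; rewrite ea// /g'.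
    set w := convs a l - _.
    have ew : convs a l = conv u (nz N) a l + (cross (u l) (a 0) + w).
      by rewrite addrA -conv_box addrC subrK.
    clearbody w; rewrite ew !crossDr !scalerDr -!addrA; congr (_ + _).
    by rewrite [RHS]addrC addrA.
  - move=> l; rewrite mem_nz => /andP[l0 _].
    have rl := rho_gt0 (R := R) l.
    have P w X : vn w <= X * rho l ^- s.+1 -> vn ('i%C *: cross (kap j l) w) <= X * rho l ^- s.
      move=> hw; rewrite vnZ cm_i mul1r; apply: le_trans (vn_cross _ _) _.
      have -> : X * rho l ^- s = rho l * (X * rho l ^- s.+1).
        by rewrite [rho l ^+ s.+1]exprS; field; rewrite expf_neq0 ?rho_neq0.
      by apply: ler_pM; rewrite ?vn_ge0//; exact: (sw_upper sw).
    rewrite !mulrDl; apply: le_trans (vnD _ _) _; apply: lerD; last first.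
      by apply: P; exact: hE.
    apply: le_trans (vnD _ _) _; apply: lerD; first exact: hg.
    apply: P; apply: le_trans (vn_cross _ _) _.
    by rewrite mulrAC ler_wpM2r ?hF.
move: H; rewrite subr_le0 => /le_trans; apply; apply: ler_wpM2r => //.
have h1 : 0 <= D * M by rewrite mulr_ge0.
have h2 : 0 <= D * (F * M) by rewrite !mulr_ge0.
have h3 : 0 <= D * vn (a 0) by rewrite mulr_ge0.
lra.
Qed.

(** The truncated system is linear on a finite-dimensional space. [gal_stability] with zero source
    makes it injective, hence surjective. *)
Lemma gal_exists j p N h : small_wave kU c0 j -> 0 <= Re p -> exists a,
  [/\ a 0 = h, forall k, k \notin box N -> a k = 0 &
      gal_eq u j p N (fun k => 'i%C *: cross (kap j k) (cross (u k) h)) a].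
Proof.
move=> sw p0; pose I := seq_sub (nz N).
pose ext (X : {ffun I -> V}) k : V := if insub k is Some x then X x else 0.
have extE X (x : I) : ext X (val x) = X x by rewrite /ext valK.
have ext_lin z X Y k : ext (z *: X + Y) k = z *: ext X k + ext Y k.
  by rewrite /ext; case: insub => [x|]; rewrite ?scaler0 ?addr0// !ffunE.
pose L (X : {ffun I -> V}) : {ffun I -> V} :=
  [ffun x : I => ((kap2 j (val x))%:C%C + p) *: X x
     - 'i%C *: cross (kap j (val x)) (conv u (nz N) (ext X) (val x))].
have ffZD z (X Y : {ffun I -> V}) x : (z *: X + Y) x = z *: X x + Y x by rewrite 2!ffunE.
have LE X x : L X x = ((kap2 j (val x))%:C%C + p) *: X x
    - 'i%C *: cross (kap j (val x)) (conv u (nz N) (ext X) (val x)) by rewrite ffunE.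
have L_lin : linear L.
  move=> z X Y; apply/ffunP => x.
  have e : z *: L X x + L Y x = (z *: L X + L Y) x by rewrite ffZD.
  apply: etrans (LE _ _) _; apply: etrans e; rewrite (LE X x) (LE Y x) ffZD.
  have -> : conv u (nz N) (ext (z *: X + Y)) (val x) =
     z *: conv u (nz N) (ext X) (val x) + conv u (nz N) (ext Y) (val x).
    by rewrite -convZ -convD; apply: conv_eq => l _; rewrite ext_lin.
  by rewrite crossDr crossZr !scalerDr scalerN !scalerA [_ * z]mulrC ['i%C * z]mulrC opprD addrACA.
pose Lb := GRing.isLinear.Build _ _ _ _ L L_lin.
pose f : {linear {ffun I -> V} -> {ffun I -> V}} := HB.pack L Lb.
have [D D0 hD] := gal_stability hu c0_gt0 (leqnn 3).
have finj : injective f.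
  apply: raddf_inj => X LX; apply/ffunP => x; rewrite ffunE.
  have hX : gal_eq u j p N (fun=> 0) (ext X).
    move=> k kN; have /ffunP/(_ (SeqSub kN)) := LX; rewrite !ffunE /= -(extE X) /= => /eqP.
    by rewrite subr_eq0 addr0 => /eqP.
  have := hD j p N (fun=> 0) (ext X) 0 sw p0 (lexx _) hX.
  rewrite mulr0 => /(_ _ _ (valP x)); rewrite mul0r extE => hx; apply: vn_le0; apply: hx.
  by move=> k _; rewrite vn0 mul0r.
pose G : {ffun I -> V} := [ffun x : I => 'i%C *: cross (kap j (val x)) (cross (u (val x)) h)].
have /memv_imgP[X _ GX] : G \in limg (linfun f).
  rewrite lker0_limgf ?memvf//; by apply/lker0P => X Y; rewrite !lfunE => /finj.
pose a k := if k == 0 then h else ext X k.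
have aX k : k \in nz N -> a k = ext X k by rewrite mem_nz => /andP[k0 _]; rewrite /a (negbTE k0).
exists a; split.
- by rewrite /a eqxx.
- move=> k kN; rewrite /a; case: eqP => [k0|_]; first by move: kN; rewrite k0 box0.
  by rewrite /ext insubF// mem_nz (negbTE kN) andbF.
- move=> k kN; rewrite (conv_eq _ _ aX) aX//.
  move: GX; rewrite lfunE /= => /ffunP/(_ (SeqSub kN)); rewrite !ffunE /= => ->.
  by rewrite [RHS]addrC subrK -(extE X (SeqSub kN)).
Qed.

Let shift_conv z (w A B D c : V) : z *: cross w A + z *: cross w c - (z *: cross w B + z *: cross w c) =
  z *: cross w (D - B) + z *: cross w (A + c - (D + c)).
Proof.
rewrite -!scalerDr -scalerBr -!crossDr -crossBr; congr (_ *: cross _ _).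
have e (x y : V) : x + c - (y + c) = x - y by rewrite opprD addrACA subrr addr0.
by rewrite !e [RHS]addrC addrA subrK.
Qed.

(** The Galerkin solutions form a Cauchy sequence in every weighted norm: on the smaller box the
    difference of two of them solves the truncated system with a convolution tail as source, and
    outside it the uniform decay is traded for the rate. *)
Lemma sol_exists j p h : small_wave kU c0 j -> 0 <= Re p ->
  exists2 a, a 0 = h & sol j p (fun=> 0) a.
Proof.
move=> sw p0; have [f hf] := choice (fun N => gal_exists N h sw p0).
have P s w k X : vn w <= X * rho k ^- s.+1 -> vn ('i%C *: cross (kap j k) w) <= X * rho k ^- s.
  move=> hw; rewrite vnZ cm_i mul1r; apply: le_trans (vn_cross _ _) _.
  have -> : X * rho k ^- s = rho k * (X * rho k ^- s.+1).
    by rewrite [rho k ^+ s.+1]exprS; field; rewrite expf_neq0 ?rho_neq0.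
  by apply: ler_pM; rewrite ?vn_ge0//; exact: (sw_upper sw).
have bnd s : (3 <= s)%N -> exists2 B, 0 <= B & forall N k, vn (f N k) <= B * rho k ^- s.
  move=> s3; have [D D0 hD] := gal_stability hu c0_gt0 s3; have [F F0 hF] := fc_decay hu s.+1.
  exists (D * (F * vn h) + vn h); first by rewrite addr_ge0 ?mulr_ge0 ?vn_ge0.
  move=> N k; have [a0 aout eqa] := hf N.
  have [->|k0] := eqVneq k 0.
    by rewrite rho0 expr1n invr1 mulr1 a0 lerDr !mulr_ge0 ?vn_ge0.
  have [kN|kN] := boolP (k \in box N); last first.
    by rewrite aout// vn0 mulr_ge0// addr_ge0 ?mulr_ge0 ?vn_ge0.
  apply: (@le_trans _ _ (D * (F * vn h) * rho k ^- s)); last by rewrite ler_wpM2r// lerDl vn_ge0.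
  apply: (hD _ _ _ _ _ _ sw p0 _ eqa); rewrite ?mulr_ge0 ?vn_ge0 ?mem_nz ?k0//.
  move=> l _; apply: P; apply: le_trans (vn_cross _ _) _.
  by rewrite mulrAC ler_wpM2r ?hF ?vn_ge0.
have cau s : (3 <= s)%N -> exists2 E, 0 <= E & forall k N M, (N <= M)%N ->
    vn (f M k - f N k) <= E * rho k ^- s / N.+1%:R.
  move=> s3; have [D D0 hD] := gal_stability hu c0_gt0 s3.
  have [G G0 hG] := conv_tail s.+1.
  (* Outside the box one spare power gives the rate. Inside, one gives the rate of the tail and
     another pays for the factor kap. *)
  have [B1 B10 hB1] := bnd s.+1 (leqW s3); have [B2 B20 hB2] := bnd s.+2 (leqW (leqW s3)).
  exists (D * (G * B2) + B1); first by rewrite addr_ge0 ?mulr_ge0.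
  move=> k N M NM; have [a0 aout eqa] := hf N; have [b0 bout eqb] := hf M.
  rewrite 2!mulrDl.
  have [->|k0] := eqVneq k 0.
    by rewrite a0 b0 subrr vn0 addr_ge0 ?mulr_ge0 ?r0 ?invr_ge0.
  have [kN|kN] := boolP (k \in box N); last first.
    rewrite aout// subr0 -[leLHS]add0r lerD ?mulr_ge0 ?r0 ?invr_ge0//.
    apply: le_trans (hB1 M k) _; rewrite -!mulrA ler_wpM2l// exprSr invfM ler_wpM2l//.
    by rewrite lef_pV2 ?posrE ?ltr0n ?rho_gt0// rho_out.
  rewrite -[leLHS]addr0 lerD//; last by rewrite !mulr_ge0 ?r0 ?invr_ge0.
  rewrite mulrAC -[D * _ / _]mulrA.
  pose g l := 'i%C *: cross (kap j l) (conv u (box M) (f M) l - conv u (box N) (f M) l).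
  have hg l : vn (g l) <= G * B2 / N.+1%:R * rho l ^- s by apply: P; exact: hG.
  apply: (hD j p N g (fun l => f M l - f N l)) => //; rewrite ?mulr_ge0 ?r0 ?invr_ge0//.
  - move=> l lN; have lM : l \in nz M.
      by move: lN; rewrite !mem_nz => /andP[-> /(box_le NM)].
    have ec : conv u (nz N) (fun l => f M l - f N l) l = conv u (nz N) (f M) l - conv u (nz N) (f N) l.
      rewrite -[in RHS]scaleN1r -convZ -convD; apply: conv_eq => i _.
      by rewrite scaleN1r.
    rewrite ec scalerBr eqa// eqb// /g !conv_box b0; exact: shift_conv.
  - by rewrite mem_nz k0.
pose a k := vlim (fun N => f N k).
have rate s : (3 <= s)%N -> exists2 E, 0 <= E & forall k N, vn (a k - f N k) <= E * rho k ^- s / N.+1%:R.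
  move=> s3; have [E E0 hE] := cau s s3; exists (6 * E); first by rewrite mulr_ge0.
  by move=> k N; rewrite -[6 * E * _]mulrA; apply: vlim_rate => n m; exact: hE.
have da : decays a.
  move=> s; pose t := maxn 3 s; have t3 : (3 <= t)%N by rewrite leq_maxl.
  have [E E0 hE] := rate t t3; have [B B0 hB] := bnd t t3.
  exists (E + B); first exact: addr_ge0.
  move=> k; apply: (@le_trans _ _ ((E + B) * rho k ^- t)).
    rewrite -[a k](subrK (f 0%N k)) (le_trans (vnD _ _))// mulrDl lerD//.
    by have := hE k 0%N; rewrite divr1.
  by rewrite ler_wpM2l ?addr_ge0// rho_le// leq_maxr.
have a0 : a 0 = h.
  have [E E0 hE] := rate 3 (leqnn 3).
  apply/eqP; rewrite -subr_eq0; apply/eqP/vn_le0.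
  apply: (le0_of_rate (c := E * rho 0 ^- 3) (N0 := 0)) => N _.
  by have [<- _ _] := hf N.
exists a => //; split=> // k k0; rewrite addr0.
have [E E0 hE] := rate 3 (leqnn 3).
have [B B0 hB] := da 1%N; have [D D0 hD] := convs_rate 0; have [F F0 hF] := conv_bound hu 0.
have [N0 hN0] := in_some_box [:: k].
pose z := (kap2 j k)%:C%C + p.
apply/eqP; rewrite -subr_eq0; apply/eqP/vn_le0.
apply: (le0_of_rate (c := cm z * (E * rho k ^- 3) + vn (kap j k) * (D * B + F * E)) (N0 := N0)) => N NN.
have [f0 fout eqf] := hf N.
have kN : k \in nz N by rewrite mem_nz k0 (box_le NN)// hN0// inE.
(* Subtracting the Galerkin equation from the residual of the limit leaves three errors of order
   1/(N+1): in the coefficient at k, in the truncation of the convolution, and in its argument. *)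
have -> : z *: a k - 'i%C *: cross (kap j k) (convs a k) = z *: (a k - f N k) -
    'i%C *: cross (kap j k) ((convs a k - conv u (box N) a k) + conv u (box N) (fun l => a l + -1 *: f N l) k).
  rewrite convD convZ scaleN1r addrA subrK crossBr !scalerBr /z eqf// -scalerDr -crossDr -f0 -conv_box.
  by rewrite [in RHS]opprB addrA subrK.
apply: le_trans (vnB _ _) _; rewrite mulrDl; apply: lerD.
  by rewrite vnZ -!mulrA ler_wpM2l ?cm_ge0// mulrA.
rewrite vnZ cm_i mul1r; apply: le_trans (vn_cross _ _) _; rewrite -mulrA ler_wpM2l ?vn_ge0//.
apply: le_trans (vnD _ _) _; rewrite mulrDl; apply: lerD.
  by have := hD a B B0 hB N k; rewrite expr0 invr1 mulr1.
rewrite -mulrA -[leRHS]mulr1 -[X in _ * X]invr1 -(expr0 (rho k)).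
apply: hF; rewrite ?box_uniq ?divr_ge0// => l _.
rewrite scaleN1r expr0 invr1 mulr1; apply: le_trans (hE l N) _.
rewrite ler_wpM2r ?r0 ?invr_ge0// ler_piMr// invf_le1 ?exprn_ege1 ?exprn_gt0 ?rho_ge1 ?rho_gt0//.
Qed.

End Stability.
End Solutions.

(** * Fixed points, determinants and perturbation of a simple eigenvalue *)

Section Perturbation.
Context {R : realType}.
Local Notation C := (R[i])%C.
Local Notation cm := (@Normc.normc R).
Implicit Types (q z w mu : C) (f g : C -> C).

(** Banach's theorem on a closed disc with factor 1/2; since 2^-n <= 1/(n+1), the iterates satisfy a
    rate as in [clim_rate]. *)
Lemma contraction_fixpoint (F : C -> C) mu (r : R) :
  (forall q, cm (q - mu) <= r -> cm (F q - mu) <= r) ->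
  (forall q q', cm (q - mu) <= r -> cm (q' - mu) <= r -> cm (F q - F q') <= 2^-1 * cm (q - q')) ->
  0 <= r -> exists2 q, cm (q - mu) <= r & F q = q.
Proof.
move=> hF hL r0; pose x n := iter n F mu.
have xr n : cm (x n - mu) <= r.
  by elim: n => [|n IH]; [rewrite subrr cm0|exact: hF].
have hit n q : cm (q - mu) <= r -> cm (iter n F q - mu) <= r.
  by elim: n => //= n IH hq; apply: hF; exact: IH.
have hpow n q : cm (q - mu) <= r -> cm (iter n F q - x n) <= 2 ^- n * cm (q - mu).
  elim: n => [|n IH] hq; first by rewrite expr0 invr1 mul1r.
  rewrite exprS invfM -mulrA; apply: le_trans (hL _ _ (hit n q hq) (xr n)) _.
  by rewrite ler_wpM2l ?invr_ge0// IH.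
have cau N M : (N <= M)%N -> cm (x M - x N) <= r / N.+1%:R.
  move=> NM; rewrite -(subnKC NM) {1}/x iterD; apply: le_trans (hpow N _ (xr (M - N)%N)) _.
  rewrite mulrC; apply: ler_pM; rewrite ?cm_ge0 ?invr_ge0 ?exprn_ge0//.
  rewrite lef_pV2 ?posrE ?exprn_gt0 ?ltr0n// -natrX ler_nat; exact: ltn_expl.
have rate := clim_rate cau.
have qr : cm (clim x - mu) <= r.
  rewrite -subr_le0; apply: (le0_of_rate (c := 2 * r) (N0 := 0)) => N _.
  rewrite lerBlDr; have -> : clim x - mu = (clim x - x N) + (x N - mu) by rewrite addrA subrK.
  by apply: le_trans (cmD _ _) _; apply: lerD.
exists (clim x) => //; apply: cm_le0; apply: (le0_of_rate (c := 3 * r) (N0 := 0)) => N _.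
have -> : F (clim x) - clim x = (F (clim x) - F (x N)) - (clim x - x N.+1).
  by rewrite opprB addrA subrK.
have -> : 3 * r / N.+1%:R = 2^-1 * (2 * r / N.+1%:R) + 2 * r / N.+1%:R.
  by move: (N.+1%:R^-1) => y; field.
apply: le_trans (cmB _ _) _; apply: lerD.
  by apply: le_trans (hL _ _ qr (xr N)) _; rewrite ler_wpM2l ?invr_ge0.
apply: le_trans (rate N.+1) _; rewrite ler_wpM2l ?mulr_ge0// lef_pV2 ?posrE ?ltr0n// ler_nat.
exact: leqnSn.
Qed.

Section Close.
Variable B : C -> Prop.

(* Stability of this class under sums and products passes a Lipschitz-small
   perturbation of a matrix to its determinant. *)
Definition close (K d : R) f g := forall q q', B q -> B q' ->
  [/\ cm (f q) <= K, cm (g q) <= K, cm (f q - f q') <= K * cm (q - q'),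
      cm (g q - g q') <= K * cm (q - q') &
      cm (f q - g q) <= K * d /\ cm ((f q - g q) - (f q' - g q')) <= K * d * cm (q - q')].

Let mul_le (z w : C) (a b : R) : cm z <= a -> cm w <= b -> cm (z * w) <= a * b.
Proof. by move=> za wb; rewrite cmM ler_pM ?cm_ge0. Qed.

Let add_le (z w : C) (a b : R) : cm z <= a -> cm w <= b -> cm (z + w) <= a + b.
Proof. by move=> za wb; apply: le_trans (cmD _ _) _; rewrite lerD. Qed.

Lemma close_ext (K d : R) f g f' g' : f =1 f' -> g =1 g' -> close K d f g -> close K d f' g'.
Proof. by move=> /funext -> /funext ->. Qed.

Lemma close_add K1 K2 d f1 g1 f2 g2 : close K1 d f1 g1 -> close K2 d f2 g2 ->
  close (K1 + K2) d (fun q => f1 q + f2 q) (fun q => g1 q + g2 q).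
Proof.
move=> h1 h2 q q' Bq Bq'; have [a1 a2 a3 a4 [a5 a6]] := h1 q q' Bq Bq'.
have [b1 b2 b3 b4 [b5 b6]] := h2 q q' Bq Bq'.
split; [exact: add_le|exact: add_le| | |split]; rewrite ?mulrDl.
- by rewrite opprD addrACA; exact: add_le.
- by rewrite opprD addrACA; exact: add_le.
- by rewrite opprD addrACA; exact: add_le.
- have -> : f1 q + f2 q - (g1 q + g2 q) - (f1 q' + f2 q' - (g1 q' + g2 q')) =
    (f1 q - g1 q - (f1 q' - g1 q')) + (f2 q - g2 q - (f2 q' - g2 q')) by ring.
  exact: add_le.
Qed.

(** The 4 counts the products into which the mixed difference of f1 f2 - g1 g2 between q and q'
    splits. *)
Lemma close_mul K1 K2 d f1 g1 f2 g2 : 0 <= d -> 0 <= K1 -> 0 <= K2 ->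
  close K1 d f1 g1 -> close K2 d f2 g2 ->
  close (4 * (K1 * K2)) d (fun q => f1 q * f2 q) (fun q => g1 q * g2 q).
Proof.
move=> d0 K10 K20 h1 h2 q q' Bq Bq'; have [a1 a2 a3 a4 [a5 a6]] := h1 q q' Bq Bq'.
have [b1 b2 b3 b4 [b5 b6]] := h2 q q' Bq Bq'.
have [a1' a2' _ _ [a5' _]] := h1 q' q Bq' Bq; have [b1' b2' _ _ [b5' _]] := h2 q' q Bq' Bq.
set D := cm (q - q') in a3 a4 a6 b3 b4 b6 *; have D0 : 0 <= D by exact: cm_ge0.
have P : 0 <= K1 * K2 by exact: mulr_ge0.
have PD : 0 <= K1 * K2 * D by exact: mulr_ge0.
have Pd : 0 <= K1 * K2 * d by exact: mulr_ge0.
have PdD : 0 <= K1 * K2 * d * D by exact: mulr_ge0.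
split; [| | | |split].
- by apply: le_trans (mul_le a1 b1) _; lra.
- by apply: le_trans (mul_le a2 b2) _; lra.
- have -> : f1 q * f2 q - f1 q' * f2 q' = (f1 q - f1 q') * f2 q + f1 q' * (f2 q - f2 q') by ring.
  by apply: le_trans (add_le (mul_le a3 b1) (mul_le a1' b3)) _; lra.
- have -> : g1 q * g2 q - g1 q' * g2 q' = (g1 q - g1 q') * g2 q + g1 q' * (g2 q - g2 q') by ring.
  by apply: le_trans (add_le (mul_le a4 b2) (mul_le a2' b4)) _; lra.
- have -> : f1 q * f2 q - g1 q * g2 q = (f1 q - g1 q) * f2 q + g1 q * (f2 q - g2 q) by ring.
  by apply: le_trans (add_le (mul_le a5 b1) (mul_le a2 b5)) _; lra.
- have -> : f1 q * f2 q - g1 q * g2 q - (f1 q' * f2 q' - g1 q' * g2 q') =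
    (f1 q - g1 q - (f1 q' - g1 q')) * f2 q + (f1 q' - g1 q') * (f2 q - f2 q') +
    ((g1 q - g1 q') * (f2 q - g2 q) + g1 q' * (f2 q - g2 q - (f2 q' - g2 q'))) by ring.
  apply: le_trans (add_le (add_le (mul_le a6 b1) (mul_le a5' b3))
    (add_le (mul_le a4 b5) (mul_le a2' b6))) _; lra.
Qed.

Lemma close_cst (K d : R) z : 0 <= d -> 0 <= K -> cm z <= K -> close K d (fun=> z) (fun=> z).
Proof.
move=> d0 K0 hz q q' _ _; rewrite !subrr cm0.
by split=> //; [exact: mulr_ge0 (cm_ge0 _)..|split; rewrite ?mulr_ge0 ?cm_ge0].
Qed.

Lemma close_sum (I : Type) (s : seq I) (K d : R) (f g : I -> C -> C) : 0 <= d -> 0 <= K ->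
  (forall i, close K d (f i) (g i)) ->
  close (K *+ size s) d (fun q => \sum_(i <- s) f i q) (fun q => \sum_(i <- s) g i q).
Proof.
move=> d0 K0 h; elim: s => [|i s IH].
  have := @close_cst 0 d 0 d0 (lexx _); rewrite cm0 => /(_ (lexx _)).
  by apply: close_ext => q; rewrite big_nil.
rewrite /= mulrS; have := close_add (h i) IH.
by apply: close_ext => q; rewrite big_cons.
Qed.

Lemma close_prod (I : Type) (s : seq I) (K d : R) (f g : I -> C -> C) : 0 <= d -> 1 <= K ->
  (forall i, close K d (f i) (g i)) ->
  close ((4 * K) ^+ size s) d (fun q => \prod_(i <- s) f i q) (fun q => \prod_(i <- s) g i q).
Proof.
move=> d0 K1 h; have K0 : 0 <= K by exact: le_trans K1.
elim: s => [|i s IH].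
  have := @close_cst 1 d 1 d0 ler01; rewrite cm1 => /(_ (lexx _)).
  by apply: close_ext => q; rewrite big_nil.
have K0' : 0 <= (4 * K) ^+ size s by rewrite exprn_ge0// mulr_ge0.
rewrite /= exprS -mulrA; have := close_mul d0 K0 K0' (h i) IH.
by apply: close_ext => q; rewrite big_cons.
Qed.

(** By the Leibniz expansion L depends on n and K only, so it is available before the size d of the
    perturbation is chosen. *)
Lemma close_det n (K : R) : 1 <= K -> exists2 L, 0 <= L & forall d (M N : C -> 'M[C]_n), 0 <= d ->
  (forall i j, close K d (fun q => M q i j) (fun q => N q i j)) ->
  close L d (fun q => \det (M q)) (fun q => \det (N q)).
Proof.
move=> K1; have K0 : 0 <= K by exact: le_trans K1.
pose L1 : R := 4 * (1 * (4 * K) ^+ size (index_enum 'I_n)).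
have L10 : 0 <= L1 by rewrite !mulr_ge0// exprn_ge0// mulr_ge0.
exists (L1 *+ size (index_enum 'S_n)); first exact: mulrn_wge0.
move=> d M N d0 h; apply: close_sum => // s.
apply: close_mul => //; first by rewrite exprn_ge0// mulr_ge0.
- by apply: close_cst => //; rewrite cmX cmN cm1 expr1n.
- by apply: close_prod.
Qed.

End Close.

(** [close] with d = 0 and equal functions says bounded and Lipschitz, so its closure under sums and
    products gives the claim by induction. *)
Lemma poly_bounded_lip (p : {poly C}) mu : exists2 S, 0 <= S & forall q q',
  cm (q - mu) <= 1 -> cm (q' - mu) <= 1 ->
  cm p.[q] <= S /\ cm (p.[q] - p.[q']) <= S * cm (q - q').
Proof.
pose B q := cm (q - mu) <= 1.
suff [S S0 hS] : exists2 S, 0 <= S & close B S 0 (horner p) (horner p).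
  by exists S => // q q' h h'; have [h1 _ h2 _ _] := hS q q' h h'.
elim/poly_ind: p => [|p c [S S0 hS]].
  exists 0 => //; have := @close_cst B 0 0 0 (lexx _) (lexx _); rewrite cm0 => /(_ (lexx _)).
  by apply: close_ext => q; rewrite horner0.
have hX : close B (1 + cm mu) 0 id id.
  move=> q q' Bq Bq'; rewrite !subrr cm0 !mulr0 !mul0r.
  have hq : cm q <= 1 + cm mu.
    by rewrite -[X in cm X](subrK mu); apply: le_trans (cmD _ _) _; rewrite lerD2r.
  by split=> //; rewrite mulrDl mul1r lerDl mulr_ge0 ?cm_ge0.
have K0 : 0 <= 1 + cm mu by rewrite addr_ge0 ?cm_ge0.
exists (4 * (S * (1 + cm mu)) + cm c); first by rewrite addr_ge0 ?mulr_ge0 ?cm_ge0.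
have := close_add (close_mul (lexx _) S0 K0 hS hX) (close_cst (B := B) (lexx _) (cm_ge0 c) (lexx _)).
by apply: close_ext => q; rewrite !hornerE.
Qed.

Lemma det_char_poly n (A : 'M[C]_n) q : \det (q%:M - A) = (char_poly A).[q].
Proof.
rewrite /char_poly -[RHS]/(horner_eval q _) -det_map_mx; congr (\det _).
apply/matrixP => i j; rewrite !mxE /=.
by rewrite /horner_eval hornerD hornerN hornerC hornerMn hornerX.
Qed.

Lemma simple_rootP (p : {poly C}) mu : p != 0 -> mup mu p = 1%N -> exists r s : {poly C},
  [/\ r.[mu] != 0, p = ('X - mu%:P) * r & r = (r.[mu])%:P + ('X - mu%:P) * s].
Proof.
move=> p0 hm; have /dvdpP[r hr] : 'X - mu%:P %| p by rewrite XsubC_dvd// hm.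
have /dvdpP[s hs] : 'X - mu%:P %| r - (r.[mu])%:P by rewrite dvdp_XsubCl rootE !hornerE subrr.
exists r, s; split; last by rewrite mulrC -hs addrC subrK.
- apply/negP => /eqP r0.
  have : (mup mu p <= 1)%N by rewrite hm.
  rewrite mup_leq// => /negP; apply; rewrite hr expr2 dvdp_mul// dvdp_XsubCl rootE; exact/eqP.
- by rewrite hr mulrC.
Qed.

(** Newton's iteration with frozen slope. The characteristic polynomial is (q - mu) (rho(mu) + (q -
    mu) s(q)) with rho(mu) nonzero, so the perturbed determinant vanishes at the fixed points of F
    below, where D is the change of the determinant. On a small disc the quadratic term and D both
    have small Lipschitz constants. *)
Lemma simple_eigenvalue_perturb n (A : 'M[C]_n) mu (r : R) : simple_eigenvalue A mu -> 0 < r ->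
  exists2 d0, 0 < d0 & forall (E : C -> 'M[C]_n) d, 0 <= d <= d0 ->
    (forall q q' i j, cm (q - mu) <= r -> cm (q' - mu) <= r ->
       cm (E q i j) <= d /\ cm (E q i j - E q' i j) <= d * cm (q - q')) ->
    exists2 q, cm (q - mu) <= r & \det (q%:M - (A + E q)) = 0.
Proof.
move=> hA r0.
have [rho [s [rho0 hP hrho]]] := simple_rootP (monic_neq0 (char_poly_monic A)) hA.
have [S S0 hS] := poly_bounded_lip s mu.
pose b := cm rho.[mu]; have b0 : 0 < b by rewrite cm_gt0.
(* The quadratic term has Lipschitz constant at most 3 r1 S <= b / 4, and [d0] gives [L * d] at most
   b / 4 as well; divided by b, they make F a contraction with factor 1/2. *)
pose r1 := Num.min (Num.min 1 r) (b / (12 * (S + 1))).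
have S1 : 0 < S + 1 by lra.
have r10 : 0 < r1 by rewrite !lt_min ltr01 r0 divr_gt0// mulr_gt0.
have r11 : r1 <= 1 by rewrite !ge_min lexx.
have r1r : r1 <= r by rewrite !ge_min lexx orbT.
have r1b : r1 * (S + 1) <= b / 12.
  rewrite -ler_pdivlMr//; have -> : b / 12 / (S + 1) = b / (12 * (S + 1)) by rewrite -mulrA invfM.
  by rewrite ge_min lexx orbT.
pose B q := cm (q - mu) <= r1.
(* Bounds the entries of both matrices on the disc, where |q| <= |mu| + 1 and the perturbation is at
   most d <= 1. *)
pose K : R := cm mu + 2 + \sum_i \sum_j cm (A i j).
have K1 : 1 <= K.
  by have := cm_ge0 mu; have : 0 <= \sum_i \sum_j cm (A i j); [by apply: sumr_ge0 => i _; apply: sumr_ge0 => j _; exact: cm_ge0|rewrite /K; lra].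
have [L L0 hL] := close_det B n K1.
pose d0 := Num.min 1 (r1 * b / (4 * (L + 1))).
have L1 : 0 < L + 1 by lra.
have d00 : 0 < d0 by rewrite lt_min ltr01 divr_gt0// mulr_gt0.
exists d0 => // E d /andP[dge0 dd0] hE.
have d1 : d <= 1 by rewrite (le_trans dd0)// ge_min lexx.
have Ld : L * d <= r1 * b / 4.
  apply: (@le_trans _ _ ((L + 1) * d)); first by rewrite ler_wpM2r// lerDl.
  have -> : r1 * b / 4 = (L + 1) * (r1 * b / (4 * (L + 1))) by field; rewrite gt_eqF.
  by rewrite ler_wpM2l ?(ltW L1)// (le_trans dd0)// ge_min lexx orbT.
have Aij i j : cm (A i j) <= \sum_i \sum_j cm (A i j).
  rewrite (bigD1 i)//= (bigD1 j)//= -addrA lerDl addr_ge0//.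
    by apply: sumr_ge0 => *; exact: cm_ge0.
  by apply: sumr_ge0 => *; apply: sumr_ge0 => *; exact: cm_ge0.
have hclose i j : close B K d (fun q => (q%:M - (A + E q)) i j) (fun q => (q%:M - A) i j).
  move=> q q' Bq Bq'; rewrite !mxE.
  have [e1 e2] := hE q q' i j (le_trans Bq r1r) (le_trans Bq' r1r).
  have D0 := cm_ge0 (q - q').
  have hq : cm (q *+ (i == j)) <= cm mu + 1.
    case: (i == j); rewrite ?mulr0n ?mulr1n ?cm0; last by rewrite addr_ge0 ?cm_ge0.
    rewrite -[q](subrK mu); apply: le_trans (cmD _ _) _; rewrite addrC lerD2l.
    exact: le_trans Bq r11.
  have hqq : cm (q *+ (i == j) - q' *+ (i == j)) <= cm (q - q').
    by rewrite -mulrnBl; case: (i == j); rewrite ?mulr0n ?mulr1n ?cm0.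
  have A1 := Aij i j; have mu0 := cm_ge0 mu.
  have Kd : 1 <= K := K1.
  have Kd1 : d <= K * d by rewrite ler_peMl.
  have KD : cm (q - q') <= K / 2 * cm (q - q').
    by rewrite ler_peMl// /K; have := le_trans (cm_ge0 _) A1; lra.
  have dD : d * cm (q - q') <= K / 2 * cm (q - q').
    by apply: le_trans KD; rewrite ler_piMl.
  have eA : q *+ (i == j) - (A i j + E q i j) - (q *+ (i == j) - A i j) = - E q i j by ring.
  have eA' : q' *+ (i == j) - (A i j + E q' i j) - (q' *+ (i == j) - A i j) = - E q' i j by ring.
  split; [| | | |split].
  - apply: le_trans (cmB _ _) _; have := cmD (A i j) (E q i j); rewrite /K; lra.
  - apply: le_trans (cmB _ _) _; rewrite /K; lra.
  - have -> : q *+ (i == j) - (A i j + E q i j) - (q' *+ (i == j) - (A i j + E q' i j)) =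
      (q *+ (i == j) - q' *+ (i == j)) - (E q i j - E q' i j) by ring.
    apply: le_trans (cmB _ _) _; lra.
  - have -> : q *+ (i == j) - A i j - (q' *+ (i == j) - A i j) = q *+ (i == j) - q' *+ (i == j) by ring.
    by lra.
  - by rewrite eA cmN; lra.
  - rewrite eA eA' -opprD cmN; apply: le_trans e2 _; rewrite ler_wpM2r//.
have hD := hL d _ _ dge0 hclose.
pose D q := \det (q%:M - (A + E q)) - \det (q%:M - A).
pose F q := mu - ((q - mu) ^+ 2 * s.[q] + D q) / rho.[mu].
have PE q : \det (q%:M - A) = (q - mu) * (rho.[mu] + (q - mu) * s.[q]).
  by rewrite det_char_poly hP {1}hrho !hornerE.
have hsq q : B q -> cm ((q - mu) ^+ 2 * s.[q] + D q) <= b * r1.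
  move=> Bq; have [_ _ _ _ [h _]] := hD q q Bq Bq.
  have [hs _] := hS q q (le_trans Bq r11) (le_trans Bq r11).
  apply: le_trans (cmD _ _) _; rewrite cmM cmX.
  have h1 : cm (q - mu) ^+ 2 * cm s.[q] <= r1 * (r1 * (S + 1)).
    rewrite mulrA -expr2; apply: ler_pM; rewrite ?exprn_ge0 ?cm_ge0//; last by lra.
    by rewrite lerXn2r ?nnegrE ?cm_ge0// ltW.
  have h2 := ler_wpM2l (ltW r10) r1b.
  have h3 := le_trans h Ld; rewrite -/(D q) in h3.
  have h4 := mulr_gt0 b0 r10.
  apply: le_trans (lerD (le_trans h1 h2) h3) _; lra.
have [q Bq Fq] : exists2 q, cm (q - mu) <= r1 & F q = q.
  apply: contraction_fixpoint; last exact: ltW.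
  - move=> q Bq; rewrite /F addrC addKr cmN cmM cmV ler_pdivrMr// [leRHS]mulrC -/b; exact: hsq.
  - move=> q q' Bq Bq'.
    have [_ _ _ _ [_ h]] := hD q q' Bq Bq'; rewrite -/(D q) -/(D q') in h.
    have [hs _] := hS q q (le_trans Bq r11) (le_trans Bq r11).
    have [hs' hl] := hS q q' (le_trans Bq r11) (le_trans Bq' r11).
    have hss : cm ((q - mu) ^+ 2 * s.[q] - (q' - mu) ^+ 2 * s.[q']) <= b / 4 * cm (q - q').
      have -> : (q - mu) ^+ 2 * s.[q] - (q' - mu) ^+ 2 * s.[q'] =
        (q - q') * ((q - mu + (q' - mu)) * s.[q]) + (q' - mu) ^+ 2 * (s.[q] - s.[q']) by ring.
      apply: le_trans (cmD _ _) _.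
      rewrite (cmM (q - q')) (cmM (_ + _)) (cmM (_ ^+ 2)) cmX.
      have D0 := cm_ge0 (q - q').
      have h1 : cm (q - mu + (q' - mu)) * cm s.[q] <= (r1 + r1) * S.
        by apply: ler_pM; rewrite ?cm_ge0//; apply: le_trans (cmD _ _) _; rewrite lerD.
      have h2 : cm (q' - mu) ^+ 2 * cm (s.[q] - s.[q']) <= r1 * (S * cm (q - q')).
        apply: ler_pM; rewrite ?exprn_ge0 ?cm_ge0//.
        by apply: le_trans (_ : r1 * r1 <= r1); [rewrite -expr2 lerXn2r ?nnegrE ?cm_ge0// ltW|rewrite ler_piMl// ltW].
      have h3 := ler_wpM2l D0 h1; have h4 := ler_wpM2r D0 r1b.
      have h5 := mulr_ge0 (ltW r10) D0.
      lra.
    have -> : F q - F q' = - (((q - mu) ^+ 2 * s.[q] - (q' - mu) ^+ 2 * s.[q'] + (D q - D q')) / rho.[mu]).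
      rewrite /F; ring.
    rewrite cmN cmM cmV ler_pdivrMr// -/b; apply: le_trans (cmD _ _) _.
    have D0 := cm_ge0 (q - q').
    have h1 := le_trans h (ler_wpM2r D0 Ld).
    have h2 : r1 * b / 4 * cm (q - q') <= b / 4 * cm (q - q').
      by rewrite ler_wpM2r// ler_wpM2r// ?ler_piMl// ltW.
    by lra.
exists q; first exact: le_trans Bq r1r.
have -> : \det (q%:M - (A + E q)) = D q + \det (q%:M - A) by rewrite /D subrK.
rewrite PE.
have : (q - mu) * rho.[mu] = - ((q - mu) ^+ 2 * s.[q] + D q).
  rewrite -{1}Fq /F addrC addKr mulNr mulfVK//.
move=> h; rewrite mulrDr h; ring.
Qed.

Lemma det_eigenvector n (A : 'M[C]_n) q : \det (q%:M - A) = 0 ->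
  exists2 h : 'cV[C]_n, h != 0 & A *m h = q *: h.
Proof.
rewrite -det_tr => /eqP/det0P[v v0 hv]; exists v^T.
  by apply: contraNneq v0 => /(congr1 trmx); rewrite trmxK linear0 => ->.
have /(congr1 trmx) := hv; rewrite trmx_mul trmxK linear0 mulmxBl mul_scalar_mx => /eqP.
by rewrite subr_eq0 => /eqP.
Qed.

End Perturbation.

(** * Small wave vectors and the unstable mode *)

Section Instability.
Context {R : realType}.
Local Notation C := (R[i])%C.
Local Notation V := 'cV[C]_3.
Local Notation K := 'cV[int]_3.
Local Notation cm := (@Normc.normc R).
Local Notation Re := (@complex.Re R).
Local Notation rho := (@rho R).
Local Notation kc := (@kc R).
Implicit Types (k l : K) (j : 'cV[R]_3) (a b g : K -> V) (p q : C).
Variables (u : K -> V) (kU : R).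
Hypothesis hu : field_coefs u kU.
Variable e : 'cV[R]_3.
Hypothesis e1 : \sum_i e i 0 ^+ 2 = 1.

Let c0 := (1 - kU) / 2.
Let c0_gt0 : 0 < c0.
Proof. by have /andP[_ h] := fc_kU hu; rewrite divr_gt0// subr_gt0. Qed.

Let r0 t k : 0 <= rho k ^- t.
Proof. by rewrite invr_ge0 exprn_ge0// ltW// rho_gt0. Qed.

(** The spectral gap of the Laplacian on the torus, against which the bound kU < 1 is measured. *)
Lemma kc_sqr_ge1 k : k != 0 -> 1 <= \sum_i kc k i ^+ 2.
Proof.
move=> k0.
have [m km] : exists m, kc k m != 0.
  by apply: contrapT => /forallNP hh; move/eqP: k0; apply; apply: (@kc_eq0 R) => m; apply/eqP/negP => /negP; exact: hh.
rewrite (bigD1 m)//=; apply: le_trans (_ : kc k m ^+ 2 <= _); last first.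
  by rewrite lerDl sumr_ge0// => *; exact: sqr_ge0.
rewrite -real_normK ?num_real// exprn_ege1//.
by rewrite /kc -intr_norm -[1]/(1%:~R) ler_int; move: km; rewrite /kc intr_eq0; lia.
Qed.

Lemma rho_sqr_le k : rho k ^+ 2 <= 4 * (1 + \sum_i kc k i ^+ 2).
Proof.
rewrite rhoE !sum3 -!(real_normK (num_real (kc _ _))).
move: `|kc k ord0| `|kc k 1| `|kc k (1 + 1)| => x y z.
have := sqr_ge0 (x - y); have := sqr_ge0 (x - z); have := sqr_ge0 (y - z).
have := sqr_ge0 (x - 1); have := sqr_ge0 (y - 1); have := sqr_ge0 (z - 1).
nra.
Qed.

Lemma kc_sqr_le k : \sum_i kc k i ^+ 2 + 1 <= rho k ^+ 2.
Proof.
rewrite rhoE !sum3 -!(real_normK (num_real (kc _ _))).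
have := normr_ge0 (kc k ord0); have := normr_ge0 (kc k 1); have := normr_ge0 (kc k (1 + 1)).
move: `|kc k ord0| `|kc k 1| `|kc k (1 + 1)| => x y z x0 y0 z0.
have := mulr_ge0 x0 y0; have := mulr_ge0 x0 z0; have := mulr_ge0 y0 z0; nra.
Qed.

Let kap2E (t : R) k : kap2 (t *: e) k = \sum_i kc k i ^+ 2 + t * (2 * \sum_i kc k i * e i 0) + t ^+ 2.
Proof.
have -> : t ^+ 2 = t ^+ 2 * \sum_i e i 0 ^+ 2 by rewrite e1 mulr1.
rewrite /kap2 !sum3 !mxE; ring.
Qed.

Let dot_le k : `|2 * \sum_i kc k i * e i 0| <= \sum_i kc k i ^+ 2 + 1.
Proof.
have := e1; rewrite !sum3 ler_norml => E.
have := sqr_ge0 (kc k ord0 - e ord0 0); have := sqr_ge0 (kc k 1 - e 1 0); have := sqr_ge0 (kc k (1 + 1) - e (1 + 1) 0).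
have := sqr_ge0 (kc k ord0 + e ord0 0); have := sqr_ge0 (kc k 1 + e 1 0); have := sqr_ge0 (kc k (1 + 1) + e (1 + 1) 0).
by move=> h1 h2 h3 h4 h5 h6; apply/andP; split; nra.
Qed.

Let e_le i : `|e i 0| <= 1.
Proof.
rewrite -(@ler_pXn2r _ 2)// ?nnegrE// real_normK ?num_real// expr1n -e1 (bigD1 i)//= lerDl.
by apply: sumr_ge0 => *; exact: sqr_ge0.
Qed.

(** Half of the gap 1 - kU is kept as the margin c0; the restriction on t lets the other half pay
    for the loss 2t in the symbol. *)
Lemma small_wave_scale (t : R) : 0 <= t <= (1 - kU) / 4 -> small_wave kU c0 (t *: e).
Proof.
have /andP[kU0 kU1] := fc_kU hu => /andP[t0 t1].
(* The cross term 2 t k.e is at least - t (|k|^2 + 1), hence at least - 2 t |k|^2. *)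
have low k : k != 0 -> (1 - 2 * t) * \sum_i kc k i ^+ 2 <= kap2 (t *: e) k.
  move=> k0; rewrite kap2E; have := dot_le k; have := kc_sqr_ge1 k0; rewrite ler_norml.
  move: (\sum_i _ ^+ 2) (2 * _) => Q d Q1 /andP[d1 _].
  have := ler_wpM2l t0 d1; have := ler_wpM2l t0 Q1; have := sqr_ge0 t; nra.
split=> k.
- move=> k0; apply: le_trans (low k k0); have := rho_sqr_le k; have := kc_sqr_ge1 k0.
  move: (\sum_i _ ^+ 2) (rho k ^+ 2) => Q r Q1 h.
  have := ler_wpM2r (le_trans ler01 Q1) t1.
  have := mulr_ge0 kU0 (le_trans ler01 Q1); lra.
- rewrite /vn rhoE.
  have h i : cm (kap (t *: e) k i 0) <= `|kc k i| + 4^-1.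
    rewrite !mxE cmR; apply: le_trans (ler_normD _ _) _; rewrite lerD2l normrM (ger0_norm t0).
    have := ler_wpM2l t0 (e_le i); lra.
  rewrite !sum3; have := h ord0; have := h 1; have := h (1 + 1); lra.
- move=> k0; have h := low k k0; have Q1 := kc_sqr_ge1 k0.
  apply: (@le_trans _ _ ((1 - c0) * ((1 - 2 * t) * \sum_i kc k i ^+ 2))).
    move: (\sum_i _ ^+ 2) Q1 => Q Q1.
    have d : 0 <= (1 - c0) * (1 - 2 * t) - kU.
      have : t * (1 + kU) <= (1 - kU) / 4 * 2 by apply: ler_pM => //; lra.
      rewrite /c0; lra.
    have s : 0 <= (1 - c0) * (1 - 2 * t) by lra.
    by rewrite mulrA; have := ler_wpM2l s Q1; lra.
  by apply: ler_wpM2l => //; rewrite /c0; lra.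
Qed.

Let small0 : small_wave kU c0 0.
Proof.
rewrite -(scale0r e); apply: small_wave_scale; rewrite lexx divr_ge0// subr_ge0.
by have /andP[_ /ltW] := fc_kU hu.
Qed.

Lemma sol_unique j p a b : small_wave kU c0 j -> 0 <= Re p ->
  sol u j p (fun=> 0) a -> sol u j p (fun=> 0) b -> a 0 = b 0 -> a = b.
Proof.
move=> sw p0 sa sb ab; have [D D0 hD] := sol_stability hu c0_gt0 (leqnn 3).
apply/funext => k; apply/eqP; rewrite -subr_eq0; apply/eqP/vn_le0.
have := hD j p _ _ 0 sw p0 (lexx _) (solD hu sa (solZ hu (-1) sb)).
move=> /= h; have := h _ k; rewrite ab !scaleN1r !subrr !vn0 addr0 mulr0 mul0r; apply=> l _.
by rewrite mul0r.
Qed.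

(** Read with other parameters, a solution acquires as source the difference of the symbols applied
    to it; stability then bounds the effect of the change. *)
Lemma sol_change j p j' p' a : sol u j' p' (fun=> 0) a ->
  sol u j p (fun k => ((kap2 j k)%:C%C - (kap2 j' k)%:C%C + (p - p')) *: a k +
     'i%C *: cross (kap j' k - kap j k) (convs u a k)) a.
Proof.
move=> [da ea]; split=> // k k0; have := ea k k0; rewrite addr0 => h.
rewrite crossBl scalerBr -h [RHS]addrC -!addrA addNr addr0 -scalerDl.
congr (_ *: _); ring.
Qed.

Lemma sol_compare : exists2 D, 0 <= D & forall j p g a a' M, small_wave kU c0 j -> 0 <= Re p ->
  0 <= M -> sol u j p (fun=> 0) a -> sol u j p g a' -> a 0 = a' 0 ->
  (forall k, k != 0 -> vn (g k) <= M * rho k ^- 3) ->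
  vn (convs u a 0 - convs u a' 0) <= D * M.
Proof.
have [D D0 hD] := sol_stability hu c0_gt0 (leqnn 3); have [E E0 hE] := convs_bound hu 0.
exists (E * D); first exact: mulr_ge0.
move=> j p g a a' M sw p0 M0 sa sa' aa' hg.
have sd := solD hu sa (solZ hu (-1) sa').
have /= h := hD j p _ _ M sw p0 M0 sd.
have hd k : vn (a k + -1 *: a' k) <= D * M * rho k ^- 3.
  have := h _ k; rewrite aa' !scaleN1r subrr vn0 addr0; apply=> l l0.
  by rewrite scaleN1r add0r vnN hg.
have := hE (fun k => a k + -1 *: a' k) (D * M).
rewrite mulr_ge0// => /(_ isT) h2; have := h2 _ 0; rewrite rho0 expr0 invr1 mulr1 mulrA.
have [[da _] [da' _]] := (sa, sa').
rewrite (convsD hu)// ?(convsZ hu)// ?scaleN1r; first apply.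
  by move=> l; apply: le_trans (hd l) _; rewrite ler_wpM2l ?mulr_ge0// rho_le.
exact: decaysZ.
Qed.

Let ew : V := \col_i (e i 0)%:C%C.

Let vn_ew : vn ew <= 3.
Proof.
rewrite /vn sum3 !mxE !cmR; have := e_le ord0; have := e_le 1; have := e_le (1 + 1); lra.
Qed.

Let kap_scale (t : R) k : kap 0 k - kap (t *: e) k = - (t%:C%C *: ew).
Proof.
apply/matrixP => i o; rewrite ord1 !mxE -rmorphB -rmorphM -rmorphN; congr (_%:C%C); ring.
Qed.

(** With j fixed, the source of [sol_change] reduces to (p - p') a'. *)
Lemma convs_lip : exists2 D, 0 <= D & forall j p p' a a', small_wave kU c0 j ->
  0 <= Re p -> 0 <= Re p' -> sol u j p (fun=> 0) a -> sol u j p' (fun=> 0) a' ->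
  a 0 = a' 0 -> vn (a 0) <= 1 -> vn (convs u a 0 - convs u a' 0) <= D * cm (p - p').
Proof.
have [D D0 hD] := sol_compare; have [E E0 hE] := sol_stability hu c0_gt0 (leqnn 3).
exists (D * E); first exact: mulr_ge0.
move=> j p p' a a' sw p0 p0' sa sa' aa' a1.
rewrite -mulrA; apply: (hD j p _ a a' _ sw p0 _ sa (sol_change j p sa') aa').
  by rewrite mulr_ge0 ?cm_ge0.
move=> k k0; rewrite !subrr add0r cross0l scaler0 addr0 vnZ.
have ha' := hE j p' _ a' 0 sw p0' (lexx _) sa' _ k.
rewrite [E * _]mulrC -mulrA; apply: ler_wpM2l; first exact: cm_ge0.
apply: le_trans (ha' _) _; first by move=> l _; rewrite vn0 mul0r.
by rewrite add0r ler_wpM2r// ler_piMr// -aa'.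
Qed.

(** The symbols differ by O(t + |p|) times rho^2, so decay 5 = 3 + 2 of the solution at t = 0 is
    used; the curl symbols differ by the constant vector t e. *)
Lemma convs_small : exists2 D, 0 <= D & forall (t : R) p a a', 0 <= t <= (1 - kU) / 4 ->
  0 <= Re p -> sol u (t *: e) p (fun=> 0) a -> sol u 0 0 (fun=> 0) a' ->
  a 0 = a' 0 -> vn (a 0) <= 1 -> vn (convs u a 0 - convs u a' 0) <= D * (t + cm p).
Proof.
have [D D0 hD] := sol_compare.
have [E E0 hE] := sol_stability hu c0_gt0 (isT : (3 <= 5)%N).
have [F F0 hF] := convs_bound hu 3.
exists (D * (3 * E + 3 * F * E)); first by rewrite mulr_ge0 ?addr_ge0 ?mulr_ge0.
move=> t p a a' ht p0 sa sa' aa' a1; have /andP[t0 t1] := ht.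
have tq : t <= 1 by have /andP[kU0 _] := fc_kU hu; lra.
have sw := small_wave_scale ht.
have ha' k : vn (a' k) <= E * rho k ^- 5.
  have := hE 0 0 _ a' 0 small0 (lexx _) (lexx _) sa' _ k; rewrite add0r => h.
  apply: le_trans (h _) _; first by move=> l _; rewrite vn0 mul0r.
  by rewrite ler_wpM2r// ler_piMr// -aa'.
have hc k : vn (convs u a' k) <= F * E * rho k ^- 3.
  by apply: hF => // l; apply: le_trans (ha' l) _; rewrite ler_wpM2l// rho_le.
have P := cm_ge0 p.
rewrite -mulrA; apply: (hD _ p _ a a' _ sw p0 _ sa (sol_change _ p sa') aa').
  by rewrite mulr_ge0 ?addr_ge0 ?mulr_ge0.
move=> k k0; apply: le_trans (vnD _ _) _; rewrite -mulrA mulrDl; apply: lerD.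
  rewrite vnZ subr0.
  apply: (@le_trans _ _ ((3 * (t + cm p) * rho k ^+ 2) * (E * rho k ^- 5))); last first.
    have -> : 3 * (t + cm p) * rho k ^+ 2 * (E / rho k ^+ 5) = 3 * E * ((t + cm p) / rho k ^+ 3).
      by field; rewrite rho_neq0.
    exact: lexx.
  apply: ler_pM; rewrite ?cm_ge0 ?vn_ge0//.
  apply: le_trans (cmD _ _) _; rewrite -rmorphB cmR.
  have -> : (0 : 'cV[R]_3) = 0 *: e by rewrite scale0r.
  rewrite !kap2E mul0r expr0n /= !addr0.
  have -> : \sum_i kc k i ^+ 2 + t * (2 * \sum_i kc k i * e i 0) + t ^+ 2 - \sum_i kc k i ^+ 2 =
     t * (2 * \sum_i kc k i * e i 0) + t ^+ 2 by ring.
  have h1 := dot_le k; have h2 := kc_sqr_le k.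
  have h3 : `|t * (2 * \sum_i kc k i * e i 0) + t ^+ 2| <= t * rho k ^+ 2 + t * 1.
    apply: le_trans (ler_normD _ _) _; rewrite normrM (ger0_norm t0) (ger0_norm (sqr_ge0 t)) [t ^+ 2]expr2.
    by rewrite lerD// ler_wpM2l// (le_trans h1).
  have R1 : 1 <= rho k ^+ 2 by rewrite exprn_ege1// rho_ge1.
  have := ler_wpM2l t0 R1; have := ler_wpM2l P R1.
  have := mulr_ge0 t0 (le_trans ler01 R1); have := mulr_ge0 P (le_trans ler01 R1); lra.
rewrite kap_scale crossNl crossZl vnZ cm_i mul1r vnN vnZ cmR (ger0_norm t0).
have h : vn (cross ew (convs u a' k)) <= 3 * (F * E * rho k ^- 3).
  by apply: le_trans (vn_cross _ _) _; apply: ler_pM; rewrite ?vn_ge0.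
apply: le_trans (ler_wpM2l t0 h) _.
have := mulr_ge0 P (mulr_ge0 (mulr_ge0 F0 E0) (r0 3 k)); lra.
Qed.

Let vn_delta m : vn (delta_mx m 0 : V) <= 1.
Proof.
rewrite /vn (bigD1 m)//= big1 => [|i im]; first by rewrite mxE !eqxx cm1 addr0.
by rewrite mxE (negbTE im) mulr0n cm0.
Qed.

Let entry_le (x y : V) r : cm (('i%C *: cross ew x) r 0 - ('i%C *: cross ew y) r 0) <= 3 * vn (x - y).
Proof.
have -> : ('i%C *: cross ew x) r 0 - ('i%C *: cross ew y) r 0 = ('i%C *: cross ew (x - y)) r 0.
  by rewrite crossBr scalerBr !mxE.
apply: le_trans (vn_coord _ _) _; rewrite vnZ cm_i mul1r; apply: le_trans (vn_cross _ _) _.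
by rewrite ler_wpM2r ?vn_ge0.
Qed.

(** By uniqueness a solution depends linearly on its mean, so the map from h to i e x (U x H)_0 is a
    matrix. Its columns come from solutions whose means are the basis vectors; where existence is
    not known, [xget] returns the zero family and nothing is claimed. *)
Lemma response_matrix : exists M : 'cV[R]_3 -> C -> 'M[C]_3, [/\
  forall j p a, small_wave kU c0 j -> 0 <= Re p -> sol u j p (fun=> 0) a ->
    'i%C *: cross ew (convs u a 0) = M j p *m a 0,
  exists2 D, 0 <= D & forall j p p' i m, small_wave kU c0 j -> 0 <= Re p -> 0 <= Re p' ->
    cm (M j p i m - M j p' i m) <= D * cm (p - p') &
  exists2 D, 0 <= D & forall (t : R) p i m, 0 <= t <= (1 - kU) / 4 -> 0 <= Re p ->
    cm (M (t *: e) p i m - M 0 0 i m) <= D * (t + cm p)].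
Proof.
have [b bP] : exists b : 'cV[R]_3 -> C -> 'I_3 -> K -> V, forall j p m, small_wave kU c0 j -> 0 <= Re p ->
    b j p m 0 = delta_mx m 0 /\ sol u j p (fun=> 0) (b j p m).
  exists (fun j p m => xget (fun=> 0) [set a | a 0 = delta_mx m 0 /\ sol u j p (fun=> 0) a]) => j p m sw p0.
  have [a a0 sa] := sol_exists hu c0_gt0 (delta_mx m 0) sw p0.
  have ex : exists a, [set a : K -> V | a 0 = delta_mx m 0 /\ sol u j p (fun=> 0) a] a by exists a.
  exact: (xgetPex (fun=> 0) ex).
have [M ME] : exists M : 'cV[R]_3 -> C -> 'M[C]_3, forall j p r m,
    M j p r m = ('i%C *: cross ew (convs u (b j p m) 0)) r 0.
  by exists (fun j p => \matrix_(r, m) ('i%C *: cross ew (convs u (b j p m) 0)) r 0) => j p r m; rewrite mxE.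
exists M; split.
- move=> j p a sw p0 sa.
  have hb m : b j p m 0 = delta_mx m 0 /\ sol u j p (fun=> 0) (b j p m) by exact: bP.
  have db m : decays (b j p m) by have [_ []] := hb m.
  pose x m : C := a 0 m 0.
  pose c k := x ord0 *: b j p ord0 k + x 1 *: b j p 1 k + x (1 + 1) *: b j p (1 + 1) k.
  have sb : sol u j p (fun=> 0) c.
    have h m : sol u j p (fun=> 0) (fun k => x m *: b j p m k).
      have := solZ hu (x m) (hb m).2; congr sol; apply/funext => k; by rewrite scaler0.
    have := solD hu (solD hu (h ord0) (h 1)) (h (1 + 1)); congr sol; apply/funext => k.
    by rewrite !addr0.
  have ac : a = c.
    apply: (sol_unique sw p0 sa sb); rewrite /c (hb ord0).1 (hb 1).1 (hb (1 + 1)).1.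
    by apply: vec3P; rewrite !mxE !eqxx /= /x ?(mulr0, mulr1, addr0, add0r).
  have key (w : 'I_3 -> V) : (forall r m, M j p r m = ('i%C *: cross ew (w m)) r 0) ->
      'i%C *: cross ew (x ord0 *: w ord0 + x 1 *: w 1 + x (1 + 1) *: w (1 + 1)) = M j p *m a 0.
    move=> Mw; rewrite !crossDr !crossZr; apply/matrixP => r o; rewrite ord1 [RHS]mxE sum3 !Mw /x.
    move: (cross _ _) (cross _ _) (cross _ _) (a 0) => w1 w2 w3 y; rewrite !mxE; ring.
  rewrite -(key (fun m => convs u (b j p m) 0)) ?ac; last by move=> r m; exact: ME.
  by rewrite !(convsD hu, convsZ hu)//; do ?apply: decaysD; apply: decaysZ.
- have [D D0 hD] := convs_lip; exists (3 * D) => [|j p p' i m sw p0 p0']; first by rewrite mulr_ge0.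
  have [b0 sb] := bP _ _ m sw p0; have [b0' sb'] := bP _ _ m sw p0'.
  rewrite !ME -mulrA; apply: le_trans (entry_le _ _ i) _.
  by rewrite ler_wpM2l//; apply: (hD j) => //; rewrite b0 ?b0' ?vn_delta.
- have [D D0 hD] := convs_small; exists (3 * D) => [|t p i m ht p0]; first by rewrite mulr_ge0.
  have [b0 sb] := bP _ _ m (small_wave_scale ht) p0; have [b0' sb'] := bP _ _ m small0 (lexx (Re 0)).
  rewrite !ME -mulrA; apply: le_trans (entry_le _ _ i) _.
  by rewrite ler_wpM2l//; apply: hD => //; rewrite b0 ?b0' ?vn_delta.
Qed.

(** A kernel vector h of q - A - E q is taken as the mean of a solution on the nonzero modes;
    multiplied by t, the relation q h = (A + E q) h is the missing equation at the mode 0. *)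
Theorem discrete_instability (A : 'M[C]_3) mu :
  (forall a, sol u 0 0 (fun=> 0) a -> A *m a 0 = 'i%C *: cross ew (convs u a 0)) ->
  simple_eigenvalue A mu -> 0 < Re mu ->
  exists (t : R) (q : C) (a : K -> V), [/\ 0 < t <= 1, 0 < Re q, decays a, a 0 != 0 &
    forall k, ((kap2 (t *: e) k)%:C%C + t%:C%C * q) *: a k = 'i%C *: cross (kap (t *: e) k) (convs u a k)].
Proof.
move=> hA simA mu0.
have [Mt [MtP' [D D0 hD] [F F0 hF]]] := response_matrix.
have A0E : A = Mt 0 0.
  apply/matrixP => r m.
  have [a a0 sa] := sol_exists hu c0_gt0 (delta_mx m 0) small0 (lexx (Re 0)).
  have := MtP' _ _ _ small0 (lexx (Re 0)) sa; rewrite -hA// a0 -!colE => /matrixP/(_ r 0).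
  by rewrite mxE [RHS]mxE.
(* On this disc Re q stays positive, so p = tq remains in the half-plane where solutions exist. *)
pose r := Re mu / 2; have r0' : 0 < r by rewrite divr_gt0.
have [d0 d00 pert] := simple_eigenvalue_perturb simA r0'.
pose Q : R := cm mu + r; have Q0 : 0 <= Q by rewrite addr_ge0 ?cm_ge0 ?ltW.
(* |p| <= t Q bounds the entries of E by (F (1 + Q) + 1) t, and p = tq makes them Lipschitz in q
   with constant D t. *)
pose L : R := D + F * (1 + Q) + 1.
have L0 : 0 < L by rewrite ltr_wpDl// addr_ge0// mulr_ge0// addr_ge0.
have /andP[kU0 kU1] := fc_kU hu.
pose t : R := Num.min ((1 - kU) / 4) (d0 / L).
have t0 : 0 < t by rewrite lt_min !divr_gt0// subr_gt0.
have ht : 0 <= t <= (1 - kU) / 4 by rewrite (ltW t0)/= ge_min lexx.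
have tL : L * t <= d0 by rewrite mulrC -ler_pdivlMr// ge_min lexx orbT.
have sw := small_wave_scale ht.
have Rq q : cm (q - mu) <= r -> 0 < Re q.
  move=> hq; have := le_trans (Re_le_cm _) hq; rewrite ReD ReN ler_norml => /andP[h _].
  by rewrite /r in h; lra.
have Rp q : cm (q - mu) <= r -> 0 <= Re (t%:C%C * q).
  by move=> hq; rewrite ReM /= mul0r subr0 mulr_ge0 ?ltW// Rq.
(* The last term is the diffusion |te|^2 = t^2 of the mean, divided by t. *)
pose E q : 'M[C]_3 := Mt (t *: e) (t%:C%C * q) - Mt 0 0 - t%:C%C%:M.
have hE q q' i m : cm (q - mu) <= r -> cm (q' - mu) <= r ->
    cm (E q i m) <= L * t /\ cm (E q i m - E q' i m) <= L * t * cm (q - q').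
  move=> hq hq'; have T0 := ltW t0.
  have hqQ : cm q <= Q.
    by rewrite -[q](subrK mu) (le_trans (cmD _ _))// addrC lerD2l.
  have Eq z : E z i m = (Mt (t *: e) (t%:C%C * z) i m - Mt 0 0 i m) - (t%:C%C *+ (i == m)) by rewrite !mxE.
  split.
    rewrite Eq; apply: le_trans (cmB _ _) _; rewrite /L mulrDl mul1r; apply: lerD; last first.
      by case: (i == m); rewrite ?mulr1n ?mulr0n ?cm0// cmR ger0_norm.
    apply: le_trans (hF _ _ _ _ ht (Rp q hq)) _.
    rewrite cmM cmR (ger0_norm T0) mulrDl -[leLHS]add0r; apply: lerD; first exact: mulr_ge0.
    by rewrite -mulrA ler_wpM2l// mulrDl mul1r lerD2l mulrC ler_wpM2r.
  have -> : E q i m - E q' i m = Mt (t *: e) (t%:C%C * q) i m - Mt (t *: e) (t%:C%C * q') i m.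
    by rewrite !Eq; move: (Mt _ _ _ _) (Mt _ _ _ _) (Mt _ _ _ _) => X Y Z; ring.
  apply: le_trans (hD _ _ _ _ _ sw (Rp q hq) (Rp q' hq')) _.
  rewrite -mulrBr cmM cmR (ger0_norm T0) mulrA ler_wpM2r ?cm_ge0// ler_wpM2r// /L.
  have := mulr_ge0 F0 (addr_ge0 ler01 Q0); lra.
have [q hq det0] : exists2 q, cm (q - mu) <= r & \det (q%:M - (A + E q)) = 0.
  by apply: (pert _ (L * t)) => //; rewrite tL mulr_ge0// ltW.
have [h h0 hh] := det_eigenvector det0.
have [a a0 sa] := sol_exists hu c0_gt0 h sw (Rp q hq).
have [da ea] := sa; have hM := MtP' _ _ _ sw (Rp q hq) sa.
exists t, q, a; split=> //; rewrite ?a0//.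
- by rewrite t0 /=; have /andP[_ ?] := ht; lra.
- exact: Rq.
move=> k; have [->|k0] := eqVneq k 0; last by have := ea k k0; rewrite addr0.
have k0E : kap2 (t *: e) 0 = t ^+ 2.
  by rewrite kap2E !sum3 !kc0; ring.
have kapE : kap (t *: e) 0 = t%:C%C *: ew.
  by apply/matrixP => i o; rewrite ord1 !mxE kc0 add0r rmorphM.
rewrite k0E kapE crossZl scalerA ['i%C * _]mulrC -scalerA hM a0.
have : Mt (t *: e) (t%:C%C * q) *m h = q *: h + t%:C%C *: h.
  by rewrite -hh A0E /E -[t%:C%C *: h]mul_scalar_mx -mulmxDl -addrA subrK addrC subrK.
move=> ->; rewrite -scalerDl scalerA; congr (_ *: _); rewrite rmorphXn /=; ring.
Qed.

End Instability.

(** * Fourier coefficients of distributions *)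

Section Spectrum.
Context {R : realType}.
Local Notation C := (R[i])%C.
Local Notation R3 := (R * R * R)%type.
Local Notation V := 'cV[C]_3.
Local Notation K := 'cV[int]_3.
Local Notation cm := (@Normc.normc R).
Local Notation rho := (@rho R).
Local Notation kc := (@kc R).
Implicit Types (k l : K) (F G : R3 -> V) (phi : R3 -> R) (a : K -> V) (T S : @distr R) (c d : K -> C).

Let r0 t k : 0 <= rho k ^- t.
Proof. by rewrite invr_ge0 exprn_ge0// ltW// rho_gt0. Qed.

Let ii : 'i%C * 'i%C = -1 :> C.
Proof. by rewrite -expr2 sqr_i. Qed.

(* [c] is the family of Fourier coefficients of the distribution [T]. *)
Definition spec T c := forall phi, test phi -> exists2 D, 0 <= D & forall N,
  cm (((2 * pi) ^- 3)%:C%C * T phi - \sum_(k <- box N) fcr phi k * c (- k)) <= D / N.+1%:R.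

Lemma test_partial phi i : test phi -> test (partial i phi).
Proof. by move=> [sp pp]; split; [exact: smooth_partial|exact: periodic_partial]. Qed.

Lemma eq_spec T c d : c =1 d -> spec T c -> spec T d.
Proof. by move=> /funext ->. Qed.

Lemma specD T S c d : spec T c -> spec S d -> spec (fun phi => T phi + S phi) (fun k => c k + d k).
Proof.
move=> hT hS phi tp; have [D D0 hD] := hT phi tp; have [E E0 hE] := hS phi tp.
exists (D + E) => [|N]; first exact: addr_ge0.
under eq_bigr => k _ do rewrite mulrDr.
rewrite mulrDr big_split /= opprD addrACA [leRHS]mulrDl; apply: le_trans (cmD _ _) _. exact: lerD.
Qed.

Lemma specZ z T c : spec T c -> spec (fun phi => z * T phi) (fun k => z * c k).
Proof.
move=> hT phi tp; have [D D0 hD] := hT phi tp.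
exists (cm z * D) => [|N]; first by rewrite mulr_ge0 ?cm_ge0.
under eq_bigr => k _ do rewrite mulrCA.
by rewrite mulrCA -mulr_sumr -mulrBr cmM -mulrA ler_wpM2l ?cm_ge0.
Qed.

Lemma specN T c : spec T c -> spec (fun phi => - T phi) (fun k => - c k).
Proof.
move=> hT; have := specZ (-1) hT.
have -> : (fun phi => -1 * T phi) = (fun phi => - T phi) by apply/funext => phi; rewrite mulN1r.
by apply: eq_spec => k; rewrite mulN1r.
Qed.

Lemma spec_sum (I : Type) (s : seq I) (T : I -> distr) (c : I -> K -> C) : (forall i, spec (T i) (c i)) ->
  spec (fun phi => \sum_(i <- s) T i phi) (fun k => \sum_(i <- s) c i k).
Proof.
move=> h; elim: s => [|i s IH].
  move=> phi _; exists 0 => // N; rewrite big_nil mulr0 sub0r cmN mul0r.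
  by rewrite big1 ?cm0// => k _; rewrite big_nil mulr0.
have := specD (h i) IH.
have -> : (fun phi => T i phi + \sum_(i <- s) T i phi) = fun phi => \sum_(i <- i :: s) T i phi.
  by apply/funext => phi; rewrite big_cons.
by apply: eq_spec => k; rewrite big_cons.
Qed.

Lemma spec_dpartial i T c : spec T c -> spec (dpartial i T) (fun k => 'i%C * (kc k i)%:C%C * c k).
Proof.
move=> hT phi tp; have [D D0 hD] := hT _ (test_partial i tp); exists D => // N.
rewrite -cmN; have := hD N; congr (cm _ <= _); have [sp pp] := tp.
rewrite /dpartial mulrN opprB addrC opprK -sumrN; congr (_ + _); apply: eq_bigr => k _.
by rewrite fcr_partial// kcN rmorphN; ring.
Qed.

Lemma spec_nabla (j : 'cV[R]_3) i T c : spec T c ->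
  spec (nabla j i T) (fun k => 'i%C * (kap j k i 0) * c k).
Proof.
move=> hT; have := specD (spec_dpartial i hT) (specZ ('i%C * (j i 0)%:C%C) hT).
by apply: eq_spec => k; rewrite mxE rmorphD; ring.
Qed.

Lemma spec_curl (j : 'cV[R]_3) (T : 'I_3 -> distr) (w : K -> V) i :
  (forall m, spec (T m) (fun k => w k m 0)) ->
  spec (curl j T i) (fun k => ('i%C *: cross (kap j k) (w k)) i 0).
Proof.
move=> hT; have := specD (spec_nabla j (i + 1) (hT (i + 2))) (specN (spec_nabla j (i + 2) (hT (i + 1)))).
by apply: eq_spec => k; rewrite [RHS]mxE [cross _ _ _ _]mxE mulrBr !mulrA.
Qed.

Lemma spec_div (j : 'cV[R]_3) (T : 'I_3 -> distr) (w : K -> V) :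
  (forall m, spec (T m) (fun k => w k m 0)) -> spec (div j T) (fun k => 'i%C * dotc (kap j k) (w k)).
Proof.
move=> hT; have := spec_sum (index_enum 'I_3) (fun m => spec_nabla j m (hT m)).
by apply: eq_spec => k; rewrite /dotc mulr_sumr; apply: eq_bigr => m _; rewrite mulrA.
Qed.

Lemma spec_laplacian T c : spec T c -> spec (laplacian T) (fun k => - (kap2 0 k)%:C%C * c k).
Proof.
move=> hT; have := spec_sum (index_enum 'I_3) (fun m => spec_dpartial m (spec_dpartial m hT)).
apply: eq_spec => k; rewrite /kap2 rmorph_sum mulNr mulr_suml -sumrN; apply: eq_bigr => m _.
rewrite mxE addr0 rmorphXn /=.
have -> : 'i%C * (kc k m)%:C%C * ('i%C * (kc k m)%:C%C * c k) = ('i%C * 'i%C) * ((kc k m)%:C%C ^+ 2 * c k) by ring.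
by rewrite ii mulN1r.
Qed.

Lemma spec_nabla_sq (j : 'cV[R]_3) T c : spec T c -> spec (nabla_sq j T) (fun k => - (kap2 j k)%:C%C * c k).
Proof.
move=> hT.
have h1 := specZ (2 * 'i%C) (spec_sum (index_enum 'I_3) (fun m => specZ (j m 0)%:C%C (spec_dpartial m hT))).
have := specD (specD (spec_laplacian hT) h1) (specN (specZ (enorm j ^+ 2)%:C%C hT)).
apply: eq_spec => k.
have -> : enorm j ^+ 2 = \sum_m j m 0 ^+ 2 by rewrite sqr_sqrtr// sumr_ge0// => m _; exact: sqr_ge0.
rewrite /kap2 !sum3 !mxE !addr0 !rmorphD !rmorphXn /= !rmorphD.
rewrite [X in _ + X + _](_ : _ = 2 * ('i%C * 'i%C) * ((j ord0 0)%:C%C * (kc k ord0)%:C%C +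
  (j 1 0)%:C%C * (kc k 1)%:C%C + (j (1 + 1) 0)%:C%C * (kc k (1 + 1))%:C%C) * c k); last by ring.
rewrite ii; ring.
Qed.

(** Both distributions are limits of the same sums. Together with [spec_eq] this makes an equation
    of distributions equivalent to its mode equations. *)
Lemma spec_unique T S c d : spec T c -> spec S d -> c =1 d -> distr_eq T S.
Proof.
move=> hT hS cd phi tp; have [D D0 hD] := hT phi tp; have [E E0 hE] := hS phi tp.
apply: cm_le0; have z0 : ((2 * pi) ^- 3)%:C%C != 0 :> C.
  by rewrite fmorph_eq0 invr_neq0// pi3_neq0.
have := cm_gt0 (((2 * pi) ^- 3)%:C%C : C); rewrite z0 => pz.
rewrite -(pmulr_rle0 _ pz) -cmM mulrBr.
apply: (le0_of_rate (c := D + E) (N0 := 0)) => N _.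
have := hE N; have := hD N.
have -> : \sum_(k <- box N) fcr phi k * c (- k) = \sum_(k <- box N) fcr phi k * d (- k).
  by apply: eq_bigr => k _; rewrite cd.
move: (\sum_(k <- _) _) => s h1 h2; rewrite [leRHS]mulrDl.
have -> : ((2 * pi) ^- 3)%:C%C * T phi - ((2 * pi) ^- 3)%:C%C * S phi =
  (((2 * pi) ^- 3)%:C%C * T phi - s) - (((2 * pi) ^- 3)%:C%C * S phi - s) by ring.
by apply: le_trans (cmB _ _) _; apply: lerD.
Qed.

Lemma test_trig k (a b : R) : test (trig k a b).
Proof. by split; [exact: trig_smooth|exact: trig_periodic]. Qed.

(** The character of -k is assembled from its real and imaginary parts, both of them test functions;
    against it the sum reduces to the single coefficient at k. *)
Lemma spec_eq T S c d : spec T c -> spec S d -> distr_eq T S -> c =1 d.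
Proof.
move=> hT hS TS k.
have cE (x y : R) : x%:C%C + 'i%C * y%:C%C = Complex x y.
  by apply: complex_ext; rewrite ?ReD ?ImD ?ReM ?ImM /=; ring.
have [D1 D10 h1] := hT _ (test_trig (- k) 1 0); have [D2 D20 h2] := hT _ (test_trig (- k) 0 1).
have [E1 E10 g1] := hS _ (test_trig (- k) 1 0); have [E2 E20 g2] := hS _ (test_trig (- k) 0 1).
have hf l : fcr (trig (- k) 1 0 : R3 -> R) l + 'i%C * fcr (trig (- k) 0 1 : R3 -> R) l = (- k == l)%:R.
  have ci (x y : R) : cint (fun z => (trig (- k) x y z)%:C%C) by exact/cint_real/rbm_int/trig_rbm.
  have := fcD l (ci 1 0) (cintZ 'i%C (ci 0 1)); rewrite (fcZ _ _ (ci 0 1)) => e.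
  have E : @ee R (- k) = fun x : R3 => (trig (- k) 1 0 x : R)%:C%C + 'i%C * (trig (- k) 0 1 x : R)%:C%C.
    by apply/funext => x; rewrite cE ee_trig.
  by rewrite -(fc_ee (- k) l) E e.
have [N0 hN0] := in_some_box [:: - k].
have S0 (f : K -> C) N : (N0 <= N)%N ->
    \sum_(l <- box N) fcr (trig (- k) 1 0) l * f (- l) + 'i%C * \sum_(l <- box N) fcr (trig (- k) 0 1) l * f (- l) = f k.
  move=> NN; rewrite mulr_sumr -big_split /= (bigD1_seq (- k)) ?box_uniq//=; last first.
    by apply: (box_le NN); apply: hN0; rewrite inE.
  rewrite mulrA -mulrDl hf eqxx mul1r opprK big1 ?addr0// => l lk.
  by rewrite mulrA -mulrDl hf eq_sym (negbTE lk) mul0r.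
apply: cm_le0; apply: (le0_of_rate (c := D1 + D2 + (E1 + E2)) (N0 := N0)) => N NN.
have := h1 N; have := h2 N; have := g1 N; have := g2 N.
rewrite -(TS _ (test_trig (- k) 1 0)) -(TS _ (test_trig (- k) 0 1)) -(S0 c N NN) -(S0 d N NN).
move: (_ * T _) (_ * T _) => t1 t2.
move: (\sum_(l <- _) _) (\sum_(l <- _) _) (\sum_(l <- _) _) (\sum_(l <- _) _) => s1 s2 s3 s4 b1 b2 b3 b4.
have -> : s1 + 'i%C * s2 - (s3 + 'i%C * s4) = - ((t1 - s1) + 'i%C * (t2 - s2)) + ((t1 - s3) + 'i%C * (t2 - s4)) by ring.
rewrite [leRHS]mulrDl; apply: le_trans (cmD _ _) _; rewrite cmN; apply: lerD; rewrite [leRHS]mulrDl;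
  by apply: le_trans (cmD _ _) _; rewrite cmM cm_i mul1r lerD.
Qed.

Definition fcv F k : V := \col_i fc (fun x => F x i 0) k.

Lemma spec_distr_of F i : cint (fun x => F x i 0) -> spec (distr_of F i) (fun k => fcv F k i 0).
Proof.
move=> hF phi [sp pp]; have [D D0 hD] := parseval hF sp pp; exists D => // N.
by under eq_bigr => k _ do rewrite mxE.
Qed.

(** Unlike [fourier_conv] this gives no rate, but it loses no decay and applies from s = 0 on, as
    the bootstrap for correctors requires. *)
Lemma fc_mul_decay (F : R3 -> C) (f : R3 -> R) s : cint F -> smooth f -> periodic f ->
  exists2 D, 0 <= D & forall A, 0 <= A -> (forall k, cm (fc F k) <= A * rho k ^- s) ->
  forall k, cm (fc (fun x => F x * (f x)%:C%C) k) <= D * A * rho k ^- s.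
Proof.
move=> hF sf pf; have [B B0 hB] := fcr_decay (s + 6) sf pf.
exists (B * 64) => [|A A0 hA k]; first by rewrite mulr_ge0.
have hFk : cint (fun x => F x * ee (- k) x) by apply: cintM => //; exact: cbm_ee.
have [D D0 hD] := parseval hFk sf pf.
rewrite -subr_le0; apply: (le0_of_rate (c := D) (N0 := 0)) => N _.
have e1 : fc (fun x => F x * (f x)%:C%C) k = avg (fun x => F x * ee (- k) x * (f x)%:C%C).
  by apply: avg_eq => x _; ring.
have e2 l : fc (fun x => F x * ee (- k) x) (- l) = fc F (k - l).
  by apply: avg_eq => x _; rewrite opprK opprB -mulrA -eeD addrC.
have := hD N; rewrite -e1; under eq_bigr => l _ do rewrite e2.
set s' := \sum_(l <- _) _ => h.
have hs : cm s' <= B * 64 * A * rho k ^- s.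
  apply: le_trans (cm_sum _ _ _) _.
  apply: (@le_trans _ _ (\sum_(l <- box N) B * A * (rho l ^- (s + 6) * rho (k - l) ^- s))).
    by apply: ler_sum => l _; rewrite cmM mulrACA; apply: ler_pM; rewrite ?cm_ge0.
  have -> : B * 64 * A * rho k ^- s = B * A * (64 * rho k ^- s) by ring.
  rewrite -mulr_sumr ler_wpM2l ?mulr_ge0//.
  have -> : \sum_(l <- box N) rho l ^- (s + 6) * rho (k - l) ^- s =
      \sum_(l <- [seq k - l | l <- box N]) rho (k - l) ^- (s + 6) * rho l ^- s.
    by rewrite [RHS]big_map; under [in RHS]eq_bigr => l _ do rewrite subKr.
  by apply: rho_conv; rewrite map_inj_uniq ?box_uniq// => p q /addrI/oppr_inj.
rewrite lerBlDr -[fc _ _](subrK s'); apply: le_trans (cmD _ _) _; exact: lerD.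
Qed.

Section Field.
Variable U : R3 -> 'cV[R]_3.
Hypothesis sU : forall i, smooth (fun x => U x i 0).
Hypothesis pU : periodic U.
Let pUi i : periodic (fun x => U x i 0).
Proof. by move=> m x; rewrite pU. Qed.

Definition ucoef k : V := \col_i fcr (fun x => U x i 0) k.

Definition ucross F x := cross (cvec (U x)) (F x).

Let Ub i : cbm (fun x => (U x i 0)%:C%C).
Proof. exact/cbm_real/smooth_rbm. Qed.

Let ucrossE F i : (fun x => ucross F x i 0) =
  (fun x => F x (i + 2) 0 * (U x (i + 1) 0)%:C%C + -1 * (F x (i + 1) 0 * (U x (i + 2) 0)%:C%C)).
Proof. by apply/funext => x; rewrite !mxE mulN1r !(mulrC (_%:C)%C). Qed.

Lemma ucross_cint F i : (forall m, cint (fun x => F x m 0)) -> cint (fun x => ucross F x i 0).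
Proof.
by move=> hF; rewrite ucrossE; apply: cintD; [exact: cintM|apply: cintZ; exact: cintM].
Qed.

Let fc_ucross F i k : (forall m, cint (fun x => F x m 0)) -> fcv (ucross F) k i 0 =
  fc (fun x => F x (i + 2) 0 * (U x (i + 1) 0)%:C%C) k - fc (fun x => F x (i + 1) 0 * (U x (i + 2) 0)%:C%C) k.
Proof.
move=> hF; rewrite mxE ucrossE fcD; [|exact: cintM|apply: cintZ; exact: cintM].
by rewrite fcZ ?mulN1r//; exact: cintM.
Qed.

Lemma fcv_ucross_decay F s A : (forall m, cint (fun x => F x m 0)) -> 0 <= A ->
  (forall k, vn (fcv F k) <= A * rho k ^- s) ->
  exists2 B, 0 <= B & forall k, vn (fcv (ucross F) k) <= B * rho k ^- s.
Proof.
move=> hF A0 hA.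
have hi m k : cm (fc (fun x => F x m 0) k) <= A * rho k ^- s.
  by apply: le_trans (hA k); have := vn_coord (fcv F k) m; rewrite mxE.
have H i : exists2 B, 0 <= B & forall k, cm (fcv (ucross F) k i 0) <= B * rho k ^- s.
  have [D D0 hD] := fc_mul_decay s (hF (i + 2)) (sU (i + 1)) (@pUi (i + 1)).
  have [E E0 hE] := fc_mul_decay s (hF (i + 1)) (sU (i + 2)) (@pUi (i + 2)).
  exists (D * A + E * A) => [|k]; first by rewrite addr_ge0 ?mulr_ge0.
  rewrite fc_ucross// mulrDl; apply: le_trans (cmB _ _) _; apply: lerD; [exact: hD|exact: hE].
have [B1 B10 h1] := H ord0; have [B2 B20 h2] := H 1; have [B3 B30 h3] := H (1 + 1).
exists (B1 + B2 + B3) => [|k]; first by rewrite !addr_ge0.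
by rewrite /vn sum3 !mulrDl !lerD.
Qed.

(** Each component is a difference of two instances of [fourier_conv] with s = 0, whose rates
    identify the limit [convs]. *)
Lemma fcv_ucross F kU : field_coefs ucoef kU -> (forall m, cint (fun x => F x m 0)) -> decays (fcv F) ->
  forall k, fcv (ucross F) k = convs ucoef (fcv F) k.
Proof.
move=> hu hF dF k; have [A A0 hA] := dF 7%N.
have hi m l : cm (fc (fun x => F x m 0) l) <= A * rho l ^- (0 + 7).
  by apply: le_trans (hA l); have := vn_coord (fcv F l) m; rewrite mxE.
have H i : exists2 D, 0 <= D & forall N, cm ((fcv (ucross F) k - conv ucoef (box N) (fcv F) k) i 0) <= D / N.+1%:R.
  have [D D0 hD] := fourier_conv (hF (i + 2)) (sU (i + 1)) (@pUi (i + 1)) A0 (hi (i + 2)).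
  have [E E0 hE] := fourier_conv (hF (i + 1)) (sU (i + 2)) (@pUi (i + 2)) A0 (hi (i + 1)).
  exists (D + E) => [|N]; first exact: addr_ge0.
  have eN (x y : V) : (x - y) i 0 = x i 0 - y i 0 by rewrite 2!mxE.
  rewrite eN fc_ucross// /conv summxE.
  have -> : \sum_(l <- box N) cross (ucoef (k - l)) (fcv F l) i 0 =
     \sum_(l <- box N) fcr (fun x => U x (i + 1) 0) (k - l) * fc (fun x => F x (i + 2) 0) l -
     \sum_(l <- box N) fcr (fun x => U x (i + 2) 0) (k - l) * fc (fun x => F x (i + 1) 0) l.
    by rewrite -sumrB; apply: eq_bigr => l _; rewrite !mxE.
  have key (z1 z2 s1 s2 : C) : z1 - z2 - (s1 - s2) = (z1 - s1) - (z2 - s2) by ring.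
  rewrite key mulrDl; have := hD k N; have := hE k N; rewrite expr0 invr1 !mulr1 => h2 h1.
  by apply: le_trans (cmB _ _) _; apply: lerD.
have [D1 D10 h1] := H ord0; have [D2 D20 h2] := H 1; have [D3 D30 h3] := H (1 + 1).
apply/esym; apply: (convs_unique hu (c := D1 + D2 + D3) dF) => N.
by rewrite /vn sum3 !mulrDl !lerD.
Qed.

End Field.

Definition Hfield a x : V := \col_i fser (fun k => a k i 0) x.

Lemma Hfield_cbm a i : decays a -> cbm (fun x => Hfield a x i 0).
Proof.
move=> da; have [B B0 hB] := da 7%N.
have h k : cm (a k i 0) <= B * rho k ^- 7 by apply: le_trans (vn_coord _ _) (hB k).
by apply: cbm_ext (fser_cbm B0 h) => x; rewrite mxE.
Qed.

Lemma fcv_Hfield a : decays a -> fcv (Hfield a) = a.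
Proof.
move=> da; have [B B0 hB] := da 7%N; apply/funext => k; apply/matrixP => i o; rewrite ord1 mxE.
have h l : cm (a l i 0) <= B * rho l ^- 7 by apply: le_trans (vn_coord _ _) (hB l).
have -> : (fun x => Hfield a x i 0) = fser (fun k => a k i 0) by apply/funext => x; rewrite mxE.
exact: (fc_fser B0 h).
Qed.

Lemma Hfield_periodic a : periodic (Hfield a).
Proof. by move=> i x; apply/matrixP => m o; rewrite !mxE fser_periodic. Qed.

End Spectrum.

(** * The velocity gradient as a quadratic form on modes *)

Section Strain.
Context {R : realType}.
Local Notation C := (R[i])%C.
Local Notation R3 := (R * R * R)%type.
Local Notation V := 'cV[C]_3.
Local Notation K := 'cV[int]_3.
Local Notation cm := (@Normc.normc R).
Local Notation Re := (@complex.Re R).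
Local Notation Im := (@complex.Im R).
Local Notation rho := (@rho R).
Local Notation kc := (@kc R).
Local Notation mu := (@lebesgue_measure R).
Local Notation mu3 := ((mu \x mu) \x mu)%E.
Local Notation T1 := (measurableTypeR R).
Local Notation T3 := (T1 * T1 * T1)%type.
Implicit Types (k l : K) (w v : 'cV[R]_3) (M : 'M[R]_3).

Lemma enorm_sqr w : enorm w ^+ 2 = \sum_i w i 0 ^+ 2.
Proof. by rewrite sqr_sqrtr// sumr_ge0// => i _; exact: sqr_ge0. Qed.

Lemma enorm_ge0 w : 0 <= enorm w. Proof. exact: sqrtr_ge0. Qed.

Lemma enormZ (t : R) w : enorm (t *: w) = `|t| * enorm w.
Proof.
apply/eqP; rewrite -(@eqrXn2 _ 2)// ?mulr_ge0 ?enorm_ge0// exprMn real_normK ?num_real// !enorm_sqr.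
by rewrite mulr_sumr; apply/eqP; apply: eq_bigr => i _; rewrite mxE exprMn.
Qed.

Lemma enorm_le_sum w : enorm w <= \sum_i `|w i 0|.
Proof.
rewrite -(@ler_pXn2r _ 2)// ?nnegrE ?enorm_ge0 ?sumr_ge0// enorm_sqr !sum3.
rewrite -!(real_normK (num_real (w _ _))).
have := normr_ge0 (w ord0 0); have := normr_ge0 (w 1 0); have := normr_ge0 (w (1 + 1) 0).
move: `|_| `|_| `|_| => x y z z0 y0 x0.
have := mulr_ge0 x0 y0; have := mulr_ge0 x0 z0; have := mulr_ge0 y0 z0; nra.
Qed.

Lemma coord_le_enorm w i : `|w i 0| <= enorm w.
Proof.
rewrite -(@ler_pXn2r _ 2)// ?nnegrE ?enorm_ge0// enorm_sqr real_normK ?num_real//.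
by rewrite (bigD1 i)//= lerDl sumr_ge0// => *; exact: sqr_ge0.
Qed.

(** [sup] dominates the elements of a bounded set only; the sum of the |M i j| bounds this one. *)
Lemma opnorm_ub M w : enorm w <= 1 -> enorm (M *m w) <= opnorm M.
Proof.
move=> w1; apply: ub_le_sup; last by exists w.
exists (\sum_i \sum_j `|M i j|) => _ [v /= v1 <-]; apply: le_trans (enorm_le_sum _) _.
apply: ler_sum => i _; rewrite mxE; apply: le_trans (ler_norm_sum _ _ _) _; apply: ler_sum => j _.
by rewrite normrM ler_piMr// (le_trans (coord_le_enorm _ _)).
Qed.

Lemma cauchy_schwarz3 (a b : 'I_3 -> R) :
  (\sum_i a i * b i) ^+ 2 <= (\sum_i a i ^+ 2) * (\sum_i b i ^+ 2).
Proof.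
rewrite !sum3 -subr_ge0.
have -> : (a ord0 ^+ 2 + a 1 ^+ 2 + a (1 + 1) ^+ 2) * (b ord0 ^+ 2 + b 1 ^+ 2 + b (1 + 1) ^+ 2) -
    (a ord0 * b ord0 + a 1 * b 1 + a (1 + 1) * b (1 + 1)) ^+ 2 =
  (a ord0 * b 1 - a 1 * b ord0) ^+ 2 + (a ord0 * b (1 + 1) - a (1 + 1) * b ord0) ^+ 2 +
  (a 1 * b (1 + 1) - a (1 + 1) * b 1) ^+ 2 by ring.
by rewrite !addr_ge0 ?sqr_ge0.
Qed.

Lemma opnorm_form M (c : R) w : opnorm M <= c -> 0 <= c ->
  \sum_i w i 0 * (M *m w) i 0 <= c * \sum_i w i 0 ^+ 2.
Proof.
move=> Mc c0.
have h : enorm (M *m w) <= c * enorm w.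
  have [w0|w0] := eqVneq (enorm w) 0.
    have -> : w = 0.
      apply/matrixP => i j; rewrite ord1 mxE; apply/eqP; rewrite -normr_le0 -w0; exact: coord_le_enorm.
    by rewrite mulmx0 -(scale0r (0 : 'cV[R]_3)) !enormZ normr0 !mul0r mulr0.
  have N0 : 0 < enorm w by rewrite lt_neqAle eq_sym w0 enorm_ge0.
  have := opnorm_ub M (w := (enorm w)^-1 *: w); rewrite enormZ ger0_norm ?invr_ge0 ?enorm_ge0//.
  rewrite mulVf// -scalemxAr enormZ ger0_norm ?invr_ge0 ?enorm_ge0// => /(_ (lexx _)) h.
  by have := le_trans h Mc; rewrite mulrC ler_pdivrMr.
have /= CS := cauchy_schwarz3 (fun i => w i 0) (fun i => (M *m w) i 0).
have S0 : 0 <= \sum_i w i 0 ^+ 2 by apply: sumr_ge0 => i _; exact: sqr_ge0.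
rewrite (le_trans (ler_norm _))// -(@ler_pXn2r _ 2)// ?nnegrE ?mulr_ge0// real_normK ?num_real//.
have h2 : \sum_i (M *m w) i 0 ^+ 2 <= c ^+ 2 * \sum_i w i 0 ^+ 2.
  by rewrite -!enorm_sqr -exprMn lerXn2r ?nnegrE ?mulr_ge0 ?enorm_ge0.
apply: le_trans CS _; move: (\sum_i w i 0 ^+ 2) S0 h2 => S S0 h2.
have -> : (c * S) ^+ 2 = S * (c ^+ 2 * S) by ring.
by rewrite ler_wpM2l.
Qed.

(** f agrees almost everywhere with max (f, 0). *)
Lemma icube_ge0_ae (f : R3 -> R) : rbm f -> {ae @leb3 R, forall x, 0 <= f x} -> 0 <= icube f.
Proof.
move=> hf h.
have -> : icube f = icube (fun x => Num.max (f x) 0).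
  have mf := hf.1.
  have [m0 _] := rbm_cst (0 : R).
  have mm : measurable_fun setT (fun x => Num.max (f x) 0) by exact: (measurable_maxr mf m0).
  congr fine.
  apply: (@ae_eq_integral _ T3 R mu3 (@cube R) _ _ measurable_cube).
  - exact: (@measurable_funTS _ _ T3 _ _ _ (measurableT_comp (@EFin_measurable R setT) mf)).
  - exact: (@measurable_funTS _ _ T3 _ _ _ (measurableT_comp (@EFin_measurable R setT) mm)).
  - case: h => N [mN N0 hN]; exists N; split=> // x /= hx; apply: hN => /= fx; apply: hx => _.
    by congr EFin; rewrite max_l.
by apply: icube_ge0 => x _; rewrite le_max lexx orbT.
Qed.

Section Coefs.
Variable U : R3 -> 'cV[R]_3.
Hypothesis admU : admissible U.

Let sU i : smooth (fun x => U x i 0). Proof. by case: admU. Qed.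
Let pUi i : periodic (fun x => U x i 0).
Proof. by case: admU => _ pU _ _ _ m x; rewrite pU. Qed.
Let Ui i : R3 -> R := fun x => U x i 0.

Let r0 t k : 0 <= rho k ^- t.
Proof. by rewrite invr_ge0 exprn_ge0// ltW// rho_gt0. Qed.

(** The essential supremum is an extended real; truncation at 0 gives a real kU and also covers the
    value -oo, while the strict bound by 1 survives. *)
Lemma jacobian_bound : exists2 kU : R, 0 <= kU < 1 &
  {ae @leb3 R, forall x, opnorm (Defs.jacobian U x) <= kU}.
Proof.
case: admU => _ _ _ _; rewrite unlock /=.
(* The norm is defined by cases on whether the whole space has positive measure; in the other case
   it is itself a null set. *)
case: ifPn => [_|h0 _]; last first.
  exists 0; first by rewrite lexx ltr01.
  exists setT; split=> //.
  by apply/eqP; rewrite -measure_le0 leNgt.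
set f := (abse \o _).
have key (s : \bar R) : (s < 1)%E ->
    0 <= Num.max 0 (fine s) < 1 /\ (s <= (Num.max 0 (fine s))%:E)%E.
  case: s => [r| |] //= s1; last by rewrite maxxx lexx ltr01; split=> //; exact: leNye.
  rewrite le_max lexx gt_max ltr01 /= -lte_fin s1; split=> //.
  by rewrite lee_fin le_max lexx orbT.
move=> /key[k1 /ess_supP h]; exists (Num.max 0 (fine (ess_sup leb3 f))) => //.
apply: filterS h => x; rewrite /f /= lee_fin; exact: le_trans (ler_norm _).
Qed.

Let d m n : R3 -> C := fun x => (partial n (Ui m) x)%:C%C.

Let cbm_d m n : cbm (d m n).
Proof. apply/cbm_real/smooth_rbm; [exact: (smooth_partial n (sU m))|exact: (periodic_partial n (@pUi m))]. Qed.

Let fc_d m n k : fc (d m n) k = 'i%C * (kc k n)%:C%C * ucoef U k m 0.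
Proof. by rewrite mxE; exact: (fcr_partial k n (sU m) (@pUi m)). Qed.

Section Form.
Variables (A : seq K) (T : K -> V).
Hypothesis uA : uniq A.
Let S n x : C := \sum_(k <- A) T k n 0 * ee k x.
Let cS n : cbm (S n).
Proof. by apply: cbm_sum => k _; apply: cbmM; [exact: cbm_cst|exact: cbm_ee]. Qed.

Let expand (g : R3 -> C) m n x : (S m x)^*%C * g x * S n x =
  \sum_(k <- A) \sum_(l <- A) ((T k m 0)^*%C * T l n 0) * (g x * ee (- (k - l)) x).
Proof.
rewrite /S conj_sum mulr_suml mulr_suml; apply: eq_bigr => k _.
rewrite mulr_sumr; apply: eq_bigr => l _.
by rewrite conjM ee_conj opprB addrC eeD; ring.
Qed.

Let avg_expand (g : R3 -> C) m n : cbm g -> avg (fun x => (S m x)^*%C * g x * S n x) =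
  \sum_(k <- A) \sum_(l <- A) ((T k m 0)^*%C * T l n 0) * fc g (k - l).
Proof.
move=> cg; have -> : (fun x => (S m x)^*%C * g x * S n x) = fun x =>
    \sum_(k <- A) \sum_(l <- A) ((T k m 0)^*%C * T l n 0) * (g x * ee (- (k - l)) x).
  by apply/funext => x; exact: expand.
have ci k l : cint (fun x => g x * ee (- (k - l)) x) by apply/cbm_int/cbmM => //; exact: cbm_ee.
rewrite avg_sum => [|k _]; last by apply: cint_sum => l _; exact/cintZ/ci.
apply: eq_bigr => k _; rewrite avg_sum => [|l _]; last exact/cintZ/ci.
by apply: eq_bigr => l _; rewrite avgZ.
Qed.

Let P x : C := \sum_m \sum_n (S m x)^*%C * d m n x * S n x.

Let avgP : avg P = \sum_(k <- A) \sum_(l <- A)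
  dotc (conjv (T k)) (('i%C * dotc (kap 0 (k - l)) (T l)) *: ucoef U (k - l)).
Proof.
have ci m n : cint (fun x => (S m x)^*%C * d m n x * S n x).
  by apply/cbm_int/cbmM/cS/cbmM/cbm_d/cbm_conj/cS.
rewrite /P avg_sum => [|m _]; last by apply: cint_sum.
under eq_bigr => m _ do rewrite avg_sum//.
under eq_bigr => m _ do under eq_bigr => n _ do rewrite (avg_expand _ _ (cbm_d m n)).
under eq_bigr => m _ do rewrite exchange_big /=.
rewrite exchange_big /=; apply: eq_bigr => k _.
under eq_bigr => m _ do rewrite exchange_big /=.
rewrite exchange_big /=; apply: eq_bigr => l _.
have eZ z (v : V) m : (z *: v) m 0 = z * v m 0 by rewrite mxE.
rewrite /dotc; apply: eq_bigr => m _; rewrite [conjv _ _ _]mxE eZ.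
rewrite mulr_sumr mulr_suml mulr_sumr; apply: eq_bigr => n _.
have -> : kap 0 (k - l) n 0 = (kc (k - l) n)%:C%C by rewrite !mxE addr0.
rewrite fc_d; ring.
Qed.

Let avgS n : avg (fun x => (S n x)^*%C * S n x) = \sum_(k <- A) (cm (T k n 0) ^+ 2)%:C%C.
Proof.
have -> : (fun x => (S n x)^*%C * S n x) = fun x => (S n x)^*%C * 1 * S n x.
  by apply/funext => x; rewrite mulr1.
rewrite (avg_expand _ _ (cbm_cst 1)); apply: eq_big_seq => k kA.
rewrite (bigD1_seq k)//= fc_cst subrr eqxx !mulr1 big1 => [|l lk].
  by rewrite addr0 mulrC mul_conj.
by rewrite fc_cst subr_eq0 eq_sym (negbTE lk) !mulr0.
Qed.

(** With S the trigonometric polynomial of coefficients T, the double sum is the average of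
    conj(S).(grad U) S. The gradient being real, the real part is the sum of its forms at Re S and
    Im S, each bounded pointwise by the operator norm; the average of |S|^2 is the sum of the
    [v2 (T k)]. *)
Lemma strain_form kU : 0 <= kU -> {ae @leb3 R, forall x, opnorm (Defs.jacobian U x) <= kU} ->
  Re (\sum_(k <- A) \sum_(l <- A)
    dotc (conjv (T k)) (('i%C * dotc (kap 0 (k - l)) (T l)) *: ucoef U (k - l)))
  <= kU * \sum_(k <- A) v2 (T k).
Proof.
move=> kU0 hJ; rewrite -avgP.
pose Q x : C := \sum_n (S n x)^*%C * S n x.
have cQ : cbm Q by apply: cbm_sum => n _; apply/cbmM/cS/cbm_conj/cS.
have cP : cbm P by apply: cbm_sum => m _; apply: cbm_sum => n _; apply/cbmM/cS/cbmM/cbm_d/cbm_conj/cS.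
have avgQ : avg Q = (\sum_(k <- A) v2 (T k))%:C%C.
  rewrite /Q avg_sum => [|n _]; last by apply/cbm_int/cbmM/cS/cbm_conj/cS.
  under eq_bigr => n _ do rewrite avgS.
  by rewrite exchange_big rmorph_sum; apply: eq_bigr => k _; rewrite rmorph_sum.
pose G x := kU%:C%C * Q x + -1 * P x.
have cG : cbm G by apply: cbmD; apply: cbmM => //; exact: cbm_cst.
have avgG : avg G = kU%:C%C * avg Q - avg P.
  by rewrite /G avgD; [rewrite !avgZ ?mulN1r//; exact: cbm_int|apply/cintZ/cbm_int..].
have ReG x : opnorm (Defs.jacobian U x) <= kU -> 0 <= Re (G x).
  move=> hx; pose a : 'cV[R]_3 := \col_i Re (S i x); pose b : 'cV[R]_3 := \col_i Im (S i x).
  have EQ : Re (Q x) = \sum_i a i 0 ^+ 2 + \sum_i b i 0 ^+ 2.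
    rewrite Re_sum -big_split; apply: eq_bigr => i _.
    by rewrite ReM Re_conj Im_conj !mxE mulNr opprK -!expr2.
  have EP : Re (P x) = \sum_i a i 0 * (Defs.jacobian U x *m a) i 0 + \sum_i b i 0 * (Defs.jacobian U x *m b) i 0.
    rewrite Re_sum -big_split; apply: eq_bigr => m _.
    have eM (w : 'cV[R]_3) : (Defs.jacobian U x *m w) m 0 = \sum_n Defs.jacobian U x m n * w n 0 by rewrite mxE.
    rewrite Re_sum !eM !mulr_sumr -big_split; apply: eq_bigr => n _.
    rewrite !ReM !ImM Re_conj Im_conj /= !mxE; ring.
  rewrite /G ReD mulN1r ReN ReM /= mul0r subr0 EQ EP subr_ge0 mulrDr.
  by apply: lerD; exact: opnorm_form.
have : 0 <= Re (avg G).
  rewrite /avg ReM /= mul0r subr0; apply: mulr_ge0.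
    by rewrite invr_ge0 exprn_ge0// ltW// twopi_gt0.
  apply: icube_ge0_ae; first by case: cG.
  case: hJ => N [mN N0 hN]; exists N; split=> // x hx; apply: hN => /= hJx; apply: hx; exact: ReG.
by rewrite avgG avgQ ReD ReN ReM /= mul0r subr0 subr_ge0.
Qed.

End Form.

Lemma admissible_coefs : exists kU, field_coefs (ucoef U) kU.
Proof.
have [kU hkU hJ] := jacobian_bound; exists kU.
have ci i : cint (fun x => (U x i 0)%:C%C) by exact/cbm_int/cbm_real/smooth_rbm.
split=> //.
- move=> k; apply/matrixP => i o; rewrite ord1 !mxE /fcr /fc -avg_conj; last first.
    by apply: cintM => //; exact: cbm_ee.
  by apply: avg_eq => x _; rewrite conjM conj_real ee_conj.
- move=> k.
  have : \sum_i fc (d i i) k = 0.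
    have -> : \sum_i fc (d i i) k = fc (fun x => \sum_i d i i x) k.
      rewrite /fc -avg_sum => [|i _]; last by apply/cbm_int/cbmM/cbm_ee/cbm_d.
      by apply: avg_eq => x _; rewrite mulr_suml.
    have -> : (fun x => \sum_i d i i x) = fun=> 0.
      by apply/funext => x; rewrite /d -rmorph_sum; case: admU => _ _ _ -> _.
    by rewrite fc_cst mul0r.
  under eq_bigr => i _ do rewrite fc_d -mulrA.
  have i0 : 'i%C != 0 :> C by rewrite -cm_eq0 cm_i oner_eq0.
  rewrite -mulr_sumr => /eqP; rewrite mulf_eq0 (negbTE i0) /= => /eqP <-.
  by apply: eq_bigr => i _; rewrite !mxE addr0.
- apply/matrixP => i o; rewrite ord1 !mxE /fcr /fc.
  have -> : avg (fun x => (U x i 0)%:C%C * ee (- 0) x) = avg (fun x => (U x i 0)%:C%C).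
    by apply: avg_eq => x _; rewrite oppr0 ee0 mulr1.
  rewrite /avg cintegralE; case: admU => _ _ h _ _.
  have -> : icube (Re \o (fun x => (U x i 0)%:C%C)) = 0 by exact: h.
  have -> : icube (Im \o (fun x => (U x i 0)%:C%C)) = 0 by have := icube_cst (R := R) 0; rewrite mul0r.
  by rewrite mulr0.
- move=> s.
  have H i := fcr_decay s (sU i) (@pUi i).
  have [D1 D10 h1] := H ord0; have [D2 D20 h2] := H 1; have [D3 D30 h3] := H (1 + 1).
  exists (D1 + D2 + D3) => [|k]; first by rewrite !addr_ge0.
  by rewrite /vn sum3 !mxE !mulrDl !lerD.
- by move=> A T uA; apply: strain_form => //; case/andP: hkU.
Qed.

End Coefs.
End Strain.

(** * Correctors, and the theorem *)

Section Assembly.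
Context {R : realType}.
Local Notation C := (R[i])%C.
Local Notation R3 := (R * R * R)%type.
Local Notation V := 'cV[C]_3.
Local Notation K := 'cV[int]_3.
Local Notation cm := (@Normc.normc R).
Local Notation Re := (@complex.Re R).
Local Notation Im := (@complex.Im R).
Local Notation rho := (@rho R).
Local Notation mu := (@lebesgue_measure R).
Local Notation mu3 := ((mu \x mu) \x mu)%E.
Local Notation T1 := (measurableTypeR R).
Local Notation T3 := (T1 * T1 * T1)%type.
Implicit Types (k l : K) (F G : R3 -> V) (a : K -> V) (v : V).

Let sq F x : R := \sum_i (Re (F x i 0) ^+ 2 + Im (F x i 0) ^+ 2).

Let sq_ge0 F x : 0 <= sq F x.
Proof. by apply: sumr_ge0 => i _; rewrite addr_ge0 ?sqr_ge0. Qed.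

Let abs_sq F : (fun x => `|(EFin \o sq F) x|%E) = EFin \o sq F.
Proof. by apply/funext => x /=; rewrite ger0_norm// sq_ge0. Qed.

(** The cube has finite measure, and |y| <= 1 + y^2. *)
Lemma L2_cint F : L2 F -> forall i, cint (fun x => F x i 0).
Proof.
move=> [_ mr mi hf] i.
have ms : measurable_fun setT (sq F).
  have -> : sq F = fun x => \sum_(i < 3) (Re (F x i 0) * Re (F x i 0) + Im (F x i 0) * Im (F x i 0)) by [].
  apply: measurable_sum => m; apply: measurable_funD; exact: measurable_funM.
have isq : rint (fun x => 1 + sq F x).
  apply: rintD; first exact/rbm_int/rbm_cst.
  apply/integrableP; split.
    exact: (@measurable_funTS _ _ T3 _ _ _ (measurableT_comp (@EFin_measurable R setT) ms)).
  by rewrite abs_sq; exact: hf.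
have dom (f : R3 -> R) : measurable_fun setT f -> (forall x, f x ^+ 2 <= sq F x) -> rint f.
  move=> mf fs; apply: (le_integrable measurable_cube _ _ isq).
    exact: (@measurable_funTS _ _ T3 _ _ _ (measurableT_comp (@EFin_measurable R setT) mf)).
  move=> x _ /=; rewrite lee_fin [leRHS]ger0_norm ?addr_ge0 ?sq_ge0//.
  apply: le_trans (_ : 1 + f x ^+ 2 <= _); last by rewrite lerD2l.
  have := sqr_ge0 (`|f x| - 1); rewrite -(real_normK (num_real (f x))); have := normr_ge0 (f x).
  by move: `|f x| => y y0; nra.
have le_sq x : Re (F x i 0) ^+ 2 + Im (F x i 0) ^+ 2 <= sq F x.
  by rewrite /sq (bigD1 i)//= lerDl sumr_ge0// => m _; rewrite addr_ge0 ?sqr_ge0.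
split.
  by apply: dom => [|x]; [exact: mr|apply: le_trans (le_sq x); rewrite lerDl sqr_ge0].
by apply: dom => [|x]; [exact: mi|apply: le_trans (le_sq x); rewrite lerDr sqr_ge0].
Qed.

Lemma L2_of_cbm F : periodic F -> (forall i, cbm (fun x => F x i 0)) -> L2 F.
Proof.
move=> pF cF; split=> // [i|i|].
- by have [[]] := cF i.
- by have [_ []] := cF i.
have h i : rbm (fun x => Re (F x i 0) * Re (F x i 0) + Im (F x i 0) * Im (F x i 0)).
  by have [h1 h2] := cF i; apply: rbmD; apply: rbmM.
have rs : rint (sq F).
  have -> : sq F = fun x => Re (F x ord0 0) * Re (F x ord0 0) + Im (F x ord0 0) * Im (F x ord0 0) +
      (Re (F x 1 0) * Re (F x 1 0) + Im (F x 1 0) * Im (F x 1 0)) +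
      (Re (F x (1 + 1) 0) * Re (F x (1 + 1) 0) + Im (F x (1 + 1) 0) * Im (F x (1 + 1) 0)).
    by apply/funext => x; rewrite /sq sum3 !expr2.
  by apply/rbm_int/rbmD/h/rbmD/h/h.
by have /integrableP[_] := rs; rewrite abs_sq.
Qed.

Lemma cintegral_ae0 F i : cbm (fun x => F x i 0) -> ae_eq (@leb3 R) (@cube R) F (fun=> 0) ->
  cintegral (fun x => F x i 0) = 0.
Proof.
move=> cF [N [mN N0 hN]].
have H (f : R3 -> R) : rbm f -> (forall x, F x = 0 -> f x = 0) -> icube f = 0.
  move=> [mf _] f0; rewrite -(mul0r ((2 * pi) ^+ 3)) -icube_cst; congr fine.
  apply: (@ae_eq_integral _ T3 R mu3 (@cube R) _ _ measurable_cube).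
  - exact: (@measurable_funTS _ _ T3 _ _ _ (measurableT_comp (@EFin_measurable R setT) mf)).
  - have [m0 _] := rbm_cst (0 : R).
    exact: (@measurable_funTS _ _ T3 _ _ _ (measurableT_comp (@EFin_measurable R setT) m0)).
  - exists N; split=> // x /= hx; apply: hN => /= hF; apply: hx => cx.
    by congr EFin; exact/f0/hF.
rewrite cintegralE (H _ cF.1) ?(H _ cF.2)// => x /= ->; by rewrite mxE.
Qed.

(* Adding the constant v to the corrector S(v) makes the corrector equation
   homogeneous. *)
Definition delta0 v k : V := if k == 0 then v else 0.

Lemma delta0_decays v : decays (delta0 v).
Proof.
move=> s; exists (vn v) => [|k]; first exact: vn_ge0.
rewrite /delta0; case: eqP => [->|_]; first by rewrite rho0 expr1n invr1 mulr1.
by rewrite vn0 mulr_ge0 ?vn_ge0// invr_ge0 exprn_ge0// ltW// rho_gt0.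
Qed.

Lemma fcv_cst v k : fcv (fun=> v) k = delta0 v k.
Proof.
apply/matrixP => i o; rewrite ord1 mxE fc_cst /delta0.
by case: eqP => _; rewrite ?mulr1 ?mulr0 ?mxE.
Qed.

Lemma fcvD F G k : (forall i, cint (fun x => F x i 0)) -> (forall i, cint (fun x => G x i 0)) ->
  fcv (fun x => F x + G x) k = fcv F k + fcv G k.
Proof.
move=> cF cG; apply/matrixP => i o; rewrite ord1 !mxE -fcD//.
by apply: avg_eq => x _; rewrite mxE.
Qed.

Lemma cintv_add F G i : (forall i, cint (fun x => F x i 0)) -> (forall i, cint (fun x => G x i 0)) ->
  cint (fun x => (F x + G x) i 0).
Proof. by move=> cF cG; apply: cint_ext (cintD (cF i) (cG i)) => x; rewrite mxE. Qed.

Section Corrector.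
Variable U : R3 -> 'cV[R]_3.
Hypothesis admU : admissible U.
Variable kU : R.
Hypothesis hu : field_coefs (ucoef U) kU.
Hypothesis sw0 : small_wave kU ((1 - kU) / 2) (0 : 'cV[R]_3).

Let sU i : smooth (fun x => U x i 0). Proof. by case: admU. Qed.
Let pU : periodic U. Proof. by case: admU. Qed.

Let cU i : cint (fun x => (U x i 0)%:C%C).
Proof. by apply/cint_real/rbm_int/smooth_rbm => // m x; rewrite pU. Qed.

Let vcrossE v i : (fun x => cross v (cvec (U x)) i 0) =
  fun x => v (i + 1) 0 * (U x (i + 2) 0)%:C%C + (- v (i + 2) 0) * (U x (i + 1) 0)%:C%C.
Proof. by apply/funext => x; rewrite !mxE mulNr. Qed.

Let vcross_cint v i : cint (fun x => cross v (cvec (U x)) i 0).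
Proof. by rewrite vcrossE; apply: cintD; apply: cintZ. Qed.

Let fcv_vcross v k : fcv (fun x => cross v (cvec (U x))) k = cross v (ucoef U k).
Proof.
apply/matrixP => i o; rewrite ord1 mxE vcrossE fcD ?fcZ//; try exact: cintZ.
by rewrite !mxE mulNr.
Qed.

Let convs_delta0 v k : convs (ucoef U) (delta0 v) k = cross (ucoef U k) v.
Proof.
apply: (convs_unique hu (c := 0) (delta0_decays v)) => N.
rewrite mul0r /conv (bigD1_seq 0) ?box_uniq ?box0//= big1 => [|l l0].
  by rewrite subr0 addr0 /delta0 eqxx subrr vn0.
by rewrite /delta0 (negbTE l0) cross0r.
Qed.

Let spec_field F i : (forall m, cint (fun x => F x m 0)) ->
  spec (curl 0 (distr_of (fun x => cross (cvec (U x)) (F x))) i)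
    (fun k => ('i%C *: cross (kap 0 k) (fcv (ucross U F) k)) i 0).
Proof.
move=> cF; apply: spec_curl => m; apply: spec_distr_of.
exact: (@ucross_cint _ _ sU pU F m cF).
Qed.

Let spec_rhs v i : spec (curl 0 (distr_of (fun x => cross v (cvec (U x)))) i)
  (fun k => ('i%C *: cross (kap 0 k) (cross v (ucoef U k))) i 0).
Proof.
apply: spec_curl => m; have := spec_distr_of (vcross_cint v m).
by apply: eq_spec => k; rewrite fcv_vcross.
Qed.

Let spec_lhs F i : (forall m, cint (fun x => F x m 0)) ->
  spec (fun phi => curl 0 (distr_of (fun x => cross (cvec (U x)) (F x))) i phi
                   + laplacian (distr_of F i) phi)
    (fun k => ('i%C *: cross (kap 0 k) (fcv (ucross U F) k) - (kap2 0 k)%:C%C *: fcv F k) i 0).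
Proof.
move=> cF; have := specD (spec_field i cF) (spec_laplacian (spec_distr_of (cF i))).
by apply: eq_spec => k; rewrite [RHS]mxE [X in _ = _ + X]mxE [X in _ = _ - X]mxE mulNr.
Qed.

Let kap00 : kap 0 0 = 0 :> V.
Proof. by apply/matrixP => i o; rewrite ord1 !mxE kc0 addr0. Qed.

Let kap200 : kap2 0 0 = 0 :> R.
Proof. by apply: big1 => i _; rewrite mxE kc0 addr0 expr0n. Qed.

(** Existence of a corrector, without which [corrector] would be the default value of [xget]. *)
Lemma corrector_of_sol v a : sol (ucoef U) 0 0 (fun=> 0) a -> a 0 = v ->
  is_corrector U v (Hfield (fun k => a k + -1 *: delta0 v k)).
Proof.
move=> [da ea] a0; set b := fun k => _.
have db : decays b by apply: decaysD => //; exact/decaysZ/delta0_decays.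
have cS i : cint (fun x => Hfield b x i 0) by exact/cbm_int/Hfield_cbm.
split.
- by apply: L2_of_cbm => [|i]; [exact: Hfield_periodic|exact: Hfield_cbm].
- apply/matrixP => i o; rewrite ord1 !mxE.
  have : fcv (Hfield b) 0 i 0 = 0.
    by rewrite fcv_Hfield// /b a0 /delta0 eqxx scaleN1r subrr mxE.
  rewrite mxE /fc /avg => /eqP; rewrite mulf_eq0 fmorph_eq0 invr_eq0 (negbTE (pi3_neq0 (R := R))) /= => /eqP <-.
  by apply: cintegral_eq => x _; rewrite oppr0 ee0 mulr1.
- move=> i; apply: (spec_unique (spec_lhs i cS) (spec_rhs v i)) => k.
  rewrite (fcv_ucross sU pU hu cS) fcv_Hfield//.
  rewrite /b (convsD hu)//; last exact/decaysZ/delta0_decays.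
  rewrite (convsZ hu)//; last exact: delta0_decays.
  rewrite convs_delta0 scaleN1r crossBr scalerBr.
  have [->|k0] := eqVneq k 0.
    by rewrite kap00 kap200 !cross0l scaler0 subrr scale0r subr0.
  have := ea k k0; rewrite !addr0 => <-.
  rewrite /delta0 (negbTE k0) scaler0 addr0 addrAC subrr sub0r.
  by rewrite [cross v _]crossC crossNr scalerN.
Qed.

(** The definite description may return any L^2 solution, so its regularity has to be derived from
    the equation: [spec_eq] yields the mode equations, and these the decay. *)
Lemma sol_of_corrector v S : is_corrector U v S ->
  exists a, [/\ sol (ucoef U) 0 0 (fun=> 0) a, a 0 = v &
    vaverage (fun x => cross (cvec (U x)) (S x)) = convs (ucoef U) a 0].
Proof.
move=> [L2S S0 eqS]; have cS := L2_cint L2S.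
pose F x := S x + v.
have cv i : cint (fun _ : R3 => v i 0) by exact/cbm_int/cbm_cst.
have cF i : cint (fun x => F x i 0) by exact: (@cintv_add S (fun=> v)).
have cUS i := @ucross_cint _ _ sU pU S i cS.
have cUv i := @ucross_cint _ _ sU pU (fun=> v) i cv.
have eF k : fcv F k = fcv S k + delta0 v k by rewrite fcvD// fcv_cst.
have eUv k : fcv (ucross U (fun=> v)) k = cross (ucoef U k) v.
  apply/matrixP => i o; rewrite ord1 mxE.
  have -> : (fun x => ucross U (fun=> v) x i 0) =
      fun x => v (i + 2) 0 * (U x (i + 1) 0)%:C%C + (- v (i + 1) 0) * (U x (i + 2) 0)%:C%C.
    by apply/funext => x; rewrite !mxE; ring.
  rewrite fcD ?fcZ//; try exact: cintZ.
  by rewrite !mxE /fcr; ring.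
have eUF k : fcv (ucross U F) k = fcv (ucross U S) k + cross (ucoef U k) v.
  have -> : ucross U F = fun x => ucross U S x + ucross U (fun=> v) x.
    by apply/funext => x; rewrite /ucross crossDr.
  by rewrite fcvD// eUv.
have eqk k : k != 0 -> (kap2 0 k)%:C%C *: fcv F k = 'i%C *: cross (kap 0 k) (fcv (ucross U F) k).
  move=> k0; rewrite eF eUF /delta0 (negbTE k0) addr0 crossDr scalerDr.
  have E : 'i%C *: cross (kap 0 k) (fcv (ucross U S) k) - (kap2 0 k)%:C%C *: fcv S k =
      'i%C *: cross (kap 0 k) (cross v (ucoef U k)).
    apply/matrixP => i o; rewrite ord1.
    exact: (spec_eq (spec_lhs i cS) (spec_rhs v i) (eqS i) k).
  by move/eqP: E; rewrite subr_eq => /eqP ->; rewrite [cross v _]crossC crossNr scalerN addrAC addNr add0r.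
have F0 : fcv F 0 = v.
  rewrite eF /delta0 eqxx -[RHS]add0r; congr (_ + _); apply/matrixP => i o; rewrite ord1 !mxE.
  have -> : fc (fun x => S x i 0) 0 = ((2 * pi) ^- 3)%:C%C * cintegral (fun x => S x i 0).
    by apply: avg_eq => x _; rewrite oppr0 ee0 mulr1.
  by have /matrixP/(_ i 0) := S0; rewrite !mxE => ->; rewrite mulr0.
(* Bootstrap: integrability bounds the coefficients, multiplication by U keeps a decay, and solving
   the mode equation gains one power, rho^-2 from the symbol against rho from the curl. *)
have dF : decays (fcv F).
  elim=> [|s [A A0 hA]].
    have H i : exists2 L, 0 <= L & forall k, cm (fcv F k i 0) <= L.
      have [L L0 hL] := avg_bound (cF i); exists L => // k; rewrite mxE -[L]mulr1.
      by apply: hL => [|x _]; [exact: cbm_ee|rewrite cm_ee].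
    have [D1 D10 h1] := H ord0; have [D2 D20 h2] := H 1; have [D3 D30 h3] := H (1 + 1).
    exists (D1 + D2 + D3) => [|k]; first by rewrite !addr_ge0.
    by rewrite expr0 invr1 mulr1 /vn sum3 !lerD.
  have [B B0 hB] := fcv_ucross_decay sU pU cF A0 hA.
  exists (48 * B + vn v) => [|k]; first by rewrite addr_ge0 ?mulr_ge0 ?vn_ge0.
  have r0 t : 0 <= rho k ^- t by rewrite invr_ge0 exprn_ge0// ltW// rho_gt0.
  have [k0|k0] := eqVneq k 0.
    by rewrite {1}k0 F0 k0 rho0 expr1n invr1 mulr1 lerDr mulr_ge0.
  apply: (@le_trans _ _ (48 * B * rho k ^- s.+1)); last by rewrite ler_wpM2r// lerDl vn_ge0.
  have low := sw_lower sw0 k0; have rk := rho_gt0 (R := R) k.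
  have q0 : 0 < kap2 (0 : 'cV[R]_3) k by apply: lt_le_trans low; rewrite divr_gt0 ?exprn_gt0.
  have zq : (kap2 0 k)%:C%C != 0 :> C by rewrite fmorph_eq0 gt_eqF.
  have -> : fcv F k = ((kap2 0 k)%:C%C)^-1 *: ('i%C *: cross (kap 0 k) (fcv (ucross U F) k)).
    by rewrite -eqk// scalerA mulVf// scale1r.
  rewrite vnZ cmV cmR gtr0_norm// vnZ cm_i mul1r.
  have -> : 48 * B * rho k ^- s.+1 = (rho k ^+ 2 / 48)^-1 * (rho k * (B * rho k ^- s)).
    by rewrite [rho k ^+ s.+1]exprS; field; rewrite !expf_neq0 ?rho_neq0.
  apply: ler_pM; rewrite ?invr_ge0 ?vn_ge0 ?(ltW q0)//.
    by rewrite lef_pV2 ?posrE// divr_gt0 ?exprn_gt0.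
  by apply: le_trans (vn_cross _ _) _; apply: ler_pM; rewrite ?vn_ge0//; exact: (sw_upper sw0).
have econv := fcv_ucross sU pU hu cF dF.
exists (fcv F); split=> //.
  by split=> // k k0; rewrite !addr0 eqk// econv.
(* U is mean-free, so v contributes nothing to the mean of U x F. *)
rewrite -econv eUF (fc_zero hu) cross0l addr0.
apply/matrixP => i o; rewrite ord1 !mxE /fc /avg; congr (_ * _).
by apply: cintegral_eq => x _; rewrite oppr0 ee0 mulr1 mxE.
Qed.

End Corrector.

End Assembly.

Theorem proposition1p2 (R : realType) (U : (R * R * R)%type -> 'cV[R]_3) :
  alpha_unstable U ->
  exists (j : 'cV[R]_3) (p : (R[i])%C)
         (H : (R * R * R)%type -> 'cV[(R[i])%C]_3),
    [/\ enorm j <= 1,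
        0 < complex.Re p,
        L2 H /\ ~ ae_eq (@leb3 R) (@cube R) H (fun=> 0),
        forall k : 'I_3, distr_eq
          (fun phi =>
             curl j (distr_of (fun x => cross (cvec (U x)) (H x))) k phi
             + nabla_sq j (distr_of H k) phi)
          (fun phi => p * distr_of H k phi)
      & distr_eq (div j (distr_of H)) (fun=> 0)].
Proof.
move=> [admU [j0 [A [mu [j0n0 hA simA mu0]]]]].
have [kU hu] := admissible_coefs admU.
have sU : forall i, smooth (fun x => U x i 0) by case: admU.
have pU : Defs.periodic U by case: admU.
pose e := (enorm j0)^-1 *: j0.
have N0 : 0 < enorm j0.
  rewrite lt_neqAle enorm_ge0 andbT eq_sym; apply: contraNneq j0n0 => h.
  apply/eqP/matrixP => i o; rewrite ord1 mxE; apply/eqP; rewrite -normr_le0 -h; exact: coord_le_enorm.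
have ne : enorm e = 1 by rewrite enormZ ger0_norm ?invr_ge0 ?enorm_ge0// mulVf ?gt_eqF.
have e1 : \sum_i e i 0 ^+ 2 = 1 by rewrite -enorm_sqr ne expr1n.
have /andP[kU0 kU1] := fc_kU hu.
have sw0 : small_wave kU ((1 - kU) / 2) (0 : 'cV[R]_3).
  rewrite -(scale0r e); apply: (small_wave_scale hu e1).
  by rewrite lexx divr_ge0// subr_ge0 ltW.
(* A corrector exists, so the description yields one; it corresponds to a solution with mean [a 0],
   which is a itself by uniqueness. *)
have hA' a : sol (ucoef U) 0 0 (fun=> 0) a ->
    A *m a 0 = 'i%C *: cross (\col_i (e i 0)%:C%C) (convs (ucoef U) a 0).
  move=> sa; have ex : exists S, [set S | is_corrector U (a 0) S] S.
    by eexists; exact: (corrector_of_sol admU hu sa erefl).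
  have := xgetPex (fun=> 0) ex; rewrite -/(corrector U (a 0)) => cor.
  have [b [sb b0 eb]] := sol_of_corrector admU hu sw0 cor.
  rewrite hA eb (sol_unique hu sw0 (lexx (complex.Re (0 : (R[i])%C))) sb sa b0); congr (_ *: cross _ _).
  by apply/matrixP => i o; rewrite ord1 !mxE.
have [t [q [a [/andP[t0 t1] q0 da a0 ea]]]] := discrete_instability hu e1 hA' simA mu0.
exists (t *: e), (t%:C%C * q), (Hfield a).
have cH i : cbm (fun x => Hfield a x i 0) by exact: Hfield_cbm.
have ciH i : cint (fun x => Hfield a x i 0) by exact/cbm_int/cH.
have fH : fcv (Hfield a) = a by exact: fcv_Hfield.
split.
- by rewrite enormZ ne mulr1 ger0_norm// ltW.
- by rewrite ReM /= mul0r subr0 mulr_gt0.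
- split; first by apply: L2_of_cbm; [exact: Hfield_periodic|exact: cH].
  (* The mean of H is [a 0], and a field that vanishes almost everywhere has mean zero. *)
  move=> h; case/eqP: a0; rewrite -fH; apply/matrixP => i o; rewrite ord1 !mxE.
  have -> : fc (fun x => Hfield a x i 0) 0 = ((2 * pi) ^- 3)%:C%C * cintegral (fun x => Hfield a x i 0).
    by apply: avg_eq => x _; rewrite oppr0 ee0 mulr1.
  by rewrite (cintegral_ae0 (cH i)) ?mulr0.
- move=> i.
  have hcurl : forall m, spec (distr_of (fun x => cross (cvec (U x)) (Hfield a x)) m)
      (fun k => convs (ucoef U) a k m 0).
    move=> m; have := spec_distr_of (@ucross_cint _ _ sU pU (Hfield a) m ciH).
    by apply: eq_spec => k; rewrite (fcv_ucross sU pU hu) ?fH.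
  have hH : spec (distr_of (Hfield a) i) (fun k => a k i 0).
    by have := spec_distr_of (ciH i); apply: eq_spec => k; rewrite fH.
  apply: (spec_unique (specD (spec_curl (t *: e) i hcurl) (spec_nabla_sq (t *: e) hH)) (specZ (t%:C%C * q) hH)) => k.
  rewrite -ea mxE; ring.
- have hH m : spec (distr_of (Hfield a) m) (fun k => a k m 0).
    by have := spec_distr_of (ciH m); apply: eq_spec => k; rewrite fH.
  have h0 : spec (fun=> 0 : R[i]%C) (fun=> 0).
    by move=> phi _; exists 0 => // N; rewrite mulr0 big1 ?subrr ?cm0 ?mul0r// => k _; rewrite mulr0.
  apply: (spec_unique (spec_div (t *: e) hH) h0) => k.
  (* Taking the product of the mode equation with kap removes the curl term; the remaining scalar
     factor has positive real part, so a k is orthogonal to kap. *)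
  have z0 : (kap2 (t *: e) k)%:C%C + t%:C%C * q != 0.
    apply: contraTneq (mulr_gt0 t0 q0) => /(congr1 (@complex.Re R)); rewrite ReD ReM /= mul0r subr0 => z.
    rewrite -leNgt; apply: le_trans (_ : t * complex.Re q + kap2 (t *: e) k <= 0); last by rewrite addrC z.
    by rewrite lerDl sumr_ge0// => i _; exact: sqr_ge0.
  suff -> : dotc (kap (t *: e) k) (a k) = 0 by rewrite mulr0.
  by apply: (mulfI z0); rewrite mulr0 -dotcZr ea dotcZr dotc_cross mulr0.
Qed.
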